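(* Let $A$ be a non-empty compact, convex and symmetric subset of $\mathbb{R}^d$, and suppose $f$ is a measurable function on $\mathbb{R}^d$ representing a tempered distribution. Then the following are equivalent: (a) $f$ is the Fourier transform of a function in $L^2(\mathbb{R}^d)$ with support contained in $A$; (b) $f$ is in $L^2(\mathbb{R}^d)$ and extends to an entire function on $\mathbb{C}^d$ of exponential type corresponding to $A$.
   Context: Symmetric means $A=-A$. Measurable functions are identified when equal almost everywhere, and the support of an $L^2$-function is its support as a distribution. The Fourier transform is $\mathcal{F}g(\lambda)=(2\pi)^{-d/2}\int_{\mathbb{R}^d}g(x)e^{-i\lambda\cdot x}\,dx$ on $L^1(\mathbb{R}^d)$, extended to tempered distributions by $\langle\mathcal{F}T,\phi\rangle=\langle T,\mathcal{F}\phi\rangle$ for Schwartz functions $\phi$. The supporting function $H_A:\mathbb{R}^d\to\mathbb{R}$ of $A$ is $H_A(x)=\max_{a\in A}a\cdot x$. A function $F:\mathbb{C}^d\to\mathbb{C}$ is an entire function of exponential type corresponding to $A$ if $F$ is entire and there exists a positive constant $C$ such that $|F(z)|\le Ce^{H_A(\operatorname{Im}z)}$ for all $z\in\mathbb{C}^d$. *)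

(* Defs.v *)
From HB Require Import structures.
From mathcomp Require Import all_boot all_order all_algebra.
From mathcomp Require Import all_classical all_reals all_analysis.
From mathcomp Require Import complex.

Set Implicit Arguments.
Unset Strict Implicit.
Unset Printing Implicit Defensive.

Import Order.TTheory GRing.Theory Num.Theory.
Import numFieldNormedType.Exports.
Import ComplexField.Normc.

Local Open Scope classical_set_scope.
Local Open Scope ring_scope.
Local Open Scope complex_scope.

(* the usual topology of C, as a normed space over itself *)
HB.instance Definition _ (R : rcfType) := NormedModule.copy R[i] R[i]^o.

(* R^d is 'rV[R]_d and C^d is 'rV[R[i]]_d.  The sigma-algebra on R^d is the
   one generated by the coordinates, i.e. the Borel sigma-algebra. *)
Section measurable_row.
Variables (R : realType) (n : nat).

Let coords : 'I_n -> 'rV[R]_n -> R := fun i x => x ord0 i.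

Let row_set0 : g_sigma_preimage coords set0.
Proof. exact: sigma_algebra0. Qed.

Let row_setC A : g_sigma_preimage coords A -> g_sigma_preimage coords (~` A).
Proof. exact: sigma_algebraC. Qed.

Let row_bigcup (F : (set 'rV[R]_n)^nat) :
  (forall i, g_sigma_preimage coords (F i)) ->
  g_sigma_preimage coords (\bigcup_i (F i)).
Proof. exact: sigma_algebra_bigcup. Qed.

HB.instance Definition _ := @isMeasurable.Build default_measure_display
  'rV[R]_n (g_sigma_preimage coords) row_set0 row_setC row_bigcup.

Lemma measurable_coord (i : 'I_n) :
  measurable_fun [set: 'rV[R]_n] (fun x : 'rV[R]_n => x ord0 i).
Proof.
move=> _ Y mY; rewrite setTI; apply: sub_sigma_algebra => /=.
rewrite -bigcup_seq/=; exists i => /=; first by rewrite mem_index_enum.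
by exists Y => //; rewrite setTI.
Qed.

Lemma measurable_fun_coordP d (T : measurableType d) (f : T -> 'rV[R]_n) :
  (forall i, measurable_fun [set: T] (fun t => f t ord0 i)) ->
  measurable_fun [set: T] f.
Proof.
move=> mf; apply: (@measurability _ _ _ 'rV[R]_n setT f
  (\big[setU/set0]_(i < n) preimage_set_system setT (coords i) measurable)) => //.
move=> _ [B + <-]; rewrite -bigcup_seq/= => -[i _ [A mA <-]].
by rewrite setTI; exact: mf.
Qed.

End measurable_row.

Section lebesgue_row.
Variable R : realType.

Definition row_cons n (p : measurableTypeR R * 'rV[R]_n) : 'rV[R]_n.+1 :=
  \row_i (if unlift ord0 i is Some j then p.2 ord0 j else p.1).

Lemma measurable_row_cons n : measurable_fun setT (@row_cons n).
Proof.
apply: measurable_fun_coordP => i; rewrite /row_cons.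
case: (unliftP ord0 i) => [j ->|->].
  under eq_fun do rewrite mxE liftK.
  exact: (measurableT_comp (@measurable_coord R n j) measurable_snd).
under eq_fun do rewrite mxE unlift_none.
exact: measurable_fst.
Qed.

Section lebesgue_step.
Variables (n : nat) (mu : {sigma_finite_measure set 'rV[R]_n -> \bar R}).

(* the image in R^(n+1) of the product of the Lebesgue measure on R and mu *)
Definition lebesgue_step : set 'rV[R]_n.+1 -> \bar R :=
  pushforward (lebesgue_measure \x mu)%E (@row_cons n).

Let step0 : lebesgue_step set0 = 0%E.
Proof. by rewrite /lebesgue_step /pushforward preimage_set0 measure0. Qed.

Let step_ge0 A : (0 <= lebesgue_step A)%E.
Proof. exact: (measure_ge0 (lebesgue_measure \x mu)%E). Qed.

Let mpre A : measurable A -> measurable (@row_cons n @^-1` A).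
Proof.
by move=> mA; rewrite -[X in measurable X]setTI; exact: measurable_row_cons.
Qed.

Let step_sigma_additive : semi_sigma_additive lebesgue_step.
Proof.
move=> F mF tF mUF; rewrite /lebesgue_step /pushforward preimage_bigcup.
apply: measure_semi_sigma_additive.
- by move=> i; exact: mpre.
- apply/trivIsetP => /= i j _ _ ij; rewrite -preimage_setI.
  by move/trivIsetP : tF => /(_ _ _ _ _ ij) ->//; rewrite preimage_set0.
- by rewrite -preimage_bigcup; exact: mpre.
Qed.

HB.instance Definition _ := isMeasure.Build _ _ _ lebesgue_step
  step0 step_ge0 step_sigma_additive.

Let step_sigma_finite : sigma_finite setT lebesgue_step.
Proof.
have [F TF Foo] : sigma_finite setT (lebesgue_measure \x mu)%E.
  have /sigma_finiteP[F [TF ndF Foo]] := sigma_finiteT (@lebesgue_measure R).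
  have /sigma_finiteP[G [TG ndG Goo]] := sigma_finiteT mu.
  exists (fun i => F i `*` G i).
    rewrite -setXTT TF TG predeqE => -[x y]; split; last first.
      by move=> [i _ []/= ? ?]; split; exists i.
    move=> [/= [i _ Fix] [k _ Gky]]; exists (maxn i k) => //; split.
    - by move: x Fix; exact/subsetPset/ndF/leq_maxl.
    - by move: y Gky; exact/subsetPset/ndG/leq_maxr.
  move=> k; have [? ?] := Foo k; have [? ?] := Goo k.
  split; first exact: measurableX.
  by rewrite product_measure1E// lte_mul_pinfty// ge0_fin_numE.
pose u (x : 'rV[R]_n.+1) : measurableTypeR R * 'rV[R]_n :=
  (x ord0 ord0, \row_j x ord0 (lift ord0 j)).
have mu_ : measurable_fun setT u.
  apply/measurable_fun_pairP; split; first exact: measurable_coord.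
  apply: measurable_fun_coordP => i /=.
  by under eq_fun do rewrite mxE; exact: measurable_coord.
have uK p : u (row_cons p) = p.
  case: p => a b; rewrite /u /row_cons mxE unlift_none /=; congr pair.
  by apply/rowP => j; rewrite !mxE liftK.
exists (fun i => u @^-1` F i).
  by rewrite -preimage_bigcup -TF preimage_setT.
move=> i; have [mFi Fioo] := Foo i; split.
  by rewrite -[X in measurable X]setTI; exact: mu_.
rewrite /lebesgue_step /pushforward -comp_preimage.
by rewrite (_ : u \o _ = id) ?preimage_id//; apply/funext => p; exact: uK.
Qed.

HB.instance Definition _ := Measure_isSigmaFinite.Build _ _ _ lebesgue_step
  step_sigma_finite.

End lebesgue_step.

(* on the one-point space R^0 the Lebesgue measure has mass 1 *)
Definition lebesgue0 : set 'rV[R]_0 -> \bar R := \d_(0 : 'rV[R]_0).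

HB.instance Definition _ := Measure.on lebesgue0.

Let lebesgue0_sigma_finite : sigma_finite setT lebesgue0.
Proof.
apply: fin_num_fun_sigma_finite; first by rewrite /lebesgue0 dirac0.
by move=> A mA; rewrite /lebesgue0 diracE.
Qed.

HB.instance Definition _ := Measure_isSigmaFinite.Build _ _ _ lebesgue0
  lebesgue0_sigma_finite.

Fixpoint lebesgue_rV n : {sigma_finite_measure set 'rV[R]_n -> \bar R} :=
  if n is m.+1 then lebesgue_step (lebesgue_rV m) else lebesgue0.

End lebesgue_row.

Section definitions.
Variables (R : realType) (d : nat).
Local Notation Rd := 'rV[R]_d.
Local Notation Cd := 'rV[R[i]]_d.
Local Notation mu := (lebesgue_rV R d).
Implicit Types (f g phi psi : Rd -> R[i]) (A U : set Rd) (s : seq 'I_d).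

Definition dotr (x y : Rd) : R := \sum_(i < d) x ord0 i * y ord0 i.

(* f agrees almost everywhere with a Borel function, i.e. f is measurable for
   the completed (Lebesgue) sigma-algebra.  The library integral is a
   supremum over Borel simple functions below the integrand, so it does not see
   null sets and is the Lebesgue integral for such f as well. *)
Definition lebesgue_measurable f := exists g,
  [/\ measurable_fun setT (@complex.Re R \o g),
      measurable_fun setT (@complex.Im R \o g) & f = g %[ae mu]].

Definition cintegral f : R[i] :=
  (\int[mu]_x complex.Re (f x)) +i* (\int[mu]_x complex.Im (f x)).

Definition L2 f :=
  lebesgue_measurable f /\ (\int[mu]_x ((normc (f x)) ^+ 2)%:E < +oo)%E.

Definition locally_integrable f := lebesgue_measurable f /\
  forall K : set Rd, compact K -> (\int[mu]_(x in K) (normc (f x))%:E < +oo)%E.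

Definition pderivable i f := forall x,
  derivable (@complex.Re R \o f) x (delta_mx ord0 i) /\
  derivable (@complex.Im R \o f) x (delta_mx ord0 i).

Definition pderiv i f : Rd -> R[i] := fun x =>
  'D_(delta_mx ord0 i) (@complex.Re R \o f) x +i*
  'D_(delta_mx ord0 i) (@complex.Im R \o f) x.

(* Multi-indices are encoded as lists of coordinates: [:: i; i; j] stands for
   d^3/(dx_i dx_i dx_j) in pderivs and for x_i^2 x_j in monomial. *)
Definition pderivs s f : Rd -> R[i] := foldr pderiv f s.

Definition monomial s (x : Rd) : R := \prod_(i <- s) x ord0 i.

Definition smooth f := forall s,
  continuous (pderivs s f) /\ forall i, pderivable i (pderivs s f).

Definition schwartz_seminorm s1 s2 f : \bar R :=
  ereal_sup [set (`|monomial s1 x| * normc (pderivs s2 f x))%:E | x in setT].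

Definition schwartz f :=
  smooth f /\ forall s1 s2, (schwartz_seminorm s1 s2 f < +oo)%E.

(* the test functions on U, i.e. C_c^infty(U) *)
Definition test_function U phi :=
  let K := closure [set x | phi x != 0] in
  [/\ smooth phi, compact K & K `<=` U].

(* A tempered distribution is a continuous linear functional on the Schwartz
   space; the values of T outside this space are irrelevant.  Continuity is for
   the topology defined by the Schwartz seminorms. *)
Definition tempered (T : (Rd -> R[i]) -> R[i]) :=
  (forall (a : R[i]) phi psi, schwartz phi -> schwartz psi ->
     T (fun x => a * phi x + psi x) = a * T phi + T psi) /\
  (forall phi (e : R), schwartz phi -> 0 < e ->
     exists (N : nat) (delta : R), 0 < delta /\
       forall psi, schwartz psi ->
         (forall s1 s2, (size s1 <= N)%N -> (size s2 <= N)%N ->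
            (schwartz_seminorm s1 s2 (fun x => (psi x - phi x)%R)
               < delta%:E)%E) ->
         normc (T psi - T phi) < e).

Definition distr_of f (phi : Rd -> R[i]) : R[i] :=
  cintegral (fun x => f x * phi x).

Definition represents f (T : (Rd -> R[i]) -> R[i]) :=
  locally_integrable f /\
  forall phi, test_function setT phi -> T phi = distr_of f phi.

Definition distr_support (T : (Rd -> R[i]) -> R[i]) : set Rd :=
  ~` \bigcup_(U in [set U | open U /\
                     forall phi, test_function U phi -> T phi = 0]) U.

Definition fourier g : Rd -> R[i] := fun y =>
  ((2 * pi) `^ (- (d%:R / 2)))%:C *
  cintegral (fun x => g x * (cos (dotr y x) -i* sin (dotr y x))).

Definition distr_fourier (T : (Rd -> R[i]) -> R[i]) (phi : Rd -> R[i]) : R[i] :=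
  T (fourier phi).

(* f is the Fourier transform of g in the sense of tempered distributions *)
Definition is_fourier_transform f g := exists T,
  [/\ tempered T, represents f T &
      forall phi, schwartz phi -> T phi = distr_fourier (distr_of g) phi].

(* H_A; for A nonempty and compact the supremum is a maximum *)
Definition supporting_function A (x : Rd) : R := sup [set dotr a x | a in A].

Definition entire (F : Cd -> R[i]) := forall z : Cd, differentiable F z.

Definition exponential_type A (F : Cd -> R[i]) :=
  entire F /\ exists2 C : R, 0 < C &
    forall z : Cd,
      normc (F z) <= C * expR (supporting_function A (map_mx (@complex.Im R) z)).

Definition extends_to f (F : Cd -> R[i]) :=
  \forall x \ae mu, F (map_mx (real_complex R) x) = f x.

End definitions.

(* Main.v *)
(* Idea.  (b) => (a): the restriction f of F to R^d is bounded and square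
   integrable.  Put f_e(x) = f(x) exp(- e |x|^2) and let g_e be its inverse
   Fourier transform.  By Plancherel's inequality the g_e are Cauchy in L^2 along
   a fast sequence e -> 0, and their limit g has Fourier transform f.  If x is not
   in A, some u strictly separates x from A: H_A(u) + del < u.x.  On the half space
   u.y >= H_A(u) + del, shifting the contour by i t u with t of order 1/e gives
   |g_e(y)| <= C e^-d exp(- k / e), which tends to 0, so g vanishes there as a
   distribution.

   (a) => (b): by the du Bois-Reymond lemma g = 0 almost everywhere off A, so g is
   integrable and F(z) = (2 pi)^(-d/2) int_A g(x) exp(- i z.x) dx is entire, with
   |F(z)| <= C exp(H_A(Im z)).  By the multiplication formula f and F agree as
   distributions on R^d, hence almost everywhere. *)
Require Import Defs.
From HB Require Import structures.
From mathcomp Require Import all_boot all_order all_algebra.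
From mathcomp Require Import all_classical all_reals all_analysis.
From mathcomp Require Import measurable_realfun complex.
From mathcomp Require Import ring lra.

Set Implicit Arguments.
Unset Strict Implicit.
Unset Printing Implicit Defensive.

Import Order.TTheory GRing.Theory Num.Theory.
Import numFieldNormedType.Exports.
Import ComplexField.Normc.

Local Open Scope classical_set_scope.
Local Open Scope ring_scope.
Local Open Scope complex_scope.

(** * Integrals of complex-valued functions *)

(** Since f is only square integrable, its inverse transform need not be given by a convergent
    integral. The Gaussian factor cures this, and it is chosen because it is entire: it can be
    shifted together with F, at the price of a factor exp(e t^2 |u|^2), which the gain exp(- t del)
    beats when t is of order 1/e. The shift takes place on each complex line xi + w u separately,
    where Goursat's theorem for rectangles suffices; no Cauchy theory in several variables is
    involved.

    The Plancherel step uses a different regularization, the Abel weight exp(- e |y|_1): its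
    transform is a product of elementary one-variable integrals and a positive kernel of mass 1. The
    inequality alone is enough, because it makes the transforms Cauchy, and pairing with Schwartz
    functions then identifies the limit.

    Functions that are measurable only for the completed sigma-algebra are replaced by Borel
    representatives before any use of Fubini's theorem. *)

Section normc_lemmas.
Variable R : realType.
Implicit Types a b : R.
Implicit Types x y z : R[i].

Lemma sqr_normr (a : R) : `|a| ^+ 2 = a ^+ 2.
Proof. by rewrite real_normK ?num_real. Qed.

Lemma normc_ge0 x : 0 <= normc x.
Proof. by case: x => a b; rewrite sqrtr_ge0. Qed.

Lemma normc_sqr x : normc x ^+ 2 = complex.Re x ^+ 2 + complex.Im x ^+ 2.
Proof. by case: x => a b /=; rewrite sqr_sqrtr// addr_ge0 ?sqr_ge0. Qed.

Lemma normc_Re x : `|complex.Re x| <= normc x.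
Proof.
by rewrite -(ler_pXn2r (n:=2))// ?nnegrE ?normc_ge0// normc_sqr sqr_normr lerDl sqr_ge0.
Qed.

Lemma normc_Im x : `|complex.Im x| <= normc x.
Proof.
by rewrite -(ler_pXn2r (n:=2))// ?nnegrE ?normc_ge0// normc_sqr sqr_normr lerDr sqr_ge0.
Qed.

Lemma normc_le x : normc x <= `|complex.Re x| + `|complex.Im x|.
Proof.
rewrite -(ler_pXn2r (n:=2))// ?nnegrE ?normc_ge0 ?addr_ge0// normc_sqr.
by rewrite sqrrD !sqr_normr lerD2r lerDl mulrn_wge0// mulr_ge0.
Qed.

Lemma normc_real (a : R) : normc a%:C = `|a|.
Proof. by rewrite /= expr0n addr0 sqrtr_sqr. Qed.

Lemma normcB x y : normc (x - y) = normc (y - x).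
Proof. by rewrite -[in LHS]opprB normcN. Qed.

Lemma normc_conj x : normc (conjc x) = normc x.
Proof. by case: x => a b /=; rewrite sqrrN. Qed.

Lemma Re_add x y : complex.Re (x + y) = complex.Re x + complex.Re y.
Proof. by case: x; case: y. Qed.
Lemma Im_add x y : complex.Im (x + y) = complex.Im x + complex.Im y.
Proof. by case: x; case: y. Qed.
Lemma Re_opp x : complex.Re (- x) = - complex.Re x.
Proof. by case: x. Qed.
Lemma Im_opp x : complex.Im (- x) = - complex.Im x.
Proof. by case: x. Qed.
Lemma Re_mul x y : complex.Re (x * y) =
  complex.Re x * complex.Re y - complex.Im x * complex.Im y.
Proof. by case: x; case: y. Qed.
Lemma Im_mul x y : complex.Im (x * y) =
  complex.Re x * complex.Im y + complex.Im x * complex.Re y.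
Proof. by case: x => a b; case: y => c e/=; rewrite [a * e + _]addrC. Qed.

Definition ReImE := (Re_add, Im_add, Re_opp, Im_opp, Re_mul, Im_mul).

Lemma complexP x y : complex.Re x = complex.Re y -> complex.Im x = complex.Im y ->
  x = y.
Proof. by case: x; case: y => a b c e /= -> ->. Qed.

Lemma mul_conjc x : conjc x * x = (normc x ^+ 2)%:C.
Proof. by apply: complexP; rewrite ?ReImE normc_sqr; case: x => a b /=; ring. Qed.

Lemma normc_normE x : `|x| = (normc x)%:C.
Proof. by case: x. Qed.

End normc_lemmas.

Section cmeas.
Context d (T : measurableType d) (R : realType).
Implicit Types f g : T -> R[i].

Definition cmeas f := measurable_fun setT (@complex.Re R \o f) /\
  measurable_fun setT (@complex.Im R \o f).

Lemma cmeasD f g : cmeas f -> cmeas g -> cmeas (fun x => f x + g x).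
Proof.
move=> [f1 f2] [g1 g2]; split.
  rewrite [X in measurable_fun _ X](_ : _ = (fun x => complex.Re (f x) + complex.Re (g x))).
    exact: measurable_funD.
  by apply/funext => x /=; rewrite ReImE.
rewrite [X in measurable_fun _ X](_ : _ = (fun x => complex.Im (f x) + complex.Im (g x))).
  exact: measurable_funD.
by apply/funext => x /=; rewrite ReImE.
Qed.

Lemma cmeasM f g : cmeas f -> cmeas g -> cmeas (fun x => f x * g x).
Proof.
move=> [f1 f2] [g1 g2]; split.
  rewrite [X in measurable_fun _ X](_ : _ = (fun x =>
     complex.Re (f x) * complex.Re (g x) - complex.Im (f x) * complex.Im (g x))).
    by apply: measurable_funB; exact: measurable_funM.
  by apply/funext => x /=; rewrite ReImE.
rewrite [X in measurable_fun _ X](_ : _ = (fun x =>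
     complex.Re (f x) * complex.Im (g x) + complex.Im (f x) * complex.Re (g x))).
  by apply: measurable_funD; exact: measurable_funM.
by apply/funext => x /=; rewrite ReImE.
Qed.

Lemma cmeas_cst (c : R[i]) : cmeas (fun=> c).
Proof. by split; exact: measurable_cst. Qed.

Lemma cmeasN f : cmeas f -> cmeas (fun x => - f x).
Proof.
move=> mf; rewrite (_ : (fun x => _) = (fun x => -1 * f x)).
  by apply: cmeasM => //; exact: cmeas_cst.
by apply/funext => x; rewrite mulN1r.
Qed.

Lemma cmeasB f g : cmeas f -> cmeas g -> cmeas (fun x => f x - g x).
Proof. by move=> mf mg; apply: cmeasD => //; exact: cmeasN. Qed.

Lemma cmeas_conj f : cmeas f -> cmeas (fun x => conjc (f x)).
Proof.
move=> [f1 f2]; split.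
  by congr (measurable_fun _ _) : f1; apply/funext => x /=; case: (f x).
rewrite [X in measurable_fun _ X](_ : _ = (fun x => - complex.Im (f x))).
  exact: measurableT_comp.
by apply/funext => x /=; case: (f x).
Qed.

Lemma cmeas_real (h : T -> R) : measurable_fun setT h -> cmeas (fun x => (h x)%:C).
Proof. by move=> mh; split => //=; exact: measurable_cst. Qed.

Lemma cmeas_ReIm (h k : T -> R) : measurable_fun setT h -> measurable_fun setT k ->
  cmeas (fun x => h x +i* k x).
Proof. by move=> mh mk; split. Qed.

Lemma measurable_normc f : cmeas f -> measurable_fun setT (fun x => normc (f x)).
Proof.
move=> [f1 f2]; rewrite (_ : (fun x => _) =
    (fun x => Num.sqrt (complex.Re (f x) ^+ 2 + complex.Im (f x) ^+ 2))).
  apply: (measurableT_comp (continuous_measurable_fun (@sqrt_continuous R))).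
  by apply: measurable_funD; exact: measurable_funX.
by apply/funext => x; case: (f x).
Qed.

End cmeas.

Lemma cmeas_comp d (T : measurableType d) d2 (U : measurableType d2) (R : realType)
    (h : U -> T) (f : T -> R[i]) :
  measurable_fun setT h -> cmeas f -> cmeas (fun x => f (h x)).
Proof.
by move=> mh [f1 f2]; split; [have := measurableT_comp f1 mh|have := measurableT_comp f2 mh].
Qed.

Section rint.
Context d (T : measurableType d) (R : realType).
Variable mu : {measure set T -> \bar R}.
Implicit Types h k : T -> R.

Definition rint h := mu.-integrable setT (EFin \o h).

Lemma rint_measurable h : rint h -> measurable_fun setT h.
Proof. by move/measurable_int/measurable_EFinP. Qed.

Lemma rintD h k : rint h -> rint k -> rint (fun x => h x + k x).
Proof. by move=> ih ik; exact: (integrableD measurableT ih ik). Qed.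

Lemma rintZ r h : rint h -> rint (fun x => r * h x).
Proof. by move=> ih; exact: (integrableZl measurableT r ih). Qed.

Lemma rint_le h k : measurable_fun setT h -> rint k -> (forall x, `|h x| <= k x) ->
  rint h.
Proof.
move=> mh ik hk; apply: le_integrable ik => //; first exact/measurable_EFinP.
by move=> x _ /=; rewrite lee_fin (le_trans (hk x))// ler_norm.
Qed.

Lemma rintP h : (forall x, 0 <= h x) ->
  rint h <-> measurable_fun setT h /\ (\int[mu]_x (h x)%:E < +oo)%E.
Proof.
move=> h0; split=> [ih|[mh fh]].
  split; first exact: rint_measurable.
  by have /integrableP[_] := ih; rewrite (eq_integral (EFin \o h))// => x _ /=; rewrite ger0_norm.
apply/integrableP; split; first exact/measurable_EFinP.
by rewrite (eq_integral (EFin \o h))// => x _ /=; rewrite ger0_norm.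
Qed.

Lemma rint_fineK h : rint h -> (\int[mu]_x h x)%:E = (\int[mu]_x (h x)%:E)%E.
Proof. by move=> ih; rewrite /Rintegral fineK//; exact: (integrable_fin_num measurableT ih). Qed.

End rint.

Section cI.
Context d (T : measurableType d) (R : realType).
Variable mu : {measure set T -> \bar R}.
Implicit Types f g : T -> R[i].

(** The body of [cintegral] over an arbitrary measure, so that for the Lebesgue measure on R^d the
    two are convertible. *)
Definition cI f : R[i] :=
  (\int[mu]_x complex.Re (f x)) +i* (\int[mu]_x complex.Im (f x)).

Definition cint f := cmeas f /\ rint mu (fun x => normc (f x)).

Lemma cint_le f (h : T -> R) : cmeas f -> rint mu h ->
  (forall x, normc (f x) <= h x) -> cint f.
Proof.
move=> mf ih fh; split => //; apply: rint_le ih _ => //; first exact: measurable_normc.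
by move=> x; rewrite ger0_norm ?normc_ge0.
Qed.

Lemma cint_Re f : cint f -> rint mu (fun x => complex.Re (f x)).
Proof.
by move=> [[f1 f2] nf]; apply: rint_le nf _ => // x; exact: normc_Re.
Qed.

Lemma cint_Im f : cint f -> rint mu (fun x => complex.Im (f x)).
Proof.
by move=> [[f1 f2] nf]; apply: rint_le nf _ => // x; exact: normc_Im.
Qed.

Lemma cintD f g : cint f -> cint g -> cint (fun x => f x + g x).
Proof.
move=> [mf nf] [mg ng]; apply: (@cint_le _ (fun x => normc (f x) + normc (g x))).
- exact: cmeasD.
- exact: rintD.
- by move=> x; exact: le_normcD.
Qed.

Lemma cintMb f g (C : R) : cint f -> cmeas g -> (forall x, normc (g x) <= C) ->
  cint (fun x => f x * g x).
Proof.
move=> [mf nf] mg gC; apply: (@cint_le _ (fun x => C * normc (f x))).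
- exact: cmeasM.
- exact: rintZ.
- by move=> x; rewrite normcM mulrC ler_wpM2r ?normc_ge0.
Qed.

Lemma cintMl (c : R[i]) f : cint f -> cint (fun x => c * f x).
Proof.
move=> cf; rewrite (_ : (fun x => _) = (fun x => f x * c)).
  by apply: (@cintMb _ _ (normc c)) => //; exact: cmeas_cst.
by apply/funext => x; rewrite mulrC.
Qed.

Lemma cintB f g : cint f -> cint g -> cint (fun x => f x - g x).
Proof.
move=> cf cg; rewrite (_ : (fun x => _) = (fun x => f x + (-1) * g x)).
  by apply: cintD => //; exact: cintMl.
by apply/funext => x; rewrite mulN1r.
Qed.

Lemma cID f g : cint f -> cint g -> cI (fun x => f x + g x) = cI f + cI g.
Proof.
move=> cf cg; apply: complexP; rewrite !ReImE /=.
  by under eq_Rintegral do rewrite ReImE; rewrite RintegralD//; exact: cint_Re.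
by under eq_Rintegral do rewrite ReImE; rewrite RintegralD//; exact: cint_Im.
Qed.

Lemma cIMl (c : R[i]) f : cint f -> cI (fun x => c * f x) = c * cI f.
Proof.
move=> cf; have rf := cint_Re cf; have jf := cint_Im cf.
apply: complexP; rewrite !ReImE /=.
  under eq_Rintegral do rewrite ReImE.
  by rewrite RintegralB ?RintegralZl//; exact: rintZ.
under eq_Rintegral do rewrite ReImE.
by rewrite RintegralD ?RintegralZl//; exact: rintZ.
Qed.

Lemma cIB f g : cint f -> cint g -> cI (fun x => f x - g x) = cI f - cI g.
Proof.
move=> cf cg; rewrite (_ : (fun x => _) = (fun x => f x + (-1) * g x)).
  by rewrite cID// ?cIMl ?mulN1r//; exact: cintMl.
by apply/funext => x; rewrite mulN1r.
Qed.

Lemma eq_cI f g : f =1 g -> cI f = cI g.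
Proof. by move=> fg; congr cI; apply/funext. Qed.

(** With v the integral, |v|^2 is the integral of the real part of conj(v) f, which is at most |v|
    |f|; then |v| is cancelled. *)
Lemma normc_cI f : cint f -> normc (cI f) <= \int[mu]_x normc (f x).
Proof.
move=> cf; have [->|n0] := eqVneq (normc (cI f)) 0.
  by apply: Rintegral_ge0 => x _; exact: normc_ge0.
rewrite -(ler_pM2l (x := normc (cI f))) ?lt_neqAle ?normc_ge0 1?eq_sym ?n0//.
rewrite -expr2; set v := cI f.
have -> : normc v ^+ 2 = \int[mu]_x complex.Re (conjc v * f x).
  by have := cIMl (conjc v) cf; rewrite mul_conjc => /(congr1 (@complex.Re R)).
rewrite -RintegralZl//; last by case: cf.
apply: le_Rintegral => //.
- by apply: cint_Re; exact: cintMl.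
- by apply: rintZ; case: cf.
- move=> x _; apply: le_trans (ler_norm _) _.
  by rewrite (le_trans (normc_Re _))// normcM normc_conj.
Qed.

Lemma normc_cI_le f (h : T -> R) : cmeas f -> rint mu h ->
  (forall x, normc (f x) <= h x) -> normc (cI f) <= \int[mu]_x h x.
Proof.
move=> mf ih fh; have cf := cint_le mf ih fh.
by rewrite (le_trans (normc_cI cf))// le_Rintegral//; case: cf.
Qed.

(** The bound [h] passes to the limit, so the real dominated convergence theorem applies to |f_n -
    f| with majorant 2 h. *)
Lemma cI_dct (f_ : nat -> T -> R[i]) f (h : T -> R) :
  (forall n, cmeas (f_ n)) -> cmeas f -> rint mu h ->
  (forall n x, normc (f_ n x) <= h x) ->
  (forall x, normc (f_ n x - f x) @[n --> \oo] --> 0) ->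
  cint f /\ normc (cI (f_ n) - cI f) @[n --> \oo] --> 0.
Proof.
move=> mf_ mf ih fh ff.
have fh' x : normc (f x) <= h x.
  apply/ler_addgt0Pr => e e0; have /cvgrPdist_lt/(_ _ e0)[N _ /(_ N (leqnn N))] := ff x.
  rewrite sub0r normrN ger0_norm ?normc_ge0// => fN.
  rewrite -[f x](subrK (f_ N x)) (le_trans (le_normcD _ _))// addrC lerD//.
  by rewrite normcB ltW.
have cf := cint_le mf ih fh'.
split=> //.
have cf_ n := cint_le (mf_ n) ih (fh n).
have I2 : rint mu (fun x => h x + h x) by exact: rintD.
have mn n : measurable_fun [set: T] (fun x => (normc (f_ n x - f x))%:E).
  by apply/measurable_EFinP; apply: measurable_normc; exact: cmeasB.
have ae1 : {ae mu, forall x, setT x ->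
    (normc (f_ n x - f x))%:E @[n --> \oo] --> (cst 0%E : T -> \bar R) x}.
  by apply: aeW => x _; apply/fine_cvgP; split; [exact: nearW|exact: ff].
have ae2 : {ae mu, forall x n, setT x ->
    (`|(normc (f_ n x - f x)%R)%:E| <= (h x + h x)%R%:E)%E}.
  apply: aeW => x n _ /=; rewrite lee_fin ger0_norm ?normc_ge0//.
  by rewrite (le_trans (le_normcD _ _))// normcN lerD.
have [_ _ H] := @dominated_convergence _ T R mu setT measurableT
  (fun n x => (normc (f_ n x - f x))%:E) (cst 0%E) (EFin \o (fun x => h x + h x))
  mn (measurable_cst _) ae1 I2 ae2.
rewrite integral0 in H.
have {}H : \int[mu]_x normc (f_ n x - f x) @[n --> \oo] --> 0 by exact: fine_cvg.
apply: (squeeze_cvgr _ (@cvg_cst _ _ _ _ _) H).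
apply: nearW => n; rewrite normc_ge0 andTb -cIB//.
by apply: normc_cI; exact: cintB.
Qed.

End cI.

Lemma cI_real dT (T : measurableType dT) (R : realType) (m : {measure set T -> \bar R}) (h : T -> R) :
  cI m (fun x => (h x)%:C) = (\int[m]_x h x)%:C.
Proof. by apply: complexP => //=; rewrite /Rintegral integral0. Qed.

(** * Integrals of functions known only up to null sets *)

Section ae_nonmeasurable.
Context d (T : measurableType d) (R : realType).
Variable mu : {measure set T -> \bar R}.
Local Open Scope ereal_scope.

Import HBNNSimple.

(* No measurability is needed because the library integral of a nonnegative
   function is a supremum over simple functions. *)
Lemma ge0_mono_integral (f g : T -> \bar R) : (forall x, 0 <= f x) ->
  (forall x, f x <= g x) -> \int[mu]_x f x <= \int[mu]_x g x.
Proof.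
move=> f0 fg; have g0 x : 0 <= g x by exact: le_trans (f0 x) (fg x).
rewrite !ge0_integralTE//; apply: le_ereal_sup => _ [h /= hf <-].
by exists h => //= x; exact: le_trans (hf x) (fg x).
Qed.

(** Here [f] may fail to be Borel. For one inequality, g cut off on the null set N lies below f
    everywhere; for the other, every simple function below f lies below g almost everywhere. *)
Lemma ge0_ae_integral (f g : T -> \bar R) : measurable_fun setT g ->
  (forall x, 0 <= f x) -> (forall x, 0 <= g x) ->
  (\forall x \ae mu, f x = g x) -> \int[mu]_x f x = \int[mu]_x g x.
Proof.
move=> mg f0 g0 [N [mN N0 sN]].
have fg x : ~ N x -> f x = g x.
  by move=> Nx; apply: contra_notP Nx => fgx; apply: sN.
have m1 : measurable_fun setT (fun x => g x * (\1_(~` N) x)%:E).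
  apply: emeasurable_funM => //; apply/measurable_EFinP.
  by apply: measurable_indic; exact: measurableC.
have i1 : \int[mu]_x g x = \int[mu]_x (g x * (\1_(~` N) x)%:E).
  apply: ge0_ae_eq_integral => //.
    by move=> x _; rewrite mule_ge0// lee_fin.
  exists N; split => // x /= H; apply: contra_notP H => Nx _.
  by rewrite indicE mem_set//= mule1.
apply/eqP; rewrite eq_le; apply/andP; split; last first.
  rewrite i1; apply: ge0_mono_integral => x; first by rewrite mule_ge0// lee_fin.
  have [Nx|Nx] := pselect (N x).
    by rewrite indicE memNset ?mule0//=; exact.
  by rewrite indicE mem_set//= mule1 fg.
rewrite ge0_integralTE//; apply: ge_ereal_sup => _ [h /= hf <-].
rewrite -integralT_nnsfun.
have mh : measurable_fun [set: T] (fun x => (h x)%:E) by exact/measurable_EFinP.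
apply: ae_ge0_le_integral => //.
  by move=> x _; rewrite lee_fin.
exists N; split => // x /= H; apply: contra_notP H => Nx _.
by rewrite -fg.
Qed.

Lemma ae_integral (f g : T -> \bar R) : measurable_fun setT g ->
  (\forall x \ae mu, f x = g x) -> \int[mu]_x f x = \int[mu]_x g x.
Proof.
move=> mg fg; rewrite integralE [RHS]integralE; congr (_ - _).
  apply: ge0_ae_integral => //; first exact: measurable_funepos.
  by apply: filterS fg => x fgx; rewrite !funeposE fgx.
apply: ge0_ae_integral => //; first exact: measurable_funeneg.
by apply: filterS fg => x fgx; rewrite !funenegE fgx.
Qed.

Lemma ae_cI (f g : T -> R[i]) : cmeas g -> (\forall x \ae mu, f x = g x) ->
  cI mu f = cI mu g.
Proof.
move=> [g1 g2] fg; rewrite /cI /Rintegral; congr (fine _ +i* fine _)%C.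
  by apply: ae_integral; [exact/measurable_EFinP|apply: filterS fg => x ->].
by apply: ae_integral; [exact/measurable_EFinP|apply: filterS fg => x ->].
Qed.

Lemma ae_normc2 (f g : T -> R[i]) : cmeas g -> (\forall x \ae mu, f x = g x) ->
  \int[mu]_x ((normc (f x)) ^+ 2)%:E = \int[mu]_x ((normc (g x)) ^+ 2)%:E.
Proof.
move=> mg fg; apply: ae_integral; last by apply: filterS fg => x ->.
by apply/measurable_EFinP; apply: measurable_funX; exact: measurable_normc.
Qed.

End ae_nonmeasurable.

(** * Fubini's theorem for real and complex integrals *)

Section fubini.
Context d1 d2 (T1 : measurableType d1) (T2 : measurableType d2) (R : realType).
Variables (m1 : {sigma_finite_measure set T1 -> \bar R}).
Variables (m2 : {sigma_finite_measure set T2 -> \bar R}).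

(** Every section is assumed integrable, not just almost every one: the real-valued inner integral
    then agrees with [fubini_F] at each point, and no default value of [fine] intervenes. *)
Lemma rint_fubini1 (f : T1 * T2 -> R) : rint (m1 \x m2)%E f ->
  (forall x, rint m2 (fun y => f (x, y))) ->
  measurable_fun setT (fun x => \int[m2]_y f (x, y)) /\
  \int[m1]_x (\int[m2]_y f (x, y)) = \int[(m1 \x m2)%E]_z f z.
Proof.
move=> fi sf.
have E : (EFin \o (fun x => \int[m2]_y f (x, y))) = fubini_F m2 (EFin \o f).
  by apply/funext => x /=; rewrite rint_fineK.
split; first by apply/measurable_EFinP; rewrite E; exact: (measurable_fubini_F fi).
rewrite /Rintegral -(integral12_prod_meas1 fi) -E.
by congr fine; apply: eq_integral => x _ /=; rewrite fineK// (integrable_fin_num measurableT (sf x)).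
Qed.

Lemma rint_fubini2 (f : T1 * T2 -> R) : rint (m1 \x m2)%E f ->
  (forall y, rint m1 (fun x => f (x, y))) ->
  measurable_fun setT (fun y => \int[m1]_x f (x, y)) /\
  \int[m2]_y (\int[m1]_x f (x, y)) = \int[(m1 \x m2)%E]_z f z.
Proof.
move=> fi sf.
have E : (EFin \o (fun y => \int[m1]_x f (x, y))) = fubini_G m1 (EFin \o f).
  by apply/funext => x /=; rewrite rint_fineK.
split; first by apply/measurable_EFinP; rewrite E; exact: (measurable_fubini_G fi).
rewrite /Rintegral -(integral21_prod_meas1 fi) -E.
by congr fine; apply: eq_integral => x _ /=; rewrite fineK// (integrable_fin_num measurableT (sf x)).
Qed.

Lemma cI_fubini1 (f : T1 * T2 -> R[i]) : cint (m1 \x m2)%E f ->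
  (forall x, cint m2 (fun y => f (x, y))) ->
  cmeas (fun x => cI m2 (fun y => f (x, y))) /\
  cI m1 (fun x => cI m2 (fun y => f (x, y))) = cI (m1 \x m2)%E f.
Proof.
move=> fi sf.
have [a b] := rint_fubini1 (cint_Re fi) (fun x => cint_Re (sf x)).
have [a' b'] := rint_fubini1 (cint_Im fi) (fun x => cint_Im (sf x)).
split; last by rewrite /cI b b'.
by [].
Qed.

Lemma cI_fubini2 (f : T1 * T2 -> R[i]) : cint (m1 \x m2)%E f ->
  (forall y, cint m1 (fun x => f (x, y))) ->
  cmeas (fun y => cI m1 (fun x => f (x, y))) /\
  cI m2 (fun y => cI m1 (fun x => f (x, y))) = cI (m1 \x m2)%E f.
Proof.
move=> fi sf.
have [a b] := rint_fubini2 (cint_Re fi) (fun x => cint_Re (sf x)).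
have [a' b'] := rint_fubini2 (cint_Im fi) (fun x => cint_Im (sf x)).
split; last by rewrite /cI b b'.
by [].
Qed.

Lemma rint_prod (h : T1 -> R) (k : T2 -> R) : (forall x, 0 <= h x) -> (forall x, 0 <= k x) ->
  rint m1 h -> rint m2 k -> rint (m1 \x m2)%E (fun z => h z.1 * k z.2).
Proof.
move=> h0 k0 ih ik.
have mh := rint_measurable ih; have mk := rint_measurable ik.
have mf : measurable_fun [set: T1 * T2] (fun z => h z.1 * k z.2).
  by apply: measurable_funM; exact: measurableT_comp.
have [_ hoo] := (rintP _ h0).1 ih; have [_ koo] := (rintP _ k0).1 ik.
apply/rintP; first by move=> z; rewrite mulr_ge0.
split=> //; rewrite fubini_tonelli1; [|exact/measurable_EFinP|]; last first.
  by move=> z; rewrite lee_fin mulr_ge0.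
rewrite (_ : (\int[m1]_x _)%E = (\int[m1]_x ((h x)%:E * \int[m2]_y (k y)%:E))%E).
  rewrite ge0_integralZr//; last 3 first.
  - exact/measurable_EFinP.
  - by move=> x _; rewrite lee_fin.
  - by apply: integral_ge0 => y _; rewrite lee_fin.
  rewrite lte_mul_pinfty//; first by apply: integral_ge0 => y _; rewrite lee_fin.
  by rewrite ge0_fin_numE//; apply: integral_ge0 => y _; rewrite lee_fin.
apply: eq_integral => x _; rewrite -ge0_integralZl//.
- exact/measurable_EFinP.
- by move=> y _; rewrite lee_fin.
- by rewrite lee_fin.
Qed.

(** A majorant of product form supplies at once everything that the two Fubini lemmas ask for. *)
Lemma cint_dom_prod (f : T1 * T2 -> R[i]) (h : T1 -> R) (k : T2 -> R) : cmeas f ->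
  rint m1 h -> rint m2 k -> (forall x, 0 <= h x) -> (forall x, 0 <= k x) ->
  (forall x y, normc (f (x, y)) <= h x * k y) ->
  [/\ cint (m1 \x m2)%E f, forall x, cint m2 (fun y => f (x, y)) &
      forall y, cint m1 (fun x => f (x, y))].
Proof.
move=> mf ih ik h0 k0 fhk; split.
- by apply: (cint_le mf (rint_prod h0 k0 ih ik)) => -[x y].
- move=> x; apply: (cint_le _ (rintZ (h x) ik)) => //.
  by apply: cmeas_comp mf; exact: pair1_measurable.
- move=> y; apply: (cint_le _ (rintZ (k y) ih)) => //.
    by apply: cmeas_comp mf; exact: pair2_measurable.
  by move=> x; rewrite mulrC.
Qed.

End fubini.

(** * Lebesgue measure on R^d *)

Section boxes.
Variables (R : realType) (n : nat).
Local Notation Rn := 'rV[R]_n.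

Definition obox (a b : Rn) : set Rn := [set x | forall i, a ord0 i < x ord0 i < b ord0 i].
Definition cbox (a b : Rn) : set Rn := [set x | forall i, a ord0 i <= x ord0 i <= b ord0 i].

Lemma obox_cbox a b : obox a b `<=` cbox a b.
Proof. by move=> x ab i; have /andP[/ltW -> /ltW ->] := ab i. Qed.

Lemma measurable_forall_coord (P : 'I_n -> set R) : (forall i, measurable (P i)) ->
  measurable [set x : Rn | forall i, P i (x ord0 i)].
Proof.
move=> mP; rewrite (_ : [set x | _] = \bigcap_(i in [set: 'I_n]) ((fun x : Rn => x ord0 i) @^-1` P i)).
  apply: fin_bigcap_measurable => // i _.
  by rewrite -[X in measurable X]setTI; exact: measurable_coord.
by apply/seteqP; split => x /= h i => [_|]; exact: h.
Qed.

Lemma measurable_obox a b : measurable (obox a b).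
Proof.
have -> : obox a b = [set x : Rn | forall i, `]a ord0 i, b ord0 i[%classic (x ord0 i)].
  by apply/seteqP; split => x /= h i; have := h i; rewrite /= in_itv.
by apply: (measurable_forall_coord (P := fun i => `]a ord0 i, b ord0 i[%classic)) => i; exact: measurable_itv.
Qed.

Definition rat_lo (q : 'rV[rat]_n) (k : nat) : Rn := \row_i (ratr (q ord0 i) - k.+1%:R^-1).
Definition rat_hi (q : 'rV[rat]_n) (k : nat) : Rn := \row_i (ratr (q ord0 i) + k.+1%:R^-1).

(** A half-width r < e/2 and a rational centre within r of x keep the box inside the e-ball of x.
    Countability of these boxes gives the measurability of open sets, and later the countable union
    of null sets in [kills_tests_ae]. *)
Lemma open_rat_box (U : set Rn) x : open U -> U x -> exists q k,
  obox (rat_lo q k) (rat_hi q k) x /\ cbox (rat_lo q k) (rat_hi q k) `<=` U.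
Proof.
move=> oU Ux; have /nbhs_ballP[e /= e0 eU] : nbhs x U by exact: open_nbhs_nbhs.
have [k ke] : exists k : nat, k.+1%:R^-1 < e / 2.
  have e2 : 0 < e / 2 by rewrite divr_gt0.
  have /= [N _ /(_ N (leqnn N)) /= NH] := near_infty_natSinv_lt (PosNum e2).
  by exists N.
have k0 : 0 < k.+1%:R^-1 :> R by rewrite invr_gt0.
have E1 q i : rat_lo q k ord0 i = ratr (q ord0 i) - k.+1%:R^-1 by rewrite mxE.
have E2 q i : rat_hi q k ord0 i = ratr (q ord0 i) + k.+1%:R^-1 by rewrite mxE.
move: (k.+1%:R^-1) ke k0 E1 E2 => r ke k0 E1 E2.
have /choice[q qx] : forall i, exists q : rat, ratr q \in `]x ord0 i - r, x ord0 i + r[.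
  move=> i; have [|q ?] := @rat_in_itvoo R (x ord0 i - r) (x ord0 i + r); last by exists q.
  by rewrite ltrBlDr -addrA ltrDl addr_gt0.
exists (\row_i q i), k; split.
  move=> i; rewrite E1 E2 !mxE; have := qx i; rewrite in_itv/= => /andP[? ?].
  by apply/andP; split; lra.
move=> y yq; apply: eU; split => // i j; rewrite (ord1 i) /ball/=.
have := yq j; rewrite E1 E2 !mxE; have := qx j; rewrite in_itv/= => /andP[? ?] /andP[? ?].
by rewrite ltr_norml; apply/andP; split; lra.
Qed.

Lemma rV_open_measurable (U : set Rn) : open U -> measurable U.
Proof.
move=> oU.
rewrite (_ : U = \bigcup_(p : 'rV[rat]_n * nat)
  (if `[< cbox (rat_lo p.1 p.2) (rat_hi p.1 p.2) `<=` U >]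
   then obox (rat_lo p.1 p.2) (rat_hi p.1 p.2) else set0)).
  apply: countable_bigcupT_measurable; first exact: countableP.
  by move=> p; case: asboolP => _; [exact: measurable_obox|exact: measurable0].
apply/seteqP; split => [x Ux|x [[q k] _] /=].
  have [q [k [qx qU]]] := open_rat_box oU Ux.
  by exists (q, k) => //=; case: asboolP.
by case: asboolP => // qU xq; exact/qU/obox_cbox.
Qed.

Lemma rV_closed_measurable (U : set Rn) : closed U -> measurable U.
Proof. by move=> cU; rewrite -(setCK U); apply: measurableC; apply: rV_open_measurable; exact: closed_openC. Qed.

Lemma rV_continuous_measurable (f : Rn -> R) : continuous f -> measurable_fun setT f.
Proof.
move=> cf; apply: (measurability _ (RGenOpens.measurableE R)) => _ [_ [a [b ->] <-]].
rewrite setTI; apply: rV_open_measurable; apply: open_comp; last exact: interval_open.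
by move=> x _; exact: cf.
Qed.

End boxes.

Section rV_integral.
Variable R : realType.
Local Notation leb := (@lebesgue_measure R).
Local Notation rV := (lebesgue_rV R).

Lemma ge0_integral_rVS n (f : 'rV[R]_n.+1 -> \bar R) : measurable_fun setT f ->
  (forall x, (0 <= f x)%E) ->
  (\int[rV n.+1]_x f x = \int[leb]_t \int[rV n]_y f (row_cons (t, y)))%E.
Proof.
move=> mf f0.
have mc := @measurable_row_cons R n.
transitivity (\int[pushforward (leb \x rV n)%E (@row_cons R n)]_x f x)%E.
  exact: eq_measure_integral.
rewrite ge0_integral_pushforward// preimage_setT fubini_tonelli1//=.
by apply: measurableT_comp => //.
Qed.

Lemma integral_rVS n (f : 'rV[R]_n.+1 -> \bar R) : measurable_fun setT f ->
  (\int[rV n.+1]_x f x = \int[(leb \x rV n)%E]_p f (row_cons p))%E.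
Proof.
move=> mf.
have mc := @measurable_row_cons R n.
have H g : measurable_fun setT g -> (forall x, (0 <= g x)%E) ->
    (\int[rV n.+1]_x g x = \int[(leb \x rV n)%E]_p g (row_cons p))%E.
  move=> mg g0.
  transitivity (\int[pushforward (leb \x rV n)%E (@row_cons R n)]_x g x)%E.
    exact: eq_measure_integral.
  by rewrite ge0_integral_pushforward// preimage_setT.
rewrite integralE [RHS]integralE; congr (_ - _)%E.
  rewrite (H _ (measurable_funepos mf)); last by move=> x; exact: funepos_ge0.
  by apply: eq_integral => p _; rewrite !funeposE.
rewrite (H _ (measurable_funeneg mf)); last by move=> x; exact: funeneg_ge0.
by apply: eq_integral => p _; rewrite !funenegE.
Qed.

Lemma cI_rVS n (f : 'rV[R]_n.+1 -> R[i]) : cmeas f ->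
  cI (rV n.+1) f = cI (leb \x rV n)%E (fun p => f (row_cons p)).
Proof.
move=> [m1 m2]; rewrite /cI /Rintegral.
by rewrite !integral_rVS//; exact/measurable_EFinP.
Qed.

Lemma rint_rVS n (f : 'rV[R]_n.+1 -> R) : measurable_fun setT f ->
  rint (leb \x rV n)%E (fun p => f (row_cons p)) -> rint (rV n.+1) f.
Proof.
move=> mf /integrableP[_ foo]; apply/integrableP; split; first exact/measurable_EFinP.
by rewrite integral_rVS//; apply/measurableT_comp => //; exact/measurable_EFinP.
Qed.

Lemma row_cons0 n (p : measurableTypeR R * 'rV[R]_n) : row_cons p ord0 ord0 = p.1.
Proof. by rewrite /row_cons mxE unlift_none. Qed.

Lemma row_consS n (p : measurableTypeR R * 'rV[R]_n) j : row_cons p ord0 (lift ord0 j) = p.2 ord0 j.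
Proof. by rewrite /row_cons mxE liftK. Qed.

Lemma cI_rV0 (f : 'rV[R]_0 -> R[i]) : cmeas f -> cI (rV 0) f = f 0.
Proof.
move=> [m1 m2].
have H (g : 'rV[R]_0 -> R) : measurable_fun setT g -> \int[rV 0]_x g x = g 0.
  move=> mg; rewrite /Rintegral; have := integral_dirac (0 : 'rV[R]_0) measurableT ((measurable_EFinP _ _).2 mg).
  by rewrite diracT mul1e => ->.
by apply: complexP; rewrite /= H.
Qed.

Lemma cmeas_prod d (T : measurableType d) (I : Type) (s : seq I) (f : I -> T -> R[i]) :
  (forall i, cmeas (f i)) -> cmeas (fun x => \prod_(i <- s) f i x).
Proof.
move=> mf; elim: s => [|i s ih].
  by under eq_fun do rewrite big_nil; exact: cmeas_cst.
by under eq_fun do rewrite big_cons; exact: cmeasM.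
Qed.

(** Induction on the dimension: [row_cons] splits off the first coordinate, and Fubini's theorem
    factors the integral. *)
Lemma cint_prod_coord n (h : 'I_n -> R -> R[i]) : (forall i, cint leb (h i)) ->
  cint (rV n) (fun x => \prod_(i < n) h i (x ord0 i)) /\
  cI (rV n) (fun x => \prod_(i < n) h i (x ord0 i)) = \prod_(i < n) cI leb (h i).
Proof.
elim: n h => [|n ih] h ch.
  split.
    split; first by under eq_fun do rewrite big_ord0; exact: cmeas_cst.
    under eq_fun do rewrite big_ord0.
    apply/rintP => [x|]; first exact: normc_ge0.
    split; first exact: measurable_cst.
    have := integral_dirac (0 : 'rV[R]_0) measurableT (measurable_cst (normc (1 : R[i]))%:E).
    by rewrite diracT mul1e => ->; rewrite ltry.
  by rewrite cI_rV0 ?big_ord0//; apply: cmeas_prod => i; apply: cmeas_comp (ch i).1; exact: measurable_coord.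
have mp : cmeas (fun x : 'rV[R]_n.+1 => \prod_(i < n.+1) h i (x ord0 i)).
  by apply: cmeas_prod => i; apply: cmeas_comp (ch i).1; exact: measurable_coord.
have [c1 c2] := ih (fun i => h (lift ord0 i)) (fun i => ch (lift ord0 i)).
have E p : \prod_(i < n.+1) h i (row_cons p ord0 i) =
    h ord0 p.1 * \prod_(i < n) h (lift ord0 i) (p.2 ord0 i).
  rewrite big_ord_recl row_cons0; congr (_ * _).
  by apply: eq_bigr => i _; rewrite row_consS.
have mE : cmeas (fun p : measurableTypeR R * 'rV[R]_n => h ord0 p.1 * \prod_(i < n) h (lift ord0 i) (p.2 ord0 i)).
  apply: cmeasM; first exact: (cmeas_comp measurable_fst (ch ord0).1).
  exact: (cmeas_comp measurable_snd c1.1).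
have [d d1 d2] := cint_dom_prod mE (ch ord0).2 c1.2 (fun=> normc_ge0 _) (fun=> normc_ge0 _)
   ltac:(by move=> x y; rewrite normcM).
split.
  split => //; apply: rint_rVS; first exact: measurable_normc.
  by under eq_fun do rewrite E; exact: d.2.
rewrite cI_rVS//; under eq_cI do rewrite E.
rewrite -(cI_fubini1 d d1).2 big_ord_recl -c2 mulrC -(cIMl _ (ch ord0)).
by apply: eq_cI => x /=; rewrite (cIMl _ c1) mulrC.
Qed.

Lemma rint_prod_coord n (h : 'I_n -> R -> R) : (forall i, rint leb (h i)) ->
  rint (rV n) (fun x => \prod_(i < n) h i (x ord0 i)) /\
  \int[rV n]_x \prod_(i < n) h i (x ord0 i) = \prod_(i < n) \int[leb]_x h i x.
Proof.
move=> ih.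
have ch i : cint leb (fun x => (h i x)%:C).
  split; first by apply: cmeas_real; exact: rint_measurable (ih i).
  apply: (rint_le (mu := leb) (k := fun x => `|h i x|)).
  - by apply: measurable_normc; apply: cmeas_real; exact: rint_measurable (ih i).
  - exact: (integrable_norm (ih i)).
  - by move=> x; rewrite normc_real normr_id.
have [c1 c2] := cint_prod_coord ch.
have E x : \prod_(i < n) (h i (x ord0 i))%:C = (\prod_(i < n) h i (x ord0 i))%:C.
  by rewrite rmorph_prod.
split.
  have := cint_Re c1; congr (rint _ _); apply/funext => x; by rewrite E.
have := congr1 (@complex.Re R) c2; rewrite /=.
under eq_Rintegral do rewrite E /=.
move=> ->; rewrite (_ : \prod_(i < n) _ = (\prod_(i < n) \int[leb]_x h i x)%:C)//.
rewrite rmorph_prod; apply: eq_bigr => i _; apply: complexP => //=.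
by rewrite /Rintegral integral0.
Qed.

End rV_integral.

(** * Translations and dilations of R^d *)

Section affine.
Variable R : realType.
Local Notation leb := (@lebesgue_measure R).
Local Notation rV := (lebesgue_rV R).

Definition affine1 (a c : R) : measurableTypeR R -> measurableTypeR R := fun x => a + c * x.

Lemma measurable_affine1 a c : measurable_fun setT (affine1 a c).
Proof. by apply: measurable_funD => //; exact: measurable_funM. Qed.

(** The scaled image measure gives each interval []u, v]] its length, and these intervals determine
    the Lebesgue measure. *)
Lemma leb_affine (a c : R) (c0 : 0 < c) A : measurable A ->
  leb A = (c%:E * pushforward leb (affine1 a c) A)%E.
Proof.
have mc := measurable_affine1 a c.
move=> mA; apply: (lebesgue_measure_unique
  (mu := mscale (NngNum (ltW c0)) (pushforward leb (affine1 a c)))) => //= _ [[u v]] _ <-.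
rewrite /mscale/= /pushforward.
rewrite (_ : _ @^-1` _ = `](u - a) / c, (v - a) / c]%classic); last first.
  by apply/seteqP; split => x /=; rewrite /affine1 !in_itv/= ltr_pdivrMr// ler_pdivlMr//;
   move=> /andP[? ?]; apply/andP; split; lra.
rewrite !lebesgue_measure_itv/= !lte_fin ltr_pM2r ?invr_gt0// ltrD2r.
case: ifPn => _; last by rewrite mule0.
by rewrite -EFinD -EFinM; congr EFin; field; rewrite gt_eqF.
Qed.

Lemma ge0_integral_affine1 (a c : R) (c0 : 0 < c) (f : measurableTypeR R -> \bar R) :
  measurable_fun setT f -> (forall x, (0 <= f x)%E) ->
  (\int[leb]_x f x = c%:E * \int[leb]_x f (a + c * x)%R)%E.
Proof.
move=> mf f0; have mc := measurable_affine1 a c.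
rewrite (eq_measure_integral (mscale (NngNum (ltW c0)) (pushforward leb (affine1 a c)))); last first.
  by move=> A mA _; exact: leb_affine.
by rewrite ge0_integral_mscale//= ge0_integral_pushforward.
Qed.

Lemma measurable_affine n (a : 'rV[R]_n) (c : R) :
  measurable_fun setT (fun x : 'rV[R]_n => a + c *: x).
Proof.
apply: measurable_fun_coordP => i; under eq_fun do rewrite !mxE.
by apply: measurable_funD => //; apply: measurable_funM => //; exact: measurable_coord.
Qed.

Lemma ge0_integral_affine n (a : 'rV[R]_n) c (c0 : 0 < c) (f : 'rV[R]_n -> \bar R) :
  measurable_fun setT f -> (forall x, (0 <= f x)%E) ->
  (\int[rV n]_x f x = (c ^+ n)%:E * \int[rV n]_x f (a + c *: x)%R)%E.
Proof.
elim: n a f => [|n ih] a f mf f0.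
  rewrite expr0 mul1e; apply: eq_integral => x _; congr f; apply/rowP => -[[]//].
have mf' := measurableT_comp mf (measurable_affine a c).
have mrc := @measurable_row_cons R n.
have mF : measurable_fun setT (fun p : measurableTypeR R * 'rV[R]_n => f (row_cons p)).
  exact: (measurableT_comp mf mrc).
rewrite ge0_integral_rVS// [in RHS]ge0_integral_rVS//.
pose a' : 'rV[R]_n := \row_j a ord0 (lift ord0 j).
have E t y : (a + c *: row_cons (t, y))%R = row_cons (a ord0 ord0 + c * t, a' + c *: y)%R.
  apply/rowP => i; rewrite 2!mxE; case: (unliftP ord0 i) => [j ->|->].
    by rewrite !row_consS !mxE.
  by rewrite !row_cons0.
transitivity (\int[leb]_t ((c ^+ n)%:E * \int[rV n]_y f (row_cons (t, a' + c *: y)%R)))%E.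
  apply: eq_integral => t _; rewrite (ih a')//.
  by apply: (measurableT_comp mF); exact: pair1_measurable.
have mG : measurable_fun setT (fun t : measurableTypeR R => \int[rV n]_y f (row_cons (t, a' + c *: y)%R))%E.
  apply: (measurable_fun_fubini_tonelli_F (fun p : measurableTypeR R * 'rV[R]_n => f (row_cons (p.1, a' + c *: p.2)%R))) => //.
  apply: (measurableT_comp mF); apply/measurable_fun_pairP; split => //=; first exact: measurable_fst.
  by apply: (measurableT_comp (measurable_affine _ _)); exact: measurable_snd.
rewrite ge0_integralZl//; last 2 first.
- by move=> t _; exact: integral_ge0.
- by rewrite lee_fin exprn_ge0// ltW.
rewrite [X in (_ * X)%E = _](ge0_integral_affine1 (a ord0 ord0) c0)//; last by move=> t; exact: integral_ge0.
rewrite muleA -EFinM -exprSr; congr (_ * _)%E.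
by apply: eq_integral => t _; apply: eq_integral => y _; rewrite E.
Qed.

Lemma rint_affine n (a : 'rV[R]_n) c (c0 : 0 < c) (f : 'rV[R]_n -> R) : rint (rV n) f ->
  rint (rV n) (fun x => f (a + c *: x)) /\
  \int[rV n]_x f x = c ^+ n * \int[rV n]_x f (a + c *: x).
Proof.
move=> ri; have mf := rint_measurable ri.
have mf' : measurable_fun setT (fun x : 'rV[R]_n => f (a + c *: x)).
  exact: measurableT_comp mf (measurable_affine a c).
have cn : 0 < c ^+ n by rewrite exprn_gt0.
have ri' : rint (rV n) (fun x => f (a + c *: x)).
  apply/integrableP; split; first exact/measurable_EFinP.
  have /integrableP[_] := ri.
  rewrite (ge0_integral_affine a c0)//; last by apply: measurableT_comp => //; exact/measurable_EFinP.
  apply: contraTT; rewrite -!leNgt !leye_eq => /eqP E.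
  by rewrite [X in (_ * X)%E]E gt0_muley// lte_fin.
split => //; rewrite /Rintegral.
have fp := measurable_funepos ((measurable_EFinP _ _).2 mf).
have fn := measurable_funeneg ((measurable_EFinP _ _).2 mf).
rewrite -[X in X * _]/(fine (c ^+ n)%:E) -fineM//; last exact: (integrable_fin_num measurableT ri').
congr fine; rewrite integralE [X in (_ * X)%E]integralE muleBr//; last first.
  by apply: fin_num_adde_defr; exact: (integrable_pos_fin_num measurableT ri').
by congr (_ - _)%E; rewrite (ge0_integral_affine a c0)//; congr (_ * _)%E; apply: eq_integral => x _;
 rewrite ?funeposE ?funenegE.
Qed.

Lemma cI_affine n (a : 'rV[R]_n) c (c0 : 0 < c) (f : 'rV[R]_n -> R[i]) : cint (rV n) f ->
  cint (rV n) (fun x => f (a + c *: x)) /\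
  cI (rV n) f = (c ^+ n)%:C * cI (rV n) (fun x => f (a + c *: x)).
Proof.
move=> cf; split.
  split; first exact: (cmeas_comp (measurable_affine a c) cf.1).
  exact: (rint_affine a c0 cf.2).1.
have [_ e1] := rint_affine a c0 (cint_Re cf).
have [_ e2] := rint_affine a c0 (cint_Im cf).
by apply: complexP; rewrite !ReImE /= ?e1 ?e2 mul0r ?subr0 ?addr0.
Qed.

Lemma integral_oneDsqrV : rint leb (fun x : R => (1 + x ^+ 2)^-1) /\
  \int[leb]_x (1 + x ^+ 2)^-1 = pi :> R.
Proof.
have E : (\int[leb]_x ((1 + x ^+ 2)^-1)%:E = pi%:E)%E.
  rewrite (@ge0_symfun_integralT _ (fun x => (oneDsqr x)^-1)).
  - rewrite -set_itvcy integral0y_oneDsqr -EFinM; congr EFin; lra.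
  - by move=> x; rewrite invr_ge0 addr_ge0// sqr_ge0.
  - exact: continuous_oneDsqrV.
  - by move=> x /=; rewrite /oneDsqr sqrrN.
have p0 (x : R) : 0 <= (1 + x ^+ 2)^-1 by rewrite invr_ge0 addr_ge0// sqr_ge0.
split; last by rewrite /Rintegral E.
apply/rintP => //; split; last by rewrite E ltry.
by apply: continuous_measurable_fun; exact: (@continuous_oneDsqrV R).
Qed.

Lemma rint_prod_oneDsqrV n :
  rint (rV n) (fun x : 'rV[R]_n => \prod_(i < n) (1 + x ord0 i ^+ 2)^-1).
Proof. by have [] := @rint_prod_coord R n (fun=> fun x => (1 + x ^+ 2)^-1) (fun=> integral_oneDsqrV.1). Qed.

End affine.

(** * The Fourier transform on L^1 and the Plancherel inequality *)

Section poisson1.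
Variable R : realType.
Local Notation leb := (@lebesgue_measure R).

(** The unit complex number exp(i t). *)
Definition ce (t : R) : R[i] := cos t +i* sin t.

Lemma normc_ce t : normc (ce t) = 1.
Proof. by rewrite /= cos2Dsin2 sqrtr1. Qed.

Lemma ceD s t : ce (s + t) = ce s * ce t.
Proof. by apply: complexP; rewrite ?ReImE /= ?cosD ?sinD//; ring. Qed.

Lemma conj_ce t : conjc (ce t) = ce (- t).
Proof. by apply: complexP; rewrite /= ?cosN ?sinN. Qed.

Variables (e u : R).
Hypothesis e0 : 0 < e.

Let f t := expR (- (e * t)) * (1 + cos (u * t)).
(** An antiderivative of [f] (see [dF]) that tends to 0 at infinity (see [Fy]). *)
Let F t := expR (- (e * t)) *
  (- e^-1 + (u * sin (u * t) - e * cos (u * t)) / (e ^+ 2 + u ^+ 2)).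

Let D0 : e ^+ 2 + u ^+ 2 != 0.
Proof. by rewrite gt_eqF// ltr_wpDr ?sqr_ge0// exprn_gt0. Qed.

Let dF (t : R) : is_derive t (1 : R) F (f t).
Proof.
rewrite /F; apply: is_derive_eq.
rewrite /f !scaler0 !add0r /GRing.scale/= ?mulr1 ?addr0; field.
by rewrite D0 gt_eqF.
Qed.

Let cf : continuous f.
Proof.
move=> t; apply: cvgM.
  apply: (@continuous_comp _ _ _ (fun t => - (e * t)) (@expR R)); last exact: continuous_expR.
  by apply: cvgN; apply: cvgM; [exact: cvg_cst|exact: cvg_id].
apply: cvgD; first exact: cvg_cst.
apply: (@continuous_comp _ _ _ (fun t => u * t) (@cos R)); last exact: continuous_cos.
by apply: cvgM; [exact: cvg_cst|exact: cvg_id].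
Qed.

Let f_ge0 t : 0 <= f t.
Proof.
by rewrite mulr_ge0 ?expR_ge0//; have := cos_max (u * t); rewrite ler_norml => /andP[]; lra.
Qed.

Let Fy : F x @[x --> +oo] --> 0.
Proof.
pose M := e^-1 + (`|u| + e) / (e ^+ 2 + u ^+ 2).
have D1 : 0 < e ^+ 2 + u ^+ 2 by rewrite ltr_wpDr ?sqr_ge0// exprn_gt0.
have M0 : 0 <= M by apply: addr_ge0; [rewrite invr_ge0 ltW|apply: divr_ge0; [rewrite addr_ge0// ltW|exact: ltW]].
have FM t : `|F t| <= expR (- (e * t)) * M.
  rewrite /F normrM gtr0_norm ?expR_gt0// ler_pM2l ?expR_gt0//.
  rewrite (le_trans (ler_normD _ _))// normrN gtr0_norm ?invr_gt0// lerD2l.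
  have D2 : 0 < (e ^+ 2 + u ^+ 2)^-1 by rewrite invr_gt0.
  rewrite normrM (gtr0_norm D2) ler_pM2r//.
  rewrite (le_trans (ler_normB _ _))// !normrM (gtr0_norm e0) lerD//.
    by rewrite ler_piMr// sin_max.
  by rewrite ler_piMr ?cos_max// ltW.
have E : expR (- (e * t)) @[t --> +oo] --> 0.
  apply: (@cvg_comp _ _ _ (fun t => e * t) (fun t => expR (- t)) _ _ _ _ (@cvgr_expR R)).
  exact: gt0_cvgMry.
apply/cvgr0Pnorm_lt => d d0.
have d1 : 0 < d / (M + 1) by rewrite divr_gt0// ltr_wpDl.
move/cvgr0Pnorm_lt : E => /(_ _ d1); apply: filterS => t.
rewrite gtr0_norm ?expR_gt0// ltr_pdivlMr ?ltr_wpDl// => h.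
by rewrite (le_lt_trans (FM t))// (le_lt_trans _ h)// ler_pM2l ?expR_gt0// lerDl.
Qed.

(* Adding 1 to the cosine makes the integrand nonnegative, as the improper
   fundamental theorem of calculus requires. *)
Lemma integral_abel_half :
  (\int[leb]_x (expR (- (e * `|x|)) * (1 + cos (u * x)))%:E =
   (2 / e + 2 * e / (e ^+ 2 + u ^+ 2))%:E)%E.
Proof.
rewrite ge0_symfun_integralT.
- rewrite (_ : \int[_]_(x in _) _ = \int[leb]_(x in `[0%R, +oo[) (f x)%:E)%E; last first.
    rewrite -set_itvcy; apply: eq_integral => x; rewrite inE/= in_itv/= andbT => x0.
    by rewrite /f ger0_norm.
  rewrite (ge0_continuous_FTC2y _ _ Fy).
  + rewrite -EFinB -EFinM; congr EFin.
    rewrite /F !mulr0 oppr0 expR0 sin0 cos0; field.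
    by rewrite D0 gt_eqF.
  + by move=> x _; exact: f_ge0.
  + by apply: continuous_subspaceT => x; exact: cf.
  + by move=> x _; exact: ex_derive.
  + by apply: cvg_at_right_filter; apply/differentiable_continuous/derivable1_diffP; exact: ex_derive.
  + by move=> x _; rewrite derive1E; exact: derive_val.
- by move=> x; rewrite mulr_ge0 ?expR_ge0//; have := cos_max (u * x); rewrite ler_norml => /andP[]; lra.
- move=> x; apply: cvgM.
    apply: (@continuous_comp _ _ _ (fun t => - (e * `|t|)) (@expR R)); last exact: continuous_expR.
    apply: cvgN; apply: cvgM; first exact: cvg_cst.
    by apply: cvg_norm; exact: cvg_id.
  apply: cvgD; first exact: cvg_cst.
  apply: (@continuous_comp _ _ _ (fun t => u * t) (@cos R)); last exact: continuous_cos.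
  by apply: cvgM; [exact: cvg_cst|exact: cvg_id].
- by move=> x /=; rewrite normrN mulrN cosN.
Qed.

End poisson1.

Section poisson2.
Variable R : realType.
Local Notation leb := (@lebesgue_measure R).

Lemma measurable_abel (e : R) : measurable_fun setT (fun t : R => expR (- (e * `|t|))).
Proof.
apply: measurableT_comp => //; apply: measurableT_comp => //.
by apply: measurable_funM => //; apply: measurableT_comp => //; exact: measurable_id.
Qed.

Lemma measurable_ce d (T : measurableType d) (h : T -> R) : measurable_fun setT h ->
  cmeas (fun t => ce (h t)).
Proof.
move=> mh; apply: cmeas_ReIm.
  exact: (measurableT_comp (continuous_measurable_fun (@continuous_cos R)) mh).
exact: (measurableT_comp (continuous_measurable_fun (@continuous_sin R)) mh).
Qed.

(** The case u = 0 of [integral_abel_half], whose integrand is then twice the exponential. Its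
    finite value also excludes an infinite integral. *)
Lemma rint_abel (e : R) : 0 < e -> rint leb (fun t => expR (- (e * `|t|))) /\
  \int[leb]_t expR (- (e * `|t|)) = 2 / e.
Proof.
move=> e0; have := integral_abel_half 0 e0.
under eq_integral do rewrite mul0r cos0 mulrC EFinM.
have mE := (measurable_EFinP _ _).2 (measurable_abel e).
rewrite ge0_integralZl//.
move=> H; have {}H : (\int[leb]_x (expR (- (e * `|x|)))%:E = (2 / e)%:E)%E.
  move: H; case: (\int[leb]_x _)%E => [r||].
  - rewrite -EFinM => -[] H; congr EFin; apply: (mulfI (x := 1 + 1)); first by rewrite gt_eqF.
    by rewrite H expr0n addr0; field; rewrite gt_eqF.
  - by rewrite gt0_muley// lte_fin.
  - by rewrite gt0_muleNy// lte_fin.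
split; last by rewrite /Rintegral H.
by apply/rintP => [t|]; [exact: expR_ge0|split; [exact: measurable_abel|rewrite H ltry]].
Qed.

Lemma integral_odd (h : R -> R) : measurable_fun setT h -> (forall x, h (- x) = - h x) ->
  rint leb h -> \int[leb]_x h x = 0.
Proof.
move=> mh oh ih.
have mN : measurable_fun setT (-%R : measurableTypeR R -> measurableTypeR R).
  exact: oppr_measurable.
have mE := (measurable_EFinP _ _).2 mh.
have E : (\int[leb]_x (h x)%:E = \int[leb]_x (h (- x))%:E)%E.
  have HH (k : measurableTypeR R -> \bar R) : measurable_fun setT k -> (forall x, (0 <= k x)%E) ->
      (\int[leb]_x k x = \int[leb]_x k (- x)%R)%E.
    move=> mk k0; rewrite (eq_measure_integral (pushforward leb (-%R : measurableTypeR R -> measurableTypeR R))); last first.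
      by move=> A mA _; apply/esym; exact: lebesgue_measureN.
    by rewrite ge0_integral_pushforward.
  rewrite integralE [RHS]integralE; congr (_ - _)%E.
    rewrite HH//; last exact: measurable_funepos.
    by apply: eq_integral => x _; rewrite !funeposE.
  rewrite HH//; last exact: measurable_funeneg.
  by apply: eq_integral => x _; rewrite !funenegE.
have : \int[leb]_x h x = - \int[leb]_x h x.
  rewrite {1}/Rintegral E -mulN1r -RintegralZl//; congr fine.
  by apply: eq_integral => x _; rewrite oh mulN1r.
lra.
Qed.

Definition abel_ce (e u t : R) : R[i] := (expR (- (e * `|t|)))%:C * ce (u * t).

(** The real part is [integral_abel_half] minus [rint_abel]; the imaginary part is odd. *)
Lemma cI_abel_ce (e u : R) : 0 < e -> cint leb (abel_ce e u) /\
  cI leb (abel_ce e u) = (2 * e / (e ^+ 2 + u ^+ 2))%:C.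
Proof.
move=> e0; have [ia Ia] := rint_abel e0.
have cc : cint leb (abel_ce e u).
  apply: (cint_le _ ia).
    apply: cmeasM; first by apply: cmeas_real; exact: measurable_abel.
    by apply: measurable_ce; apply: measurable_funM => //; exact: measurable_id.
  by move=> t; rewrite normcM normc_ce mulr1 normc_real ger0_norm ?expR_ge0.
split => //.
have E t : complex.Re (abel_ce e u t) = expR (- (e * `|t|)) * cos (u * t).
  by rewrite !ReImE /= mul0r subr0.
have E' t : complex.Im (abel_ce e u t) = expR (- (e * `|t|)) * sin (u * t).
  by rewrite !ReImE /= mul0r addr0.
apply: complexP; rewrite /cI; cbn [complex.Re complex.Im].
  have := congr1 fine (integral_abel_half u e0); rewrite -/(Rintegral _ _ _) /=.
  under eq_Rintegral do rewrite mulrDr mulr1 -E.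
  rewrite RintegralD//; last exact: cint_Re.
  by rewrite Ia => /addrI.
apply: integral_odd; [exact: cc.1.2| |exact: (cint_Im cc)].
by move=> t; rewrite !E' normrN mulrN sinN mulrN.
Qed.

End poisson2.

(** * The Fourier integral, the multiplication formula and Abel regularization *)

Section ft.
Variables (R : realType) (d : nat).
Local Notation Rd := 'rV[R]_d.
Local Notation mu := (lebesgue_rV R d).
Local Notation leb := (@lebesgue_measure R).

Lemma dotrC (x y : Rd) : dotr x y = dotr y x.
Proof. by apply: eq_bigr => i _; rewrite mulrC. Qed.

Lemma measurable_dotr e (T : measurableType e) (h k : T -> Rd) :
  measurable_fun setT h -> measurable_fun setT k ->
  measurable_fun setT (fun t => dotr (h t) (k t)).
Proof.
move=> mh mk; apply: measurable_sum => i.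
apply: measurable_funM.
  exact: (measurableT_comp (@measurable_coord R d i) mh).
exact: (measurableT_comp (@measurable_coord R d i) mk).
Qed.

Definition ft_cst : R := (2 * pi) `^ (- (d%:R / 2)).

Lemma ft_cst_gt0 : 0 < ft_cst.
Proof. by rewrite powR_gt0// mulr_gt0// pi_gt0. Qed.

(** The sign [s] is -1 for the Fourier transform and 1 for its inverse. Carrying it as a parameter
    with [s ^+ 2 = 1] proves each fact for both at once. *)
Definition ft (s : R) (g : Rd -> R[i]) (y : Rd) : R[i] :=
  ft_cst%:C * cI mu (fun x => g x * ce (s * dotr y x)).

Lemma fourierE (g : Rd -> R[i]) : fourier g = ft (-1) g.
Proof.
apply/funext => y; rewrite /fourier /ft; congr (_ * _).
by congr (cI mu _); apply/funext => x; rewrite /ce mulN1r cosN sinN.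
Qed.

Lemma cint_ce (g : Rd -> R[i]) (h : Rd -> R) : cint mu g -> measurable_fun setT h ->
  cint mu (fun x => g x * ce (h x)).
Proof.
move=> cg mh; apply: (cintMb (C := 1) cg); first exact: measurable_ce.
by move=> x; rewrite normc_ce.
Qed.

Lemma ft_le s (g : Rd -> R[i]) y : cint mu g ->
  normc (ft s g y) <= ft_cst * \int[mu]_x normc (g x).
Proof.
move=> cg; rewrite normcM normc_real gtr0_norm ?ft_cst_gt0// ler_pM2l ?ft_cst_gt0//.
apply: normc_cI_le; [|exact: cg.2|by move=> x; rewrite normcM normc_ce mulr1].
apply: (cint_ce cg _).1; apply: measurable_funM => //.
by apply: measurable_dotr => //; exact: measurable_id.
Qed.

(** The standard integrable majorant in what follows. It plays the role of a negative power of 1 +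
    |y|^2, but as a product it integrates coordinate by coordinate. *)
Definition weight (y : Rd) : R := \prod_(i < d) (1 + y ord0 i ^+ 2)^-1.

Lemma weight_gt0 y : 0 < weight y.
Proof. by apply: prodr_gt0 => i _; rewrite invr_gt0 ltr_wpDr ?sqr_ge0. Qed.

Lemma rint_weight : rint mu weight.
Proof. exact: rint_prod_oneDsqrV. Qed.

Lemma measurable_joint (g k : Rd -> R[i]) s : cmeas g -> cmeas k ->
  cmeas (fun z : Rd * Rd => g z.1 * k z.2 * ce (s * dotr z.2 z.1)).
Proof.
move=> mg mk; apply: cmeasM.
  apply: cmeasM; first exact: (cmeas_comp measurable_fst mg).
  exact: (cmeas_comp measurable_snd mk).
by apply: measurable_ce; apply: measurable_funM => //; apply: measurable_dotr.
Qed.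

Lemma normc_joint (g k : Rd -> R[i]) s x y :
  normc (g x * k y * ce (s * dotr y x)) <= normc (g x) * normc (k y).
Proof. by rewrite !normcM normc_ce mulr1. Qed.

(** Both integrals are iterated integrals of g(x) k(y) exp(i s y.x). The measurability clause is a
    by-product of Fubini's theorem and is what [cmeas_ft] rests on. *)
Lemma cint_ft_pair (g k : Rd -> R[i]) s : cint mu g -> cint mu k ->
  cmeas (fun y => ft s g y * k y) /\
  cI mu (fun y => ft s g y * k y) = cI mu (fun x => g x * ft s k x).
Proof.
move=> cg ck.
have [c c1 c2] := cint_dom_prod (measurable_joint s cg.1 ck.1) cg.2 ck.2
  (fun=> normc_ge0 _) (fun=> normc_ge0 _) (normc_joint g k s).
have [m1 e1] := cI_fubini1 c c1; have [m2 e2] := cI_fubini2 c c2.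
have mdot (y : Rd) : measurable_fun setT (fun x => s * dotr y x).
  by apply: measurable_funM => //; apply: measurable_dotr => //; exact: measurable_id.
have E1 y : ft s g y * k y = ft_cst%:C * cI mu (fun x => g x * k y * ce (s * dotr y x)).
  rewrite /ft -mulrA; congr (_ * _); rewrite mulrC -cIMl.
    by apply: eq_cI => x; ring.
  by apply: cint_ce.
have E2 x : g x * ft s k x = ft_cst%:C * cI mu (fun y => g x * k y * ce (s * dotr y x)).
  rewrite /ft mulrCA; congr (_ * _); rewrite -cIMl.
    by apply: eq_cI => y; rewrite dotrC; ring.
  by apply: cint_ce.
split.
  rewrite (_ : (fun y => _) = (fun y => ft_cst%:C * cI mu (fun x => g x * k y * ce (s * dotr y x)))).
    by apply: cmeasM => //; exact: cmeas_cst.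
  by apply/funext.
rewrite (eq_cI _ E1) (eq_cI _ E2).
have A1 : cint mu (fun x => cI mu (fun y => g x * k y * ce (s * dotr y x))).
  apply: (cint_le (h := fun x => normc (g x) * \int[mu]_y normc (k y)) m1).
    by under eq_fun do rewrite mulrC; apply: rintZ; exact: cg.2.
  move=> x; rewrite -RintegralZl//; last exact: ck.2.
  apply: normc_cI_le; [exact: (c1 x).1|by apply: rintZ; exact: ck.2|].
  by move=> y; exact: normc_joint.
have A2 : cint mu (fun y => cI mu (fun x => g x * k y * ce (s * dotr y x))).
  apply: (cint_le (h := fun y => normc (k y) * \int[mu]_x normc (g x)) m2).
    by under eq_fun do rewrite mulrC; apply: rintZ; exact: ck.2.
  move=> y; rewrite -RintegralZl//; last exact: cg.2.
  apply: normc_cI_le; [exact: (c2 y).1|by apply: rintZ; exact: cg.2|].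
  by move=> x; rewrite [leRHS]mulrC; exact: normc_joint.
by rewrite [LHS](cIMl _ A2) [RHS](cIMl _ A1) e1 e2.
Qed.

Lemma ft_multiplication (g k : Rd -> R[i]) s : cint mu g -> cint mu k ->
  cI mu (fun y => ft s g y * k y) = cI mu (fun x => g x * ft s k x).
Proof. by move=> cg ck; have [] := cint_ft_pair s cg ck. Qed.

Lemma cint_real (h : Rd -> R) : rint mu h -> (forall x, 0 <= h x) -> cint mu (fun x => (h x)%:C).
Proof.
move=> ih h0; apply: (cint_le _ ih); first by apply: cmeas_real; exact: rint_measurable ih.
by move=> x; rewrite normc_real ger0_norm.
Qed.

(** Fubini's theorem makes [ft s g] measurable after multiplication by an integrable function. The
    positive [weight] is such a function and is divided out again. *)
Lemma cmeas_ft s (g : Rd -> R[i]) : cint mu g -> cmeas (ft s g).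
Proof.
move=> cg.
have cw : cint mu (fun x => (weight x)%:C).
  by apply: cint_real; [exact: rint_weight|move=> x; exact/ltW/weight_gt0].
have [m _] := cint_ft_pair s cg cw.
rewrite (_ : ft s g = (fun y => (ft s g y * (weight y)%:C) * ((weight y)^-1)%:C)).
  apply: cmeasM => //; apply: cmeas_real.
  rewrite (_ : (fun y => _) = (fun y : Rd => \prod_(i < d) (1 + y ord0 i ^+ 2))).
    apply: measurable_prod => i _; apply: measurable_funD => //.
    by apply: measurable_funX; exact: measurable_coord.
  by apply/funext => y; rewrite -prodfV; apply: eq_bigr => i _; rewrite invrK.
apply/funext => y; rewrite -mulrA -rmorphM mulfV ?mulr1//.
by rewrite gt_eqF// weight_gt0.
Qed.

Lemma cint_ftM s (g k : Rd -> R[i]) : cint mu g -> cint mu k -> cint mu (fun y => k y * ft s g y).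
Proof.
move=> cg ck; apply: (cintMb ck); first exact: cmeas_ft.
by move=> x; exact: ft_le.
Qed.

(** The exponential of - e times the l^1 norm. A product over coordinates is needed for its
    transform to reduce to the one-variable integral [cI_abel_ce]. *)
Definition abel (e : R) (y : Rd) : R := \prod_(i < d) expR (- (e * `|y ord0 i|)).

Definition poisson (e : R) (u : Rd) : R := \prod_(i < d) (pi^-1 * (e / (e ^+ 2 + u ord0 i ^+ 2))).

Lemma abel_gt0 e y : 0 < abel e y.
Proof. by apply: prodr_gt0 => i _; exact: expR_gt0. Qed.

Lemma abel_le1 e y : 0 <= e -> abel e y <= 1.
Proof.
move=> e0; apply: (le_trans (y := \prod_(i < d) 1)); last by rewrite big1.
apply: ler_prod => i _; rewrite expR_ge0 /= -expR0 ler_expR oppr_le0.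
by rewrite mulr_ge0.
Qed.

Lemma poisson_ge0 e u : 0 <= e -> 0 <= poisson e u.
Proof.
move=> e0; apply: prodr_ge0 => i _; rewrite mulr_ge0 ?invr_ge0 ?pi_ge0//.
by rewrite divr_ge0// addr_ge0 ?sqr_ge0.
Qed.

Lemma rint_abel_rV e : 0 < e -> rint mu (abel e).
Proof. by move=> e0; have [] := @rint_prod_coord R d (fun=> fun t => expR (- (e * `|t|))) (fun=> (rint_abel e0).1). Qed.

Lemma ce_sum (I : Type) (r : seq I) (t : I -> R) : ce (\sum_(i <- r) t i) = \prod_(i <- r) ce (t i).
Proof.
elim: r => [|i r ih]; first by rewrite !big_nil /ce cos0 sin0.
by rewrite !big_cons ceD ih.
Qed.

(** Two normalizing constants, one from each transform, turn the factors 2 e / (e^2 + u_i^2) into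
    Poisson kernels of mass 1. *)
Lemma ft_cst_sqr (e : R) (u : Rd) : 0 < e ->
  ft_cst ^+ 2 * \prod_(i < d) (2 * e / (e ^+ 2 + u ord0 i ^+ 2)) = poisson e u.
Proof.
move=> e0.
have -> : ft_cst ^+ 2 = \prod_(i < d) (2 * pi)^-1.
  have p0 : 0 <= 2 * pi :> R by rewrite mulr_ge0// pi_ge0.
  rewrite prodr_const card_ord /ft_cst -powR_mulrn ?powR_ge0// -powRrM.
  have -> : - (d%:R / 2) * 2%:R = - d%:R :> R by field.
  by rewrite powRN powR_mulrn// exprVn.
rewrite -big_split; apply: eq_bigr => i _ /=.
have D0 : e ^+ 2 + u ord0 i ^+ 2 != 0 by rewrite gt_eqF// ltr_wpDr ?sqr_ge0// exprn_gt0.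
have pi0 : (pi : R) != 0 by rewrite gt_eqF// pi_gt0.
by move: (pi : R) pi0 => p p0; field; rewrite D0 p0.
Qed.

Lemma ft_abel s e x x' : 0 < e -> s ^+ 2 = 1 ->
  ft_cst%:C * ft (- s) (fun y => (abel e y)%:C * ce (s * dotr x y)) x' = (poisson e (x' - x))%:C.
Proof.
move=> e0 s1; rewrite /ft mulrA -rmorphM -expr2 -ft_cst_sqr// [in RHS]rmorphM; congr (_ * _).
have [_ E] := @cint_prod_coord R d (fun i => abel_ce e (s * (x ord0 i - x' ord0 i)))
  (fun i => (cI_abel_ce _ e0).1).
transitivity (\prod_(i < d) cI leb (abel_ce e (s * (x ord0 i - x' ord0 i)))); last first.
  rewrite rmorph_prod; apply: eq_bigr => i _; rewrite (cI_abel_ce _ e0).2 !mxE.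
  by rewrite exprMn s1 mul1r -[(x ord0 i - _) ^+ 2]sqrrN opprB.
rewrite -E; apply: eq_cI => y.
rewrite /abel /abel_ce big_split/= rmorph_prod -mulrA; congr (_ * _).
rewrite -ceD -ce_sum; congr ce.
rewrite mulNr -mulrBr /dotr -sumrB mulr_sumr; apply: eq_bigr => i _; ring.
Qed.

Lemma cint_ft_abel (h : Rd -> R[i]) s e : cint mu h -> 0 < e ->
  cint mu (fun y => ft s h y * (abel e y)%:C).
Proof.
move=> ch e0; under eq_fun do rewrite mulrC; apply: cint_ftM => //.
by apply: cint_real; [exact: rint_abel_rV|move=> x; exact/ltW/abel_gt0].
Qed.

(** The inversion formula in Abel-regularized form: the multiplication formula moves the inner
    transform from [h] onto the Abel weight times a character, whose transform is the Poisson kernel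
    by [ft_abel]. *)
Lemma ft_abel_ft (h : Rd -> R[i]) s e x : cint mu h -> 0 < e -> s ^+ 2 = 1 ->
  ft s (fun y => ft (- s) h y * (abel e y)%:C) x =
  cI mu (fun x' => h x' * (poisson e (x' - x))%:C).
Proof.
move=> ch e0 s1; rewrite {1}/ft.
have cak : cint mu (fun y => (abel e y)%:C * ce (s * dotr x y)).
  apply: cint_ce.
    by apply: cint_real; [exact: rint_abel_rV|move=> z; exact/ltW/abel_gt0].
  by apply: measurable_funM => //; apply: measurable_dotr => //; exact: measurable_id.
transitivity (ft_cst%:C * cI mu (fun y => ft (- s) h y * ((abel e y)%:C * ce (s * dotr x y)))).
  by congr (_ * _); apply: eq_cI => y; rewrite mulrA.
rewrite ft_multiplication// -cIMl.
  by apply: eq_cI => x'; rewrite mulrCA ft_abel.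
exact: cint_ftM.
Qed.

Lemma ft_kernel (g h : Rd -> R[i]) s e : cint mu g -> cint mu h -> 0 < e -> s ^+ 2 = 1 ->
  cI mu (fun y => ft s g y * (ft (- s) h y * (abel e y)%:C)) =
  cI mu (fun x => g x * cI mu (fun x' => h x' * (poisson e (x' - x))%:C)).
Proof.
move=> cg ch e0 s1; rewrite ft_multiplication//; last exact: cint_ft_abel.
by apply: eq_cI => x; rewrite ft_abel_ft.
Qed.

End ft.

Section fatou_le.
Context d (T : measurableType d) (R : realType).
Variable mu : {measure set T -> \bar R}.

Lemma fatou_le (f_ : nat -> T -> R) (f : T -> R) (B : \bar R) :
  (forall n, measurable_fun setT (f_ n)) -> (forall n x, 0 <= f_ n x) ->
  (forall x, f_ n x @[n --> \oo] --> f x) ->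
  (\forall n \near \oo, (\int[mu]_x (f_ n x)%:E <= B)%E) -> (\int[mu]_x (f x)%:E <= B)%E.
Proof.
move=> mf f0 ff [N _ fB].
have E x : limn_einf (fun n => (f_ n x)%:E) = (f x)%:E.
  have H : (f_ n x)%:E @[n --> \oo] --> (f x)%:E.
    by apply/fine_cvgP; split; [exact: nearW|exact: ff].
  by have [-> _] := cvg_limn_einf_sup H.
under eq_integral do rewrite -E.
apply: (le_trans (fatou mu measurableT (fun n => (measurable_EFinP _ _).2 (mf n)) _)).
  by move=> n x _; rewrite lee_fin.
rewrite limn_einf_lim; apply: lime_le; first exact: is_cvg_einfs.
apply: nearW => n; apply: (le_trans _ (fB (maxn n N) (leq_maxr _ _))).
by apply: ereal_inf_lbound; exists (maxn n N) => //=; exact: leq_maxl.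
Qed.

(** All functions are multiplied by the indicator of the complement of the exceptional null set, so
    that convergence holds everywhere; [ge0_ae_integral] then restores [f], which may fail to be
    Borel. *)
Lemma fatou_ae_le (f_ : nat -> T -> R) (f : T -> R) (B : \bar R) :
  (forall n, measurable_fun setT (f_ n)) -> (forall n x, 0 <= f_ n x) ->
  (forall x, 0 <= f x) ->
  (\forall x \ae mu, f_ n x @[n --> \oo] --> f x) ->
  (\forall n \near \oo, (\int[mu]_x (f_ n x)%:E <= B)%E) -> (\int[mu]_x (f x)%:E <= B)%E.
Proof.
move=> mf f0 fx0 [N [mN N0 sN]] fB.
have NN x : ~ N x -> f_ n x @[n --> \oo] --> f x.
  by move=> Nx; apply: contra_notP Nx; exact: sN.
have m1 : measurable_fun setT (\1_(~` N) : T -> R) by apply: measurable_indic; exact: measurableC.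
have cv x : f_ n x * \1_(~` N) x @[n --> \oo] --> f x * \1_(~` N) x.
  have [Nx|Nx] := pselect (N x).
    have -> : \1_(~` N) x = 0 :> R by rewrite indicE memNset//=; exact.
    by rewrite mulr0; under eq_fun do rewrite mulr0; exact: cvg_cst.
  have -> : \1_(~` N) x = 1 :> R by rewrite indicE mem_set.
  by rewrite mulr1; under eq_fun do rewrite mulr1; exact: NN.
have mlim : measurable_fun setT (fun x => f x * \1_(~` N) x).
  apply: (measurable_fun_cvg (h := fun n x => f_ n x * \1_(~` N) x)) => [n|x _]; [exact: measurable_funM|exact: cv].
rewrite (@ge0_ae_integral _ _ _ mu _ (fun x => (f x * \1_(~` N) x)%:E)).
- apply: (fatou_le (f_ := fun n x => f_ n x * \1_(~` N) x)) => //.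
  + by move=> n; exact: measurable_funM.
  + by move=> n x; rewrite mulr_ge0.
  + near=> n; apply: (le_trans _ (near fB n _)) => //.
    apply: ge0_mono_integral => x; rewrite lee_fin ?mulr_ge0//.
    by rewrite ler_piMr// indicE; case: (_ \in _).
- exact/measurable_EFinP.
- by move=> x; rewrite lee_fin.
- by move=> x; rewrite lee_fin mulr_ge0.
- exists N; split => // x /= H; apply: contra_notP H => Nx.
  by rewrite indicE mem_set//= mulr1.
Unshelve. all: by end_near. Qed.

End fatou_le.

Section plancherel.
Variables (R : realType) (d : nat).
Local Notation Rd := 'rV[R]_d.
Local Notation mu := (lebesgue_rV R d).
Local Notation leb := (@lebesgue_measure R).

(** The Poisson kernel for e = 1. By [poisson_cauchy] every other Poisson kernel is a dilation of
    it. *)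
Definition cauchyd (v : Rd) : R := \prod_(i < d) (pi^-1 * (1 + v ord0 i ^+ 2)^-1).

Lemma cauchyd_ge0 v : 0 <= cauchyd v.
Proof. by apply: prodr_ge0 => i _; rewrite mulr_ge0 ?invr_ge0 ?pi_ge0// addr_ge0 ?sqr_ge0. Qed.

Lemma integral_cauchyd : rint mu cauchyd /\ \int[mu]_v cauchyd v = 1.
Proof.
have [i1 I1] := integral_oneDsqrV R.
have [-> ->] := @rint_prod_coord R d (fun=> fun t => pi^-1 * (1 + t ^+ 2)^-1) (fun=> rintZ pi^-1 i1).
split => //; rewrite big1// => i _.
by rewrite RintegralZl// I1 mulVf// gt_eqF// pi_gt0.
Qed.

Lemma poisson_cauchy (e : R) v : 0 < e -> e ^+ d * poisson e (e *: v) = cauchyd v.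
Proof.
move=> e0; rewrite -[in e ^+ d](card_ord d) -prodr_const -big_split.
apply: eq_bigr => i _ /=; rewrite mxE.
have D1 : 1 + v ord0 i ^+ 2 != 0 by rewrite gt_eqF// ltr_wpDr ?sqr_ge0.
have D2 : e ^+ 2 + (e * v ord0 i) ^+ 2 != 0.
  by rewrite gt_eqF// ltr_wpDr ?sqr_ge0// exprn_gt0.
have D3 : e != 0 by rewrite gt_eqF.
have D4 : (pi : R) != 0 by rewrite gt_eqF// pi_gt0.
by move: (pi : R) D4 => p D4; field; rewrite D1 D2 D4.
Qed.

Lemma measurable_poisson e dT (T : measurableType dT) (h : T -> Rd) : 0 < e ->
  measurable_fun setT h -> measurable_fun setT (fun t => poisson e (h t)).
Proof.
move=> e0 mh; apply: measurable_prod => i _.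
apply: measurable_funM => //; apply: measurable_funM => //.
apply: (measurableT_comp (f := fun t : R => (e ^+ 2 + t ^+ 2)^-1)); last first.
  exact: (measurableT_comp (@measurable_coord R d i) mh).
apply: continuous_measurable_fun => t; apply: cvgV.
  by rewrite gt_eqF// ltr_wpDr ?sqr_ge0// exprn_gt0.
by apply: cvgD; [exact: cvg_cst|exact: exprn_continuous].
Qed.

Lemma poissonN e (u : Rd) : poisson e (- u) = poisson e u.
Proof. by apply: eq_bigr => i _; rewrite mxE sqrrN. Qed.

Lemma poisson_le e (u : Rd) : 0 < e -> poisson e u <= \prod_(i < d) (pi^-1 * e^-1).
Proof.
move=> e0; apply: ler_prod => i _.
have D0 : 0 < e ^+ 2 + u ord0 i ^+ 2 by rewrite ltr_wpDr ?sqr_ge0// exprn_gt0.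
have p0 : 0 < pi^-1 :> R by rewrite invr_gt0 pi_gt0.
apply/andP; split; first by rewrite mulr_ge0 ?ltW// divr_gt0.
rewrite ler_pM2l// ler_pdivrMr//.
by rewrite mulrDr expr2 mulKf ?gt_eqF// lerDl mulr_ge0 ?invr_ge0 ?sqr_ge0// ltW.
Qed.

Lemma integral_poisson e (x : Rd) : 0 < e -> (\int[mu]_x' (poisson e (x' - x)%R)%:E = 1)%E.
Proof.
move=> e0; rewrite (ge0_integral_affine x e0).
- have [ic Ic] := integral_cauchyd.
  rewrite -ge0_integralZl//.
  + rewrite -[RHS]/(1%:E) -Ic rint_fineK//; apply: eq_integral => v _.
    by rewrite -EFinM (addrC x) addrK poisson_cauchy.
  + apply/measurable_EFinP; apply: measurable_poisson => //.
    under eq_fun do rewrite (addrC x) addrK.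
    by have := @measurable_affine R d 0 e; under eq_fun do rewrite add0r.
  + by move=> v _; rewrite lee_fin poisson_ge0// ltW.
  + by rewrite lee_fin exprn_ge0// ltW.
- apply/measurable_EFinP; apply: measurable_poisson => //.
  have := @measurable_affine R d (- x) 1; congr (measurable_fun _ _).
  by apply/funext => y; rewrite scale1r addrC.
- by move=> v; rewrite lee_fin poisson_ge0// ltW.
Qed.

End plancherel.

Section plancherel_ineq.
Variables (R : realType) (d : nat).
Local Notation Rd := 'rV[R]_d.
Local Notation mu := (lebesgue_rV R d).

Lemma conjcM (x y : R[i]) : conjc (x * y) = conjc x * conjc y.
Proof. exact: rmorphM. Qed.

Lemma conjcR (a : R) : conjc a%:C = a%:C.
Proof. by rewrite /= oppr0. Qed.

Lemma conj_ft s (g : Rd -> R[i]) y : cint mu g ->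
  ft (- s) (fun x => conjc (g x)) y = conjc (ft s g y).
Proof.
move=> cg; rewrite /ft conjcM conjcR; congr (_ * _).
have c1 : cint mu (fun x => g x * ce (s * dotr y x)).
  by apply: cint_ce => //; apply: measurable_funM => //; apply: measurable_dotr => //; exact: measurable_id.
rewrite (_ : (fun x => _) = (fun x => conjc (g x * ce (s * dotr y x)))); last first.
  by apply/funext => x; rewrite conjcM conj_ce mulNr.
apply: complexP; rewrite /cI.
  by apply: eq_Rintegral => x _; case: (g x * _).
rewrite /= -mulN1r -RintegralZl//; last exact: (cint_Im c1).
by apply: eq_Rintegral => x _; rewrite mulN1r; case: (g x * _).
Qed.

(* The Abel weight transforms into the Poisson kernel P, and the double integral of
   g(x) conj(g(x')) P(x' - x) is bounded by AM-GM since P has mass 1. *)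
Lemma plancherel_abel s e (g : Rd -> R[i]) : cint mu g -> s ^+ 2 = 1 -> 0 < e ->
  (\int[mu]_y (normc (ft s g y) ^+ 2 * abel e y)%:E <= \int[mu]_x (normc (g x) ^+ 2)%:E)%E.
Proof.
move=> cg s1 e0.
have cg' : cint mu (fun x => conjc (g x)).
  split; first exact: cmeas_conj cg.1.
  by under eq_fun do rewrite normc_conj; exact: cg.2.
have K := ft_kernel cg cg' e0 s1.
have mp : measurable_fun setT (fun z : Rd * Rd => poisson e (z.2 - z.1)).
  apply: measurable_poisson => //; apply: measurable_fun_coordP => i.
  under eq_fun do rewrite !mxE.
  apply: measurable_funB.
    exact: (measurableT_comp (@measurable_coord R d i) measurable_snd).
  exact: (measurableT_comp (@measurable_coord R d i) measurable_fst).
have mps x : measurable_fun setT (fun y : Rd => poisson e (y - x)).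
  apply: measurable_poisson => //.
  have := @measurable_affine R d (- x) 1; congr (measurable_fun _ _).
  by apply/funext => y; rewrite scale1r addrC.
have mg1 : measurable_fun setT (fun z : Rd * Rd => normc (g z.1)).
  exact: (measurableT_comp (measurable_normc cg.1) measurable_fst).
have mg2 : measurable_fun setT (fun z : Rd * Rd => normc (g z.2)).
  exact: (measurableT_comp (measurable_normc cg.1) measurable_snd).
(* A crude bound of the Poisson kernel, of no use as e tends to 0: it only dominates the double
   integrand by a product so that Fubini's theorem applies. *)
pose C : R := \prod_(i < d) (pi^-1 * e^-1).
have p0 (u : Rd) : 0 <= poisson e u by rewrite poisson_ge0// ltW.
have C0 : 0 <= C by exact: (le_trans (p0 0) (poisson_le 0 e0)).
have mf : cmeas (fun z : Rd * Rd => g z.1 * (conjc (g z.2) * (poisson e (z.2 - z.1))%:C)).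
  apply: cmeasM; first exact: (cmeas_comp measurable_fst cg.1).
  by apply: cmeasM; [exact: (cmeas_comp measurable_snd cg'.1)|exact: cmeas_real].
have nf x y : normc (g x * (conjc (g y) * (poisson e (y - x))%:C)) =
    normc (g x) * normc (g y) * poisson e (y - x).
  by rewrite !normcM normc_real normc_conj (ger0_norm (p0 _)) mulrA.
have [c c1 c2] := @cint_dom_prod _ _ _ _ _ mu mu _ (fun x => C * normc (g x)) (fun x => normc (g x)) mf
  (rintZ C cg.2) cg.2 (fun x => mulr_ge0 C0 (normc_ge0 _)) (fun=> normc_ge0 _)
  ltac:(by move=> x y; rewrite nf mulrC -mulrA ler_wpM2r ?mulr_ge0 ?normc_ge0// poisson_le).
have ri : rint mu (fun y => normc (ft s g y) ^+ 2 * abel e y).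
  apply: (rint_le (k := fun y => (ft_cst R d * \int[mu]_x normc (g x)) ^+ 2 * abel e y)).
  - apply: measurable_funM; last exact: rint_measurable (rint_abel_rV _ e0).
    by apply: measurable_funX; apply: measurable_normc; exact: cmeas_ft.
  - by apply: rintZ; exact: rint_abel_rV.
  - move=> y; rewrite ger0_norm ?mulr_ge0 ?sqr_ge0 ?normc_ge0 ?(ltW (abel_gt0 _ _))//.
    rewrite ler_pM2r ?abel_gt0//; apply: lerXn2r; rewrite ?nnegrE; [exact: normc_ge0| |exact: ft_le].
    exact: le_trans (normc_ge0 _) (ft_le s y cg).
have A : cI mu (fun y => ft s g y * (ft (- s) (fun x => conjc (g x)) y * (abel e y)%:C)) =
    (\int[mu]_y (normc (ft s g y) ^+ 2 * abel e y))%:C.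
  rewrite -cI_real; apply: eq_cI => y; rewrite conj_ft// mulrA (mulrC (ft s g y)) mul_conjc.
  by rewrite -rmorphM.
rewrite -(rint_fineK ri).
have B : \int[mu]_y (normc (ft s g y) ^+ 2 * abel e y) <=
    \int[(mu \x mu)%E]_z (normc (g z.1) * normc (g z.2) * poisson e (z.2 - z.1)).
  apply: le_trans (ler_norm _) _; rewrite -normc_real -A K.
  rewrite (_ : cI mu _ = cI (mu \x mu)%E (fun z => g z.1 * (conjc (g z.2) * (poisson e (z.2 - z.1))%:C))).
    by apply: le_trans (normc_cI c) _; rewrite le_eqVlt; apply/orP; left; apply/eqP; apply: eq_Rintegral => -[x y] _; exact: nf.
  rewrite -(cI_fubini1 c c1).2; apply: eq_cI => x /=; rewrite cIMl//.
  apply: (cint_le (h := fun y => C * normc (g y))).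
  - apply: cmeasM; first exact: cg'.1.
    by apply: cmeas_real; exact: mps.
  - by apply: rintZ; exact: cg.2.
  - by move=> y; rewrite normcM normc_real normc_conj ger0_norm// mulrC ler_wpM2r ?normc_ge0// poisson_le.
apply: le_trans (_ : ((\int[(mu \x mu)%E]_z (normc (g z.1) * normc (g z.2) * poisson e (z.2 - z.1)))%:E <= _)%E).
  by rewrite lee_fin.
have rn : rint (mu \x mu)%E (fun z => normc (g z.1) * normc (g z.2) * poisson e (z.2 - z.1)).
  by have := c.2; congr (rint _ _); apply/funext => -[x y]; exact: nf.
rewrite rint_fineK//.
have mh1 : measurable_fun setT (fun z : Rd * Rd => normc (g z.1) ^+ 2 * poisson e (z.2 - z.1)).
  by apply: measurable_funM => //; exact: measurable_funX.
have mh2 : measurable_fun setT (fun z : Rd * Rd => normc (g z.2) ^+ 2 * poisson e (z.2 - z.1)).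
  by apply: measurable_funM => //; exact: measurable_funX.
have h1 z : 0 <= normc (g z.1) ^+ 2 * poisson e (z.2 - z.1).
  by rewrite mulr_ge0 ?sqr_ge0.
have h2 z : 0 <= normc (g z.2) ^+ 2 * poisson e (z.2 - z.1).
  by rewrite mulr_ge0 ?sqr_ge0.
have mg : measurable_fun setT (fun x => (normc (g x) ^+ 2)%:E).
  by apply/measurable_EFinP; apply: measurable_funX; exact: measurable_normc cg.1.
have mpx x : measurable_fun setT (fun y : Rd => (poisson e (y - x))%:E).
  by apply/measurable_EFinP; exact: mps.
have T1 : (\int[(mu \x mu)%E]_z (normc (g z.1) ^+ 2 * poisson e (z.2 - z.1))%:E =
    \int[mu]_x (normc (g x) ^+ 2)%:E)%E.
  rewrite fubini_tonelli1; [|exact/measurable_EFinP|by move=> z; rewrite lee_fin].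
  apply: eq_integral => x _; rewrite /fubini_F /=.
  under eq_integral do rewrite EFinM.
  rewrite ge0_integralZl ?integral_poisson ?mule1//.
  - by move=> y _; rewrite lee_fin.
  - by rewrite lee_fin sqr_ge0.
have T2 : (\int[(mu \x mu)%E]_z (normc (g z.2) ^+ 2 * poisson e (z.2 - z.1))%:E =
    \int[mu]_x (normc (g x) ^+ 2)%:E)%E.
  rewrite fubini_tonelli2; [|exact/measurable_EFinP|by move=> z; rewrite lee_fin].
  apply: eq_integral => y _; rewrite /fubini_G /=.
  under eq_integral do rewrite -poissonN opprB EFinM.
  rewrite ge0_integralZl ?integral_poisson ?mule1//.
  - by move=> x _; rewrite lee_fin.
  - by rewrite lee_fin sqr_ge0.
apply: (@le_trans _ _ (\int[(mu \x mu)%E]_z ((2^-1)%:E * (normc (g z.1) ^+ 2 * poisson e (z.2 - z.1))%:E +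
   (2^-1)%:E * (normc (g z.2) ^+ 2 * poisson e (z.2 - z.1))%:E))%E).
  apply: ge0_le_integral => //.
  - by move=> z _; rewrite lee_fin !mulr_ge0 ?normc_ge0.
  - exact: measurable_int rn.
  - by apply: emeasurable_funD; apply: emeasurable_funM => //; exact/measurable_EFinP.
  - move=> z _; rewrite -!EFinM -EFinD lee_fin !mulrA -mulrDl ler_wpM2r//.
    have := sqr_ge0 (normc (g z.1) - normc (g z.2)); lra.
rewrite ge0_integralD//; last 4 first.
- by move=> z _; rewrite -EFinM lee_fin mulr_ge0 ?invr_ge0.
- by apply: emeasurable_funM => //; exact/measurable_EFinP.
- by move=> z _; rewrite -EFinM lee_fin mulr_ge0 ?invr_ge0.
- by apply: emeasurable_funM => //; exact/measurable_EFinP.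
rewrite !ge0_integralZl//; try exact/measurable_EFinP; try by move=> z _; rewrite lee_fin.
rewrite T1 T2 -ge0_muleDl ?lee_fin ?invr_ge0// -EFinD.
by rewrite (_ : 2^-1 + 2^-1 = 1 :> R) ?mul1e//; lra.
Qed.

Lemma cvg_bigprod (I : Type) (r : seq I) (u : nat -> I -> R) (l : I -> R) :
  (forall i, u n i @[n --> \oo] --> l i) ->
  \prod_(i <- r) u n i @[n --> \oo] --> \prod_(i <- r) l i.
Proof.
move=> ul; elim: r => [|i r ih].
  by under eq_fun do rewrite big_nil; rewrite big_nil; exact: cvg_cst.
by under eq_fun do rewrite big_cons; rewrite big_cons; exact: cvgM.
Qed.

Lemma abel_cvg1 (y : Rd) : abel n.+1%:R^-1 y @[n --> \oo] --> (1 : R).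
Proof.
have E : \prod_(i < d) expR (- (0 * `|y ord0 i|)) = 1 :> R.
  by apply: big1 => i _; rewrite mul0r oppr0 expR0.
suff : abel n.+1%:R^-1 y @[n --> \oo] --> \prod_(i < d) expR (- (0 * `|y ord0 i|)) by rewrite E.
apply: cvg_bigprod => i; apply: continuous_cvg; first exact: continuous_expR.
by apply: cvgN; apply: cvgM; [exact: cvg_harmonic|exact: cvg_cst].
Qed.

(** Fatou's lemma removes the Abel weight along e = 1/(n+1), since the bound of [plancherel_abel]
    does not depend on e. *)
Lemma plancherel_le s (g : Rd -> R[i]) : cint mu g -> s ^+ 2 = 1 ->
  (\int[mu]_y (normc (ft s g y) ^+ 2)%:E <= \int[mu]_x (normc (g x) ^+ 2)%:E)%E.
Proof.
move=> cg s1; apply: (fatou_le (f_ := fun n y => normc (ft s g y) ^+ 2 * abel n.+1%:R^-1 y)).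
- move=> n; apply: measurable_funM.
    by apply: measurable_funX; apply: measurable_normc; exact: cmeas_ft.
  by apply: rint_measurable (rint_abel_rV _ _); rewrite invr_gt0.
- by move=> n y; rewrite mulr_ge0 ?sqr_ge0// ltW ?abel_gt0.
- move=> y; rewrite -[X in _ --> X]mulr1; apply: cvgM; first exact: cvg_cst.
  exact: abel_cvg1.
- by apply: nearW => n; apply: plancherel_abel => //; rewrite invr_gt0.
Qed.

End plancherel_ineq.

(** * Parseval's formula *)

Section parseval.
Variables (R : realType) (d : nat).
Local Notation Rd := 'rV[R]_d.
Local Notation mu := (lebesgue_rV R d).

Lemma normc_cvg_unique (u : nat -> R[i]) (a b : R[i]) :
  normc (u n - a) @[n --> \oo] --> 0 -> normc (u n - b) @[n --> \oo] --> 0 -> a = b.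
Proof.
move=> ua ub; apply/eqP; rewrite -subr_eq0; apply/eqP/eq0_normc/eqP.
rewrite eq_le normc_ge0 andbT; apply/ler_addgt0Pr => e e0; rewrite add0r.
have e2 : 0 < e / 2 by rewrite divr_gt0.
have /cvgr0Pnorm_lt/(_ _ e2) Ha := ua; have /cvgr0Pnorm_lt/(_ _ e2) Hb := ub.
near \oo => n.
have h1 : `|normc (u n - a)| < e / 2 by near: n.
have h2 : `|normc (u n - b)| < e / 2 by near: n.
rewrite ger0_norm ?normc_ge0// in h1; rewrite ger0_norm ?normc_ge0// in h2.
have -> : a - b = (u n - b) - (u n - a) by ring.
rewrite (le_trans (le_normcD _ _))// normcN; lra.
Unshelve. all: by end_near. Qed.

Lemma cvg0_mull (u : nat -> R) (c : R) : u n @[n --> \oo] --> 0 -> c * u n @[n --> \oo] --> 0.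
Proof. by move=> u0; have := cvgM (cvg_cst c) u0; rewrite mulr0; apply. Qed.

Definition sqint (g : Rd -> R[i]) := rint mu (fun x => normc (g x) ^+ 2).

Lemma sqint_ft s g : cint mu g -> sqint g -> s ^+ 2 = 1 -> sqint (ft s g).
Proof.
move=> cg sg s1; apply/rintP; first by move=> x; rewrite sqr_ge0.
split; first by apply: measurable_funX; apply: measurable_normc; exact: cmeas_ft.
apply: le_lt_trans (plancherel_le cg s1) _.
by have [] := (rintP mu (fun x => sqr_ge0 (normc (g x)))).1 sg.
Qed.

Lemma normc_continuous_affine (h : Rd -> R[i]) x (v : Rd) :
  (normc (h y - h x) @[y --> x] --> 0) ->
  normc (h (x + n.+1%:R^-1 *: v) - h x) @[n --> \oo] --> 0.
Proof.
move=> hx.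
have H : (x + n.+1%:R^-1 *: v) @[n --> \oo] --> x.
  rewrite -[X in _ --> X]addr0 -(scale0r v); apply: cvgD; first exact: cvg_cst.
  by apply: cvgZl; exact: cvg_harmonic.
exact: (cvg_comp _ (fun y => normc (h y - h x)) H hx).
Qed.

(** The substitution x' = x + e v moves e from the kernel into the argument of [h], so that the
    limit e -> 0 can be taken under a fixed majorant. *)
Lemma poisson_approx (h : Rd -> R[i]) e (x : Rd) C : cmeas h -> (forall x, normc (h x) <= C) -> 0 < e ->
  cI mu (fun x' => h x' * (poisson e (x' - x))%:C) =
  cI mu (fun v => h (x + e *: v) * (cauchyd v)%:C).
Proof.
move=> mh hC e0.
have mps : measurable_fun setT (fun y : Rd => poisson e (y - x)).
  apply: measurable_poisson => //.
  have := @measurable_affine R d (- x) 1; congr (measurable_fun _ _).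
  by apply/funext => y; rewrite scale1r addrC.
have p0 (u : Rd) : 0 <= poisson e u by rewrite poisson_ge0// ltW.
have ip : cint mu (fun x' : Rd => (poisson e (x' - x))%:C).
  apply: cint_real => //; apply/rintP => //; split => //.
  by rewrite integral_poisson// ltry.
have ch : cint mu (fun x' => h x' * (poisson e (x' - x))%:C).
  by under eq_fun do rewrite mulrC; exact: (cintMb ip mh hC).
have [c' ->] := cI_affine x e0 ch.
rewrite -cIMl//; apply: eq_cI => v; rewrite mulrCA; congr (_ * _).
by rewrite (addrC x) addrK -rmorphM poisson_cauchy.
Qed.

(** Dominated convergence with majorant |a|^2 + |b|^2, which bounds |a b|. *)
Lemma abel_dct (a b : Rd -> R[i]) : cmeas a -> cmeas b -> sqint a -> sqint b ->
  normc (cI mu (fun y => a y * (b y * (abel n.+1%:R^-1 y)%:C)) - cI mu (fun y => a y * b y))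
    @[n --> \oo] --> 0.
Proof.
move=> ma mb sa sb.
have e0 n : 0 < n.+1%:R^-1 :> R by rewrite invr_gt0.
have mab n : cmeas (fun y : Rd => (abel n.+1%:R^-1 y)%:C).
  by apply: cmeas_real; apply: rint_measurable (rint_abel_rV _ (e0 n)).
apply: (cI_dct (f_ := fun n y => a y * (b y * (abel n.+1%:R^-1 y)%:C)) _ _ (rintD sa sb) _ _).2.
- by move=> n; apply: cmeasM => //; exact: cmeasM.
- exact: cmeasM.
- move=> n x; rewrite !normcM normc_real ger0_norm ?(ltW (abel_gt0 _ _))// mulrA.
  apply: (le_trans (ler_piMr _ (abel_le1 _ (ltW (e0 n))))).
    by rewrite mulr_ge0 ?normc_ge0.
  have := sqr_ge0 (normc (a x) - normc (b x)).
  have := normc_ge0 (a x); have := normc_ge0 (b x); nra.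
- move=> x.
  have E n : normc (a x * (b x * (abel n.+1%:R^-1 x)%:C) - a x * b x) =
      normc (a x * b x) * `|abel n.+1%:R^-1 x - 1|.
    by rewrite -normc_real -normcM rmorphB /= mulrBr mulr1 mulrA.
  under eq_fun do rewrite E.
  apply: cvg0_mull.
  apply/cvgr0Pnorm_lt => e ee; have /cvgrPdist_lt/(_ _ ee) := @abel_cvg1 R d x.
  by apply: filterS => n; rewrite distrC normr_id.
Qed.

Lemma cauchy_dct (h : Rd -> R[i]) C x : cmeas h -> (forall x, normc (h x) <= C) ->
  (normc (h y - h x) @[y --> x] --> 0) ->
  normc (cI mu (fun v => h (x + n.+1%:R^-1 *: v) * (cauchyd v)%:C) - h x) @[n --> \oo] --> 0.
Proof.
move=> mh hC hx; have [ic Ic] := integral_cauchyd R d.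
have cc : cint mu (fun v : Rd => (cauchyd v)%:C) by apply: cint_real => // v; exact: cauchyd_ge0.
have -> : h x = cI mu (fun v => h x * (cauchyd v)%:C) by rewrite cIMl// cI_real Ic mulr1.
refine (proj2 (cI_dct (mu := mu) (f_ := fun n v => h (x + n.+1%:R^-1 *: v) * (cauchyd v)%:C)
  (f := fun v => h x * (cauchyd v)%:C) _ _ (rintZ C ic) _ _)).
- by move=> n; apply: cmeasM cc.1; exact: (cmeas_comp (measurable_affine x _) mh).
- by apply: cmeasM cc.1; exact: cmeas_cst.
- by move=> n v; rewrite normcM normc_real (ger0_norm (cauchyd_ge0 _)) ler_wpM2r ?cauchyd_ge0.
- move=> v; under eq_fun do rewrite -mulrBl normcM mulrC.
  apply: cvg0_mull.
  exact: normc_continuous_affine.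
Qed.

Lemma cauchy_le (h : Rd -> R[i]) C x e : cmeas h -> (forall x, normc (h x) <= C) ->
  normc (cI mu (fun v => h (x + e *: v) * (cauchyd v)%:C)) <= C.
Proof.
move=> mh hC; have [ic Ic] := integral_cauchyd R d.
have mc : cmeas (fun v : Rd => (cauchyd v)%:C) by apply: cmeas_real; exact: rint_measurable ic.
apply: (le_trans (normc_cI_le _ (rintZ C ic) _)).
- by apply: cmeasM mc; exact: (cmeas_comp (measurable_affine x _) mh).
- by move=> v; rewrite normcM normc_real (ger0_norm (cauchyd_ge0 _)) ler_wpM2r ?cauchyd_ge0.
- by rewrite RintegralZl// Ic mulr1.
Qed.

(** Let e -> 0 in the Abel-regularized formula. On the side of the transforms, domination comes from
    Plancherel's inequality for both; on the other side, the Poisson averages of [h] are bounded by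
    C and converge at every point by continuity. *)
Lemma parseval (g h : Rd -> R[i]) s C : cint mu g -> cint mu h -> sqint g -> sqint h ->
  (forall x, normc (h x) <= C) -> (forall x, normc (h y - h x) @[y --> x] --> 0) ->
  s ^+ 2 = 1 ->
  cI mu (fun y => ft s g y * ft (- s) h y) = cI mu (fun x => g x * h x).
Proof.
move=> cg ch sg sh hC hcont s1.
have e0 n : 0 < n.+1%:R^-1 :> R by rewrite invr_gt0.
have s1' : (- s) ^+ 2 = 1 by rewrite sqrrN.
have L1 := abel_dct (cmeas_ft s cg) (cmeas_ft (- s) ch) (sqint_ft cg sg s1) (sqint_ft ch sh s1').
have K n x : g x * ft s (fun y => ft (- s) h y * (abel n.+1%:R^-1 y)%:C) x =
    g x * cI mu (fun v => h (x + n.+1%:R^-1 *: v) * (cauchyd v)%:C).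
  by rewrite ft_abel_ft// (poisson_approx _ ch.1 hC).
have L2 : normc (cI mu (fun x => g x * cI mu (fun v => h (x + n.+1%:R^-1 *: v) * (cauchyd v)%:C)) -
    cI mu (fun x => g x * h x)) @[n --> \oo] --> 0.
  apply: (cI_dct (f_ := fun n x => g x * cI mu (fun v => h (x + n.+1%:R^-1 *: v) * (cauchyd v)%:C))
    _ _ (rintZ C cg.2) _ _).2.
  - move=> n; have := (cint_ftM s (cint_ft_abel (- s) ch (e0 n)) cg).1; congr (cmeas _).
    by apply/funext => x; exact: K.
  - exact: cmeasM cg.1 ch.1.
  - by move=> n x; rewrite normcM mulrC ler_wpM2r ?normc_ge0//; apply: cauchy_le hC; exact: ch.1.
  - move=> x; under eq_fun do rewrite -mulrBr normcM.
    apply: cvg0_mull.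
    by apply: cauchy_dct hC _ => //; exact: ch.1.
apply: (normc_cvg_unique L1).
apply: cvg_trans L2; apply: near_eq_cvg; apply: nearW => n.
congr (normc (_ - _)); rewrite ft_multiplication//; last exact: cint_ft_abel.
by apply: eq_cI => x; rewrite K.
Qed.

End parseval.

(** * Goursat's theorem and contour shift *)

Section hol.
Variable R : realType.
Implicit Types (f g : R[i] -> R[i]) (w h : R[i]).

(** Complex differentiability at [w], in the epsilon form with real-valued moduli that Goursat's
    estimate consumes. *)
Definition hol_at f w := exists D : R[i], forall e : R, 0 < e -> exists2 r : R, 0 < r &
  forall h, normc h < r -> normc (f (w + h) - f w - D * h) <= e * normc h.

Lemma hol_at_cst (c w : R[i]) : hol_at (fun=> c) w.
Proof.
exists 0 => e e0; exists 1 => // h _; rewrite mul0r subr0 subrr normc0.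
by rewrite mulr_ge0 ?normc_ge0// ltW.
Qed.

Lemma hol_at_id w : hol_at id w.
Proof.
exists 1 => e e0; exists 1 => // h _; rewrite mul1r (addrC w) addrK subrr normc0.
by rewrite mulr_ge0 ?normc_ge0// ltW.
Qed.

Lemma hol_atD f g w : hol_at f w -> hol_at g w -> hol_at (fun z => f z + g z) w.
Proof.
move=> [D Df] [E Eg]; exists (D + E) => e e0.
have e2 : 0 < e / 2 by rewrite divr_gt0.
have [r r0 H] := Df _ e2; have [s s0 K] := Eg _ e2.
exists (Num.min r s); first by rewrite lt_min r0.
move=> h; rewrite lt_min => /andP[hr hs].
rewrite (_ : _ - _ = (f (w + h) - f w - D * h) + (g (w + h) - g w - E * h)); last by ring.
rewrite (le_trans (le_normcD _ _))//; have := H _ hr; have := K _ hs; lra.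
Qed.

Lemma hol_at_lip f w : hol_at f w -> exists2 K : R, 0 < K & exists2 r : R, 0 < r &
  forall h, normc h < r -> normc (f (w + h) - f w) <= K * normc h.
Proof.
move=> [D Df]; have [r r0 H] := Df _ ltr01.
exists (1 + normc D); first by rewrite ltr_wpDr ?normc_ge0.
exists r => // h hr; rewrite -[f (w + h) - f w](subrK (D * h)).
by rewrite (le_trans (le_normcD _ _))// normcM mulrDl lerD2r H.
Qed.

Lemma hol_atM f g w : hol_at f w -> hol_at g w -> hol_at (fun z => f z * g z) w.
Proof.
move=> hf hg; have [K K0 [r r0 Hr]] := hol_at_lip hf; have [L L0 [s s0 Hs]] := hol_at_lip hg.
case: hf => D Df; case: hg => E Eg; exists (D * g w + f w * E) => e e0.
(* Below, [q] bounds the product of the two increments, at most K L |h|^2, by e/2 |h|; dividing by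
   [M] lets the two remainder terms share the other e/2. *)
pose M := normc (f w) + normc (g w) + 1.
have M0 : 0 < M by rewrite ltr_wpDl// addr_ge0 ?normc_ge0.
have e1 : 0 < e / 2 / M by rewrite !divr_gt0.
have [r' r0' Hr'] := Df _ e1; have [s' s0' Hs'] := Eg _ e1.
pose q := e / 2 / (K * L).
have q0 : 0 < q by rewrite !divr_gt0// mulr_gt0.
exists (Num.min (Num.min r s) (Num.min (Num.min r' s') q)).
  by rewrite !lt_min r0 s0 r0' s0' q0.
move=> h; rewrite !lt_min => /andP[/andP[h1 h2] /andP[/andP[h3 h4] h5]].
rewrite (_ : _ - _ = (f (w + h) - f w) * (g (w + h) - g w) +
   (f (w + h) - f w - D * h) * g w + f w * (g (w + h) - g w - E * h)); last by ring.
have n0 := normc_ge0 h.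
have A1 : normc ((f (w + h) - f w) * (g (w + h) - g w)) <= e / 2 * normc h.
  rewrite normcM (le_trans (ler_pM (normc_ge0 _) (normc_ge0 _) (Hr _ h1) (Hs _ h2)))//.
  rewrite mulrACA mulrA ler_wpM2r// mulrC -ler_pdivlMr ?mulr_gt0//.
  exact: ltW.
have A2 : normc ((f (w + h) - f w - D * h) * g w) <= e / 2 / M * normc h * normc (g w).
  by rewrite normcM ler_wpM2r ?normc_ge0// Hr'.
have A3 : normc (f w * (g (w + h) - g w - E * h)) <= e / 2 / M * normc h * normc (f w).
  by rewrite normcM mulrC ler_wpM2r ?normc_ge0// Hs'.
rewrite (le_trans (le_normcD _ _))//.
rewrite (le_trans (lerD (le_normcD _ _) A3))//.
rewrite (le_trans (lerD (lerD A1 A2) (lexx _)))//.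
have -> : e / 2 * normc h + e / 2 / M * normc h * normc (g w) + e / 2 / M * normc h * normc (f w) =
  e / 2 * normc h + e / 2 / M * normc h * (normc (g w) + normc (f w)) by ring.
have A4 : e / 2 / M * normc h * (normc (g w) + normc (f w)) <= e / 2 / M * normc h * M.
  apply: ler_wpM2l; first by rewrite mulr_ge0// ltW.
  by rewrite /M; lra.
have A5 : e / 2 / M * normc h * M = e / 2 * normc h by field; rewrite gt_eqF.
rewrite A5 in A4; lra.
Qed.

Lemma hol_at_sum (I : Type) (s : seq I) (f : I -> R[i] -> R[i]) w :
  (forall i, hol_at (f i) w) -> hol_at (fun z => \sum_(i <- s) f i z) w.
Proof.
move=> hf; elim: s => [|i s ih].
  by under eq_fun do rewrite big_nil; exact: hol_at_cst.
by under eq_fun do rewrite big_cons; exact: hol_atD.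
Qed.

Lemma hol_at_comp f g w : hol_at g w -> hol_at f (g w) -> hol_at (f \o g) w.
Proof.
move=> hg hf; have [L L0 [s s0 Hs]] := hol_at_lip hg.
case: hf => D Df; case: hg => E Eg; exists (D * E) => e e0.
have e1 : 0 < e / 2 / L by rewrite !divr_gt0.
have e2 : 0 < e / 2 / (normc D + 1) by rewrite !divr_gt0// ltr_wpDl ?normc_ge0.
have [r r0 Hr] := Df _ e1; have [q q0 Hq] := Eg _ e2.
exists (Num.min s (Num.min q (r / L))); first by rewrite !lt_min s0 q0 divr_gt0.
move=> h; rewrite !lt_min => /andP[h1 /andP[h2 h3]] /=.
have n0 := normc_ge0 h.
pose k := g (w + h) - g w.
have kr : normc k < r.
  by rewrite (le_lt_trans (Hs _ h1))// mulrC -ltr_pdivlMr.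
have -> : f (g (w + h)) - f (g w) - D * E * h =
   (f (g w + k) - f (g w) - D * k) + D * (k - E * h).
  by rewrite /k (addrC (g w)) subrK; ring.
have B1 := Hr _ kr; have B2 := Hq _ h2; rewrite -/k in B2.
rewrite (le_trans (le_normcD _ _))// normcM.
have B3 : e / 2 / L * normc k <= e / 2 * normc h.
  rewrite (_ : e / 2 * normc h = e / 2 / L * (L * normc h)); last by field; rewrite gt_eqF.
  by apply: ler_wpM2l; [exact: ltW|exact: Hs].
have B4 : normc D * normc (k - E * h) <= e / 2 * normc h.
  apply: (le_trans (ler_wpM2l (normc_ge0 _) B2)).
  have D1 : normc D + 1 != 0 by rewrite gt_eqF// ltr_wpDl ?normc_ge0.
  rewrite (_ : e / 2 * normc h = (normc D + 1) * (e / 2 / (normc D + 1) * normc h)); last by field.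
  by apply: ler_wpM2r; [rewrite mulr_ge0 ?(ltW e2)|lra].
lra.
Qed.

Definition cexp w : R[i] := (expR (complex.Re w))%:C * ce (complex.Im w).

Lemma cexpD w z : cexp (w + z) = cexp w * cexp z.
Proof. by rewrite /cexp !ReImE expRD ceD rmorphM mulrACA. Qed.

Lemma normc_cexp w : normc (cexp w) = expR (complex.Re w).
Proof. by rewrite normcM normc_ce mulr1 normc_real ger0_norm ?expR_ge0. Qed.

Lemma mvt_bound (f df : R -> R) M b : (forall x : R, is_derive x (1 : R) f (df x)) ->
  (forall c, `|c| <= `|b| -> `|df c| <= M) -> `|f b - f 0| <= M * `|b|.
Proof.
move=> fd dfM.
have cf : continuous f.
  by move=> x; apply/differentiable_continuous/derivable1_diffP; case: (fd x).
have [b0|b0|->] := ltgtP b 0; last by rewrite subrr !normr0 mulr0.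
- have [c cb E] := MVT b0 (fun x _ => fd x) (continuous_subspaceT cf).
  rewrite distrC E normrM sub0r normrN ler_wpM2r// dfM//.
  move: cb; rewrite in_itv/= => /andP[? ?]; rewrite !ltr0_norm//; lra.
- have [c cb E] := MVT b0 (fun x _ => fd x) (continuous_subspaceT cf).
  rewrite E normrM subr0 ler_wpM2r// dfM//.
  move: cb; rewrite in_itv/= => /andP[? ?]; rewrite !gtr0_norm//; lra.
Qed.

Lemma sin_le_abs (b : R) : `|sin b| <= `|b|.
Proof.
have := @mvt_bound sin cos 1 b (fun x => is_derive_sin x) (fun c _ => cos_max c).
by rewrite sin0 subr0 mul1r.
Qed.

Lemma cos_sub1_le (b : R) : `|cos b - 1| <= b ^+ 2.
Proof.
have H c : `|c| <= `|b| -> `|- sin c| <= `|b|.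
  by move=> cb; rewrite normrN; exact: le_trans (sin_le_abs c) cb.
have := @mvt_bound cos (fun x => - sin x) `|b| b (fun x => is_derive_cos x) H.
by rewrite cos0 -expr2 sqr_normr.
Qed.

Lemma sin_sub_le (b : R) : `|b| <= 1 -> `|sin b - b| <= b ^+ 2.
Proof.
move=> b1.
have D (x : R) : is_derive x (1 : R) (fun x => sin x - x) (cos x - 1) by apply: is_derive_eq.
suff H c : `|c| <= `|b| -> `|cos c - 1| <= `|b|.
  by have := mvt_bound D H; rewrite sin0 !subr0 -expr2 sqr_normr.
move=> cb; apply: le_trans (cos_sub1_le c) _.
rewrite -sqr_normr expr2; apply: le_trans (_ : `|c| * 1 <= _); last by rewrite mulr1.
by rewrite ler_wpM2l// (le_trans cb).
Qed.

(** The inequality 1 + x <= exp(x) at - a gives exp(a) <= 1 / (1 - a), so the remainder is at most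
    a^2 / (1 - a), and 1 - a >= 1/2. *)
Lemma expR_sub_le (a : R) : `|a| <= 2^-1 -> `|expR a - 1 - a| <= 2 * a ^+ 2.
Proof.
rewrite ler_norml => /andP[a1 a2].
have := expR_ge1Dx a; have := expR_ge1Dx (- a); rewrite expRN => h1 h2.
rewrite ger0_norm; last lra.
have e0 := expR_gt0 a.
have h3 : (1 - a) * expR a <= 1 by rewrite -ler_pdivlMr// div1r.
have := sqr_ge0 a; nra.
Qed.

(** With w = a + i b, the bounds below add up to 2 a^2 + (3/2) b^2 for the real part and a^2 + 2 b^2
    for the imaginary part; the constant 4 covers the sum. *)
Lemma cexp_sub_le w : normc w <= 2^-1 -> normc (cexp w - 1 - w) <= 4 * normc w ^+ 2.
Proof.
move=> w1; have hn := normc_sqr w; have ha := normc_Re w; have hb := normc_Im w.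
apply: le_trans (normc_le _) _; rewrite hn /cexp !ReImE.
cbn [real_complex_def ce complex.Re complex.Im].
set a := complex.Re w in ha *; set b := complex.Im w in hb *.
rewrite !mul0r subr0 addr0 (_ : complex.Re (1 : R[i]) = 1)// (_ : complex.Im (1 : R[i]) = 0)// subr0.
have {}ha := le_trans ha w1; have {}hb := le_trans hb w1.
have b1 : `|b| <= 1 by lra.
have h1 := expR_sub_le ha; have h2 := cos_sub1_le b; have h3 := sin_sub_le b1.
have h4 := sin_le_abs b; have h5 := cos_max b.
have E1 : expR a * cos b - 1 - a = (expR a - 1 - a) * cos b + (1 + a) * (cos b - 1) by ring.
have E2 : expR a * sin b - b = (expR a - 1) * sin b + (sin b - b) by ring.
rewrite E1 E2.
have k1 : `|(expR a - 1 - a) * cos b| <= 2 * a ^+ 2.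
  by rewrite normrM -[leRHS]mulr1 ler_pM.
have k2 : `|(1 + a) * (cos b - 1)| <= 3 / 2 * b ^+ 2.
  rewrite normrM ler_pM//; apply: le_trans (ler_normD _ _) _; rewrite normr1; lra.
have k3 : `|(expR a - 1) * sin b| <= 2 * `|a| * `|b|.
  rewrite normrM ler_pM//; rewrite (_ : expR a - 1 = (expR a - 1 - a) + a); last by ring.
  apply: le_trans (ler_normD _ _) _.
  have : a ^+ 2 <= 2^-1 * `|a| by rewrite -sqr_normr expr2 ler_wpM2r.
  lra.
have k4 : 2 * `|a| * `|b| <= a ^+ 2 + b ^+ 2.
  by have := sqr_ge0 (`|a| - `|b|); rewrite sqrrB !sqr_normr; lra.
have := ler_normD ((expR a - 1 - a) * cos b) ((1 + a) * (cos b - 1)).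
have := ler_normD ((expR a - 1) * sin b) (sin b - b).
have := sqr_ge0 a; have := sqr_ge0 b; lra.
Qed.

Lemma hol_at_cexp w : hol_at cexp w.
Proof.
exists (cexp w) => e e0.
pose M := 4 * normc (cexp w) + 1.
have M0 : 0 < M by rewrite ltr_wpDl// mulr_ge0 ?normc_ge0.
exists (Num.min 2^-1 (e / M)); first by rewrite lt_min invr_gt0 ltr0n divr_gt0.
move=> h; rewrite lt_min => /andP[h1 h2]; have n0 := normc_ge0 h.
have -> : cexp (w + h) - cexp w - cexp w * h = cexp w * (cexp h - 1 - h) by rewrite cexpD; ring.
rewrite normcM; apply: (le_trans (ler_wpM2l (normc_ge0 _) (cexp_sub_le (ltW h1)))).
rewrite mulrA expr2 mulrA ler_wpM2r//.
have : normc h * M <= e by rewrite -ler_pdivlMr// ltW.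
by rewrite /M; nra.
Qed.

End hol.

Section seg.
Variable R : realType.
Local Notation leb := (@lebesgue_measure R).
Local Notation cmeasR := (@cmeas _ (measurableTypeR R) R).
Implicit Types g h : R -> R[i].

(** Half-open intervals, so that cutting at an intermediate point splits the indicator exactly, as
    in [cind_split]. *)
Definition cind (a b : R) (x : R) : R[i] := (\1_(`]a, b]%classic) x)%:C.

Definition seg (a b : R) g : R[i] := cI leb (fun x => cind a b x * g x).

Definition segint (a b : R) g := cint leb (fun x => cind a b x * g x).

Lemma cmeas_cind a b : cmeasR (cind a b).
Proof. by apply: cmeas_real; apply: measurable_indic; exact: measurable_itv. Qed.

Lemma normc_cind a b x : normc (cind a b x) = \1_(`]a, b]%classic) x.
Proof. by rewrite normc_real ger0_norm. Qed.

Lemma rint_indic (a b : R) : a <= b -> rint leb (\1_(`]a, b]%classic) : R -> R) /\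
  \int[leb]_x (\1_(`]a, b]%classic) x : R) = b - a.
Proof.
move=> ab.
have E : (\int[leb]_x (\1_(`]a, b]%classic) x : R)%:E = (b - a)%:E)%E.
  rewrite integral_indic ?setIT//.
  apply: etrans (lebesgue_measure_itv `]a, b]) _; rewrite /= lte_fin; case: ltP => // ba.
  by congr EFin; apply/esym/eqP; rewrite subr_eq0 eq_le ba ab.
split; last by rewrite /Rintegral E.
apply/rintP => [x|]; first by rewrite indicE.
split; last by rewrite E ltry.
by apply: (@measurable_indic _ _ R setT `]a, b]%classic); exact: measurable_itv.
Qed.

Lemma seg_le a b g (M : R) : a <= b -> cmeasR g -> (forall x, a < x <= b -> normc (g x) <= M) ->
  segint a b g /\ normc (seg a b g) <= M * (b - a).
Proof.
move=> ab mg gM; have [i1 I1] := rint_indic ab.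
have H x : normc (cind a b x * g x) <= M * \1_(`]a, b]%classic) x.
  rewrite normcM normc_cind indicE; case: (boolP (x \in _)) => xab /=; last by rewrite mul0r mulr0.
  by rewrite mul1r mulr1 gM//; move: xab; rewrite inE/= in_itv.
have mm : cmeasR (fun x => cind a b x * g x) by apply: cmeasM mg; exact: cmeas_cind.
split; first exact: (cint_le mm (rintZ M i1) H).
by rewrite -I1 -RintegralZl//; exact: (normc_cI_le mm (rintZ M i1) H).
Qed.

Lemma segB a b g h : segint a b g -> segint a b h ->
  seg a b (fun x => g x - h x) = seg a b g - seg a b h.
Proof.
by move=> ig ih; rewrite /seg -cIB//; apply: eq_cI => x; rewrite mulrBr.
Qed.

Lemma seg_cst a b (c : R[i]) : a <= b -> segint a b (fun=> c) /\ seg a b (fun=> c) = c * (b - a)%:C.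
Proof.
move=> ab; have [i1 I1] := rint_indic ab.
have c1 : cint leb (cind a b).
  split; first exact: cmeas_cind.
  by under eq_fun do rewrite normc_cind.
split; rewrite /segint /seg.
  by under eq_fun do rewrite mulrC; exact: cintMl.
by rewrite -I1 -cI_real -cIMl//; apply: eq_cI => x; rewrite mulrC.
Qed.

Lemma cind_split a m b x : a <= m <= b -> cind a b x = cind a m x + cind m b x.
Proof.
move=> /andP[am mb]; rewrite /cind -rmorphD; congr (_%:C); rewrite !indicE.
have E (u v : R) : (x \in `]u, v]%classic) = (u < x <= v).
  by apply/idP/idP; rewrite inE /= in_itv.
rewrite !E; have [xm|xm] := leP x m.
  by rewrite (le_trans xm mb) addr0.
by rewrite (le_lt_trans am xm) andbF add0r.
Qed.

Lemma seg_split a m b g : a <= m <= b -> segint a m g -> segint m b g ->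
  seg a b g = seg a m g + seg m b g.
Proof.
move=> amb i1 i2; rewrite /seg -cID//; apply: eq_cI => x.
by rewrite (cind_split x amb) mulrDl.
Qed.

Definition ccont g := continuous (fun x => complex.Re (g x)) /\ continuous (fun x => complex.Im (g x)).

Lemma ccont_cmeas g : ccont g -> cmeasR g.
Proof. by move=> [c1 c2]; split; exact: continuous_measurable_fun. Qed.

Lemma ccont_segint a b g : a <= b -> ccont g -> segint a b g.
Proof.
move=> ab cg; have [c1 c2] := cg.
have B (h : R -> R) : continuous h -> exists M, forall x, a <= x <= b -> `|h x| <= M.
  move=> ch.
  have cn : {within `[a, b], continuous (fun x => `|h x|)}.
    by apply: continuous_subspaceT => x; apply: cvg_norm; exact: ch.
  have [c _ H] := EVT_max ab cn.
  by exists `|h c| => x xab; apply: H; rewrite in_itv.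
have [M HM] := B _ c1; have [N HN] := B _ c2.
apply: (proj1 (seg_le (M := M + N) ab (ccont_cmeas cg) _)) => x /andP[/ltW ax xb].
by apply: le_trans (normc_le _) _; rewrite lerD ?HM ?HN ?ax.
Qed.

End seg.

Section goursat.
Variable R : realType.
Local Notation cmeasR := (@cmeas _ (measurableTypeR R) R).
Variable G : R[i] -> R[i].
Hypothesis holG : forall w, hol_at G w.

Lemma hol_normc_cvg w (e : R) : 0 < e ->
  exists2 r : R, 0 < r & forall h, normc h < r -> normc (G (w + h) - G w) < e.
Proof.
move=> e0; have [K K0 [r r0 H]] := hol_at_lip (holG w).
exists (Num.min r (e / K)); first by rewrite lt_min r0 divr_gt0.
move=> h; rewrite lt_min => /andP[h1 h2]; apply: le_lt_trans (H _ h1) _.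
by rewrite mulrC -ltr_pdivlMr.
Qed.

Lemma hol_ccont (p : R -> R[i]) : (forall x y, normc (p x - p y) <= `|x - y|) ->
  ccont (fun x => G (p x)).
Proof.
move=> pl.
have H x (e : R) : 0 < e -> \forall y \near x, normc (G (p x) - G (p y)) < e.
  move=> e0; have [r r0 Hr] := hol_normc_cvg (p x) e0.
  near=> y; rewrite normcB; have := Hr (p y - p x); rewrite (addrC (p x)) subrK; apply.
  apply: le_lt_trans (pl y x) _; rewrite distrC.
  by near: y; exists r => //= z; rewrite /ball/=.
split=> x; apply/cvgrPdist_lt => e e0; apply: filterS (H x e e0) => y; apply: le_lt_trans.
  by rewrite -Re_opp -Re_add; exact: normc_Re.
by rewrite -Im_opp -Im_add; exact: normc_Im.
Unshelve. all: by end_near. Qed.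

Let hor (c x : R) : R[i] := x +i* c.
Let ver (a t : R) : R[i] := a +i* t.

Let ccont_hor c : ccont (fun x => G (hor c x)).
Proof.
apply: hol_ccont => x y; rewrite (_ : _ - _ = (x - y)%:C) ?normc_real//.
by apply: complexP; rewrite !ReImE //= subrr.
Qed.

Let ccont_ver a : ccont (fun t => G (ver a t)).
Proof.
apply: hol_ccont => x y; rewrite (_ : _ - _ = 'i * (x - y)%:C); last first.
  by apply: complexP; rewrite !ReImE //=; ring.
by rewrite normcM normc_real /= expr0n expr1n add0r sqrtr1 mul1r.
Qed.

(** The counterclockwise integral of [G] along the boundary of [a, b] x [c, d], with opposite sides
    combined into one integral. *)
Definition rect_int (a b c d : R) : R[i] :=
  seg a b (fun x => G (x +i* c) - G (x +i* d)) +
  'i * seg c d (fun t => G (b +i* t) - G (a +i* t)).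

Let seg_hor a b c d : a <= b -> segint a b (fun x => G (x +i* c)) /\
  seg a b (fun x => G (x +i* c) - G (x +i* d)) =
  seg a b (fun x => G (x +i* c)) - seg a b (fun x => G (x +i* d)).
Proof.
move=> ab; split; first exact: (ccont_segint ab (ccont_hor c)).
by apply: segB; [exact: (ccont_segint ab (ccont_hor c))|exact: (ccont_segint ab (ccont_hor d))].
Qed.

Let seg_ver a b c d : c <= d -> segint c d (fun t => G (b +i* t)) /\
  seg c d (fun t => G (b +i* t) - G (a +i* t)) =
  seg c d (fun t => G (b +i* t)) - seg c d (fun t => G (a +i* t)).
Proof.
move=> cd; split; first exact: (ccont_segint cd (ccont_ver b)).
by apply: segB; [exact: (ccont_segint cd (ccont_ver b))|exact: (ccont_segint cd (ccont_ver a))].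
Qed.

(** The integrals along the interior sides cancel in pairs. *)
Lemma rect_int_split a m b c k d : a <= m <= b -> c <= k <= d ->
  rect_int a b c d = rect_int a m c k + rect_int m b c k + rect_int a m k d + rect_int m b k d.
Proof.
move=> /[dup] amb /andP[am mb] /[dup] ckd /andP[ck kd].
have ab := le_trans am mb; have cd := le_trans ck kd.
rewrite /rect_int !(seg_hor _ _ ab).2 !(seg_hor _ _ am).2 !(seg_hor _ _ mb).2.
rewrite !(seg_ver _ _ cd).2 !(seg_ver _ _ ck).2 !(seg_ver _ _ kd).2.
have S1 e := seg_split amb (seg_hor e e am).1 (seg_hor e e mb).1.
have S2 e := seg_split ckd (seg_ver e e ck).1 (seg_ver e e kd).1.
rewrite !S1 !S2.
have E (h1c h2c h1k h2k h1d h2d v1a v2a v1m v2m v1b v2b i : R[i]) :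
  h1c + h2c - (h1d + h2d) + i * (v1b + v2b - (v1a + v2a)) =
  h1c - h1k + i * (v1m - v1a) + (h2c - h2k + i * (v1b - v1m)) +
  (h1k - h1d + i * (v2m - v2a)) + (h2k - h2d + i * (v2b - v2m)) by ring.
exact: E.
Qed.

(** The affine function G(p) + D (z - p) has boundary integral 0, since its differences across the
    rectangle are constant and the two pairs of sides cancel. Hence [G] may be replaced by the
    remainder [r]. *)
Lemma rect_int_small p (D : R[i]) (e l a b c d : R) : a <= b -> c <= d ->
  (forall z, a <= complex.Re z <= b -> c <= complex.Im z <= d ->
     normc (G z - G p - D * (z - p)) <= e * l) ->
  normc (rect_int a b c d) <= 2 * (e * l) * ((b - a) + (d - c)).
Proof.
move=> ab cd H.
pose r z := G z - G p - D * (z - p).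
have GE z : G z = r z + (G p + D * (z - p)) by rewrite /r; ring.
have H1 x : a < x <= b -> normc (r (x +i* c) - r (x +i* d)) <= 2 * (e * l).
  move=> /andP[/ltW ax xb]; apply: le_trans (le_normcD _ _) _; rewrite normcN.
  have h1 : normc (r (x +i* c)) <= e * l by apply: H; rewrite /= ?ax ?lexx.
  have h2 : normc (r (x +i* d)) <= e * l by apply: H; rewrite /= ?ax ?lexx ?cd.
  lra.
have H2 t : c < t <= d -> normc (r (b +i* t) - r (a +i* t)) <= 2 * (e * l).
  move=> /andP[/ltW ax xb]; apply: le_trans (le_normcD _ _) _; rewrite normcN.
  have h1 : normc (r (b +i* t)) <= e * l by apply: H; rewrite /= ?ax ?lexx ?ab.
  have h2 : normc (r (a +i* t)) <= e * l by apply: H; rewrite /= ?ax ?lexx ?ab.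
  lra.
have E1 x : r (x +i* c) - r (x +i* d) = (G (x +i* c) - G (x +i* d)) - D * ('i * (c - d)%:C).
  rewrite /r (_ : 'i * (c - d)%:C = (x +i* c) - (x +i* d)); first by ring.
  by apply: complexP; rewrite !ReImE //=; ring.
have E2 t : r (b +i* t) - r (a +i* t) = (G (b +i* t) - G (a +i* t)) - D * (b - a)%:C.
  rewrite /r (_ : (b - a)%:C = (b +i* t) - (a +i* t)); first by ring.
  by apply: complexP; rewrite !ReImE //=; ring.
have ig1 : segint a b (fun x => G (x +i* c) - G (x +i* d)).
  have := cintB (ccont_segint ab (ccont_hor c)) (ccont_segint ab (ccont_hor d)).
  by rewrite /segint; congr (cint _ _); apply/funext => x; rewrite mulrBr.
have ig2 : segint c d (fun t => G (b +i* t) - G (a +i* t)).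
  have := cintB (ccont_segint cd (ccont_ver b)) (ccont_segint cd (ccont_ver a)).
  by rewrite /segint; congr (cint _ _); apply/funext => x; rewrite mulrBr.
have [k1 K1] := seg_cst (D * ('i * (c - d)%:C)) ab.
have [k2 K2] := seg_cst (D * (b - a)%:C) cd.
have F1 : seg a b (fun x => r (x +i* c) - r (x +i* d)) =
   seg a b (fun x => G (x +i* c) - G (x +i* d)) - D * ('i * (c - d)%:C) * (b - a)%:C.
  by rewrite -K1 -segB//; apply: eq_cI => x; rewrite E1.
have F2 : seg c d (fun t => r (b +i* t) - r (a +i* t)) =
   seg c d (fun t => G (b +i* t) - G (a +i* t)) - D * (b - a)%:C * (d - c)%:C.
  by rewrite -K2 -segB//; apply: eq_cI => x; rewrite E2.
have -> : rect_int a b c d = seg a b (fun x => r (x +i* c) - r (x +i* d)) +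
    'i * seg c d (fun t => r (b +i* t) - r (a +i* t)).
  rewrite F1 F2 /rect_int (_ : (c - d)%:C = - (d - c)%:C); first by ring.
  by rewrite -opprB rmorphN.
have m1 : cmeasR (fun x => r (x +i* c) - r (x +i* d)).
  under eq_fun do rewrite E1.
  apply: cmeasB; last exact: cmeas_cst.
  by apply: cmeasB; apply: ccont_cmeas; exact: ccont_hor.
have m2 : cmeasR (fun t => r (b +i* t) - r (a +i* t)).
  under eq_fun do rewrite E2.
  apply: cmeasB; last exact: cmeas_cst.
  by apply: cmeasB; apply: ccont_cmeas; exact: ccont_ver.
apply: le_trans (le_normcD _ _) _; rewrite normcM mulrDr.
rewrite lerD//; first exact: (seg_le ab m1 H1).2.
rewrite (_ : normc 'i = 1) ?mul1r; first exact: (seg_le cd m2 H2).2.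
by rewrite /= expr0n expr1n add0r sqrtr1.
Qed.

Lemma normc4_le (A B C E : R[i]) : let N := normc (A + B + C + E) in
  [\/ N <= 4 * normc A, N <= 4 * normc B, N <= 4 * normc C | N <= 4 * normc E].
Proof.
move=> N; have T : N <= normc A + normc B + normc C + normc E.
  apply: le_trans (le_normcD _ _) _; rewrite lerD2r.
  apply: le_trans (le_normcD _ _) _; rewrite lerD2r; exact: le_normcD.
move: N (normc A) (normc B) (normc C) (normc E) T => N x y z t T.
have [?|?] := leP N (4 * x); first by apply: Or41.
have [?|?] := leP N (4 * y); first by apply: Or42.
have [?|?] := leP N (4 * z); first by apply: Or43.
by apply: Or44; lra.
Qed.

Section bisect.
Variables (w h : R) (a0 c0 : R).
Hypotheses (w0 : 0 <= w) (h0 : 0 <= h).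

Let cell n (p : R * R) :=
  rect_int p.1 (p.1 + w / 2 ^+ n) p.2 (p.2 + h / 2 ^+ n).

(** The candidates are the four quarters of the cell. By [normc4_le] one of them carries at least a
    quarter of the modulus. *)
Let cell_child n p : exists q : R * R,
  [/\ p.1 <= q.1, q.1 + w / 2 ^+ n.+1 <= p.1 + w / 2 ^+ n,
      p.2 <= q.2, q.2 + h / 2 ^+ n.+1 <= p.2 + h / 2 ^+ n &
      normc (cell n p) <= 4 * normc (cell n.+1 q)].
Proof.
case: p => a c.
have n0 : 0 < 2 ^+ n :> R by rewrite exprn_gt0.
set w' := w / 2 ^+ n.+1; set h' := h / 2 ^+ n.+1.
have wE : w / 2 ^+ n = w' + w' by rewrite /w' exprS; field; rewrite gt_eqF.
have hE : h / 2 ^+ n = h' + h' by rewrite /h' exprS; field; rewrite gt_eqF.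
have w'0 : 0 <= w' by rewrite divr_ge0// exprn_ge0.
have h'0 : 0 <= h' by rewrite divr_ge0// exprn_ge0.
rewrite /cell -/w' -/h'; cbn [fst snd]; rewrite wE hE.
have S := @rect_int_split a (a + w') (a + (w' + w')) c (c + h') (c + (h' + h')).
have e1 : a <= a + w' by lra.
have e2 : a + w' <= a + (w' + w') by lra.
have e3 : a + w' + w' <= a + (w' + w') by lra.
have e4 : c <= c + h' by lra.
have e5 : c + h' <= c + (h' + h') by lra.
have e6 : c + h' + h' <= c + (h' + h') by lra.
rewrite {}S ?e1 ?e2 ?e4 ?e5//; clear - e1 e2 e3 e4 e5 e6.
rewrite !(addrA a) !(addrA c) in e2 e3 e5 e6 *.
have [H|H|H|H] := normc4_le (rect_int a (a + w') c (c + h')) (rect_int (a + w') (a + w' + w') c (c + h'))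
  (rect_int a (a + w') (c + h') (c + h' + h')) (rect_int (a + w') (a + w' + w') (c + h') (c + h' + h')).
- by exists (a, c); split.
- by exists (a + w', c); split.
- by exists (a, c + h'); split.
- by exists (a + w', c + h'); split.
Qed.

Let next n p := projT1 (cid (cell_child n p)).

Let Fixpoint cells n : R * R := if n is m.+1 then next m (cells m) else (a0, c0).

Let cellsP n : [/\ (cells n).1 <= (cells n.+1).1,
   (cells n.+1).1 + w / 2 ^+ n.+1 <= (cells n).1 + w / 2 ^+ n,
   (cells n).2 <= (cells n.+1).2,
   (cells n.+1).2 + h / 2 ^+ n.+1 <= (cells n).2 + h / 2 ^+ n &
   normc (cell n (cells n)) <= 4 * normc (cell n.+1 (cells n.+1))].
Proof. exact: (projT2 (cid (cell_child n (cells n)))). Qed.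

Let nested (x : nat -> R) (l : R) : 0 <= l -> (forall n, x n <= x n.+1) ->
  (forall n, x n.+1 + l / 2 ^+ n.+1 <= x n + l / 2 ^+ n) ->
  exists p, forall n, x n <= p <= x n + l / 2 ^+ n.
Proof.
move=> l0 x1 x2.
have up n k : x n <= x (n + k)%N.
  by elim: k => [|k ih]; rewrite ?addn0// addnS (le_trans ih).
have dn n k : x (n + k)%N + l / 2 ^+ (n + k) <= x n + l / 2 ^+ n.
  by elim: k => [|k ih]; rewrite ?addn0// addnS (le_trans _ ih).
have ln n : 0 <= l / 2 ^+ n by rewrite divr_ge0// exprn_ge0.
have ub n : ubound (range x) (x n + l / 2 ^+ n).
  move=> _ [k _ <-]; have [nk|kn] := leqP n k.
    by have := dn n (k - n)%N; rewrite subnKC//; have := ln k; lra.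
  by have := up k (n - k)%N; rewrite (subnKC (ltnW kn)); have := ln n; lra.
have hs : has_sup (range x) by split; [exists (x 0%N); exists 0%N|exists (x 0%N + l / 2 ^+ 0)].
exists (sup (range x)) => n; apply/andP; split.
  by apply: ub_le_sup; [exact: hs.2|exists n].
by apply: ge_sup; [exact: hs.1|exact: ub].
Qed.

(** At the common point p of the nested cells, differentiability bounds the integral over the n-th
    cell by a small multiple of 4^-n, while bisection loses only a factor 4^n. *)
Lemma rect_int0_bisect : rect_int a0 (a0 + w) c0 (c0 + h) = 0.
Proof.
have [p1 P1] : exists p, forall n, (cells n).1 <= p <= (cells n).1 + w / 2 ^+ n.
  by apply: (@nested (fun n => (cells n).1)) => // n; have [] := cellsP n.
have [p2 P2] : exists p, forall n, (cells n).2 <= p <= (cells n).2 + h / 2 ^+ n.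
  by apply: (@nested (fun n => (cells n).2)) => // n; have [] := cellsP n.
pose p := p1 +i* p2; have [D HD] := holG p.
have big n : normc (rect_int a0 (a0 + w) c0 (c0 + h)) <= 4 ^+ n * normc (cell n (cells n)).
  elim: n => [|n ih]; first by rewrite expr0 mul1r /cell !expr0 !divr1.
  apply: le_trans ih _; have [_ _ _ _ H] := cellsP n.
  by rewrite exprSr -mulrA ler_pM2l// exprn_gt0.
apply/eq0_normc/eqP; rewrite eq_le normc_ge0 andbT.
apply/ler_addgt0Pr => e e0; rewrite add0r.
pose L := w + h; have L0 : 0 <= L by rewrite addr_ge0.
(* The tolerance is chosen so that the final bound is e (L / (L + 1))^2 <= e; the added 1 covers the
   degenerate case L = 0. *)
have e1 : 0 < e / (2 * (L + 1) ^+ 2) by rewrite divr_gt0// mulr_gt0// exprn_gt0// ltr_wpDl.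
have [r r0 Hr] := HD _ e1.
have [n Hn] : exists n : nat, L / 2 ^+ n < r.
  have /cvgr0Pnorm_lt/(_ _ r0)[N _ /(_ N (leqnn N))] : L * (2^-1) ^+ n @[n --> \oo] --> 0.
    rewrite -[X in _ --> X](mulr0 L); apply: cvgM; first exact: cvg_cst.
    by apply: cvg_expr; rewrite ger0_norm ?invr_ge0// invf_lt1// ltr1n.
  by rewrite exprVn => h1; exists N; exact: le_lt_trans (ler_norm _) h1.
have n0 : 0 < 2 ^+ n :> R by rewrite exprn_gt0.
apply: le_trans (big n) _.
have sm := @rect_int_small p D (e / (2 * (L + 1) ^+ 2)) (L / 2 ^+ n)
  (cells n).1 ((cells n).1 + w / 2 ^+ n) (cells n).2 ((cells n).2 + h / 2 ^+ n).
have w1 : 0 <= w / 2 ^+ n by rewrite divr_ge0// ltW.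
have h1 : 0 <= h / 2 ^+ n by rewrite divr_ge0// ltW.
have {sm} : normc (cell n (cells n)) <= 2 * (e / (2 * (L + 1) ^+ 2) * (L / 2 ^+ n)) * (w / 2 ^+ n + h / 2 ^+ n).
  have -> : w / 2 ^+ n + h / 2 ^+ n = ((cells n).1 + w / 2 ^+ n - (cells n).1) + ((cells n).2 + h / 2 ^+ n - (cells n).2) by ring.
  apply: sm; [lra|lra|] => z z1 z2.
  have zp : normc (z - p) <= L / 2 ^+ n.
    apply: le_trans (normc_le _) _; rewrite !ReImE /= /L mulrDl.
    have q1 := P1 n; have q2 := P2 n.
    move: z1 z2 q1 q2 => /andP[? ?] /andP[? ?] /andP[? ?] /andP[? ?].
    by apply: lerD; rewrite ler_norml; apply/andP; split; lra.
  have := Hr _ (le_lt_trans zp Hn); rewrite (addrC p) subrK => H.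
  by apply: le_trans H _; rewrite ler_wpM2l// ltW.
move=> H; apply: le_trans (ler_wpM2l _ H) _; first by rewrite exprn_ge0.
have -> : 4 ^+ n * (2 * (e / (2 * (L + 1) ^+ 2) * (L / 2 ^+ n)) * (w / 2 ^+ n + h / 2 ^+ n)) =
   e * (L / (L + 1)) ^+ 2.
  rewrite (_ : 4 ^+ n = 2 ^+ n * 2 ^+ n :> R); last by rewrite -exprMn -natrM.
  have L1 : L + 1 != 0 by rewrite gt_eqF// ltr_wpDl.
  rewrite -mulrDl -/L; move: (2 ^+ n) (gt_eqF n0) => P /negbT P0.
  by field; rewrite L1 P0.
rewrite ger_pMr// exprn_ile1 ?divr_ge0 ?addr_ge0//.
by rewrite ler_pdivrMr ?mul1r; rewrite -/L; lra.
Qed.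

End bisect.

Lemma goursat a b c d : a <= b -> c <= d -> rect_int a b c d = 0.
Proof.
move=> ab cd; have := @rect_int0_bisect (b - a) (d - c) a c.
by rewrite !subr_ge0 !(addrC _ (_ - _)) !subrK; apply.
Qed.

End goursat.

(** * Entire functions along complex lines *)

Section entire_lines.
Variables (R : realType) (d : nat).
Local Notation Rd := 'rV[R]_d.
Local Notation Cd := 'rV[R[i]]_d.
Implicit Types (F : Cd -> R[i]) (x u xi eta : Rd).

Definition zc xi eta : Cd := \row_j (xi ord0 j +i* eta ord0 j).

Lemma zc_real xi : zc xi 0 = map_mx (real_complex R) xi.
Proof. by apply/rowP => j; rewrite !mxE. Qed.

Lemma zc_Im xi eta : map_mx (@complex.Im R) (zc xi eta) = eta.
Proof. by apply/rowP => j; rewrite !mxE. Qed.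

Lemma zc_line xi u (s t : R) : zc xi 0 + (s +i* t) *: zc u 0 = zc (xi + s *: u) (t *: u).
Proof.
apply/rowP => j; rewrite !mxE; apply: complexP; rewrite !ReImE /=; ring.
Qed.

Lemma normc_lt_norm (z : R[i]) (e : R) : (`|z| < e%:C) = (normc z < e).
Proof. by rewrite normc_normE ltcR. Qed.

Lemma gt0_complex (e : R[i]) : 0 < e -> exists2 r : R, 0 < r & e = r%:C.
Proof.
case: e => a b; rewrite ltcE /= => /andP[/eqP b0 a0]; exists a => //.
by rewrite b0.
Qed.

Lemma hol_at_line F (a v : Cd) w : differentiable F (a + w *: v) ->
  hol_at (fun w => F (a + w *: v)) w.
Proof.
move=> dF; exists ('D_v F (a + w *: v)) => e e0.
have /cvg_ex[l Hl] := @diff_derivable _ _ _ F (a + w *: v) v dF.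
have lE : 'D_v F (a + w *: v) = l by apply/cvg_lim.
have eC : 0 < e%:C by rewrite ltcR.
move/cvgrPdist_lt : Hl => /(_ _ eC) [r' /= r'0 Hr].
have [r r0 rE] := gt0_complex r'0; exists r => // h hr.
have [->|h0] := eqVneq h 0.
  by rewrite addr0 mulr0 subr0 subrr normc0 mulr0.
have := Hr h; rewrite /ball_/= sub0r normrN rE normc_lt_norm => /(_ hr h0).
rewrite normc_lt_norm => H.
have E : a + (w + h) *: v = h *: v + (a + w *: v) by rewrite scalerDl addrA addrC.
rewrite lE E; move: H; rewrite [_ *: (_ - _)](_ : _ = h^-1 * (F (h *: v + (a + w *: v)) - F (a + w *: v)))//.
set G := F _ - F _ => H.
rewrite (_ : G - l * h = - h * (l - h^-1 * G)); last by field.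
by rewrite normcM normcN mulrC ler_wpM2r ?normc_ge0// ltW.
Qed.

Lemma entire_normc_cvg F (z : Cd) (e : R) : entire F -> 0 < e ->
  exists2 r : R, 0 < r & forall z' : Cd, (forall j, normc (z ord0 j - z' ord0 j) < r) ->
    normc (F z - F z') < e.
Proof.
move=> eF e0; have := differentiable_continuous (eF z).
have eC : 0 < e%:C by rewrite ltcR.
move=> /cvgrPdist_lt/(_ _ eC) /nbhs_ballP[r' /= r'0 H].
have [r r0 rE] := gt0_complex r'0; exists r => // z' zz'.
rewrite -normc_lt_norm; apply: H; split => // i j; rewrite (ord1 i) /ball/= rE normc_lt_norm.
exact: zz'.
Qed.

Lemma entire_zc_cvg F xi eta (e : R) : entire F -> 0 < e ->
  \forall xi' \near xi, normc (F (zc xi eta) - F (zc xi' eta)) < e.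
Proof.
move=> eF e0; have [r r0 H] := entire_normc_cvg (zc xi eta) eF e0.
apply/nbhs_ballP; exists r => //= xi' [_ xx']; apply: H => j; rewrite !mxE.
rewrite (_ : _ - _ = (xi ord0 j - xi' ord0 j)%:C) ?normc_real; first exact: (xx' ord0 j).
by apply: complexP; rewrite !ReImE //= subrr.
Qed.

Lemma cmeas_entire F eta : entire F -> cmeas (fun xi => F (zc xi eta)).
Proof.
move=> eF.
have cRe : continuous (fun xi : Rd => complex.Re (F (zc xi eta))).
  move=> x; apply/(@cvgrPdist_lt _ _ _ (nbhs x) (nbhs_filter x)) => e e0.
  near=> y; have K : normc (F (zc x eta) - F (zc y eta)) < e by near: y; exact: entire_zc_cvg.
  by apply: le_lt_trans K; rewrite /= -Re_opp -Re_add; exact: normc_Re.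
have cIm : continuous (fun xi : Rd => complex.Im (F (zc xi eta))).
  move=> x; apply/(@cvgrPdist_lt _ _ _ (nbhs x) (nbhs_filter x)) => e e0.
  near=> y; have K : normc (F (zc x eta) - F (zc y eta)) < e by near: y; exact: entire_zc_cvg.
  by apply: le_lt_trans K; rewrite /= -Im_opp -Im_add; exact: normc_Im.
by split; exact: rV_continuous_measurable.
Unshelve. all: by end_near. Qed.

End entire_lines.

Section shift.
Variables (R : realType) (d : nat).
Local Notation Rd := 'rV[R]_d.
Local Notation mu := (lebesgue_rV R d).
Local Notation leb := (@lebesgue_measure R).
Local Notation RR := (measurableTypeR R).

(* Peetre's inequality *)
Lemma weight_shift (xi u : Rd) (L s : R) : 0 <= s <= L ->
  weight (xi + s *: u) <= \prod_(i < d) (2 * (1 + (L * u ord0 i) ^+ 2)) * weight xi.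
Proof.
move=> /andP[s0 sL]; rewrite /weight -big_split; apply: ler_prod => i _ /=; rewrite !mxE.
set x := xi ord0 i; set v := u ord0 i.
have D1 : 0 < 1 + x ^+ 2 by rewrite ltr_wpDr ?sqr_ge0.
have D2 : 0 < 1 + (x + s * v) ^+ 2 by rewrite ltr_wpDr ?sqr_ge0.
rewrite invr_ge0 (ltW D2) /= ler_pdivlMr// mulrC ler_pdivrMr//.
have h1 : (s * v) ^+ 2 <= (L * v) ^+ 2.
  by rewrite !exprMn ler_wpM2r ?sqr_ge0// lerXn2r ?nnegrE// (le_trans s0).
have h2 := sqr_ge0 (x + s * v); have h3 := sqr_ge0 (L * v).
have h4 : x ^+ 2 <= 2 * (x + s * v) ^+ 2 + 2 * (s * v) ^+ 2.
  have -> : x = (x + s * v) - s * v by ring.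
  have := sqr_ge0 (x + s * v + s * v); move: (x + s * v) (s * v) => p q.
  by rewrite sqrrD sqrrB; lra.
move: h1 h2 h3 h4; move: ((L * v) ^+ 2) ((s * v) ^+ 2) ((x + s * v) ^+ 2) (x ^+ 2) => p q r y.
by move=> *; nra.
Qed.

Variables (Q : Rd -> Rd -> R[i]) (u : Rd) (t M : R).
Hypothesis t0 : 0 <= t.
Hypothesis holQ : forall xi w, hol_at (fun w => Q (xi + complex.Re w *: u) (complex.Im w *: u)) w.
Hypothesis mQ : forall eta, cmeas (fun xi => Q xi eta).
Hypothesis leQ : forall xi s, 0 <= s <= t -> normc (Q xi (s *: u)) <= M * weight xi.

Let J s := cI mu (fun xi => Q xi (s *: u)).

Let M0 : 0 <= M.
Proof.
have := leQ 0 (s := 0); rewrite lexx t0 => /(_ isT) H.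
by rewrite -(pmulr_lge0 _ (weight_gt0 (0 : Rd))); exact: le_trans (normc_ge0 _) H.
Qed.

Let cJ s : 0 <= s <= t -> cint mu (fun xi => Q xi (s *: u)).
Proof. by move=> st; apply: (cint_le (mQ _) (rintZ M (rint_weight R d))) => xi; exact: leQ. Qed.

Let mshift : measurable_fun setT (fun p : Rd * RR => p.1 + p.2 *: u).
Proof.
apply: measurable_fun_coordP => i; under eq_fun do rewrite !mxE.
apply: measurable_funD.
  exact: (measurableT_comp (@measurable_coord R d i) measurable_fst).
by apply: measurable_funM => //; exact: measurable_snd.
Qed.

(** Every translate by r u has the same integral [J s], so integrating over r in (0, L] and
    exchanging the integrals gives L times [J s]. Peetre's inequality supplies the majorant
    uniformly in r. *)
Let swap (L s : R) : 0 <= L -> 0 <= s <= t ->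
  [/\ cmeas (fun xi : Rd => seg 0 L (fun r => Q (xi + r *: u) (s *: u))),
      cI mu (fun xi : Rd => seg 0 L (fun r => Q (xi + r *: u) (s *: u))) = L%:C * J s,
      forall xi, segint 0 L (fun r => Q (xi + r *: u) (s *: u)) &
      cint mu (fun xi : Rd => seg 0 L (fun r => Q (xi + r *: u) (s *: u)))].
Proof.
move=> L0 st.
have [i1 I1] := rint_indic L0.
pose C := M * \prod_(i < d) (2 * (1 + (L * u ord0 i) ^+ 2)).
have C0 : 0 <= C.
  by rewrite mulr_ge0//; apply: prodr_ge0 => i _; rewrite mulr_ge0// addr_ge0// sqr_ge0.
have mf : cmeas (fun p : Rd * RR => cind 0 L p.2 * Q (p.1 + p.2 *: u) (s *: u)).
  apply: cmeasM; first exact: (cmeas_comp measurable_snd (cmeas_cind 0 L)).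
  exact: (cmeas_comp mshift (mQ _)).
have bf (xi : Rd) (r : RR) : normc (cind 0 L r * Q (xi + r *: u) (s *: u)) <=
    C * weight xi * \1_(`]0, L]%classic) r.
  rewrite normcM normc_cind indicE; case: (boolP (r \in _)) => [|_]; last by rewrite mul0r mulr0.
  rewrite inE/= in_itv/= => /andP[/ltW r0 rL]; rewrite mul1r mulr1.
  apply: le_trans (leQ _ st) _; rewrite /C -mulrA ler_wpM2l// weight_shift// r0.
  by [].
have w0 (xi : Rd) : 0 <= C * weight xi by rewrite mulr_ge0// ltW// weight_gt0.
have ind0 (r : RR) : 0 <= \1_(`]0, L]%classic) r :> R by rewrite indicE.
have [c c1 c2] := cint_dom_prod (m1 := mu) (m2 := leb) mf (rintZ C (rint_weight R d)) i1 w0 ind0 bf.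
have [m1 e1] := cI_fubini1 c c1.
have [m2 e2] := cI_fubini2 c c2.
split.
- exact: m1.
- rewrite /seg [LHS]e1 -e2.
  transitivity (cI leb (fun r => J s * cind 0 L r)).
    apply: eq_cI => r; transitivity (cI mu (fun x => cind 0 L r * Q (x + r *: u) (s *: u))); first by [].
    rewrite cIMl; last first.
      have [+ _] := cI_affine (r *: u) ltr01 (cJ st).
      by congr (cint _ _); apply/funext => x; rewrite scale1r addrC.
    rewrite mulrC; congr (_ * _); have [_ E] := cI_affine (r *: u) ltr01 (cJ st).
    rewrite /J E expr1n mul1r; apply: eq_cI => x; rewrite scale1r addrC//.
  rewrite cIMl; first by rewrite cI_real I1 subr0 mulrC.
  split; first exact: cmeas_cind.
  by under eq_fun do rewrite normc_cind.
- exact: c1.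
- apply: (cint_le m1 (rintZ (C * (L - 0)) (rint_weight R d))) => xi.
  have -> : C * (L - 0) * weight xi = \int[leb]_r (C * weight xi * \1_(`]0, L]%classic) r).
    by rewrite RintegralZl// I1; ring.
  by apply: normc_cI_le; [exact: (c1 xi).1|exact: rintZ|move=> r; exact: bf].
Qed.

(* Averaging J 0 - J t over the translations xi + r u, 0 < r <= L, turns it into
   rectangle integrals; by Goursat's theorem only two sides of length t
   survive, and their contribution stays bounded as L grows. *)
Lemma contour_shift : J 0 = J t.
Proof.
have W0 : 0 <= \int[mu]_x weight x by apply: Rintegral_ge0 => x _; rewrite ltW// weight_gt0.
have key L : 0 <= L -> normc (J 0 - J t) * L <= 2 * (M * t) * \int[mu]_x weight x.
  move=> L0.
  have z0 : (0 : R) <= 0 <= t by rewrite lexx t0.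
  have tt : 0 <= t <= t by rewrite lexx t0.
  have [m1 e1 i1 j1] := swap L0 z0; have [m2 e2 i2 j2] := swap L0 tt.
  have [k1 K1] := rint_affine (L *: u) ltr01 (rint_weight R d).
  have K1' : \int[mu]_x weight x = \int[mu]_x weight (x + L *: u).
    rewrite K1 expr1n mul1r; apply: eq_Rintegral => x _; by rewrite scale1r addrC.
  have k1' : rint mu (fun x => weight (x + L *: u)).
    by move: k1; congr (rint _ _); apply/funext => x; rewrite scale1r addrC.
  rewrite -[in normc _ * L](ger0_norm L0) -normc_real -normcM mulrC mulrBr -e1 -e2 -cIB//.
  have -> : 2 * (M * t) * \int[mu]_x weight x = \int[mu]_x (M * t * (weight (x + L *: u) + weight x)).
    rewrite RintegralZl ?RintegralD ?rintD// -?K1'; [ring|exact: rint_weight|exact: rintD k1' (rint_weight R d)].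
  apply: normc_cI_le.
  - exact: cmeasB.
  - by apply: rintZ; apply: rintD => //; exact: rint_weight.
  - move=> xi.
    have G0 := goursat (holQ xi) L0 t0.
    rewrite /rect_int in G0.
    have Ga : seg 0 L (fun r => Q (xi + r *: u) (0 *: u)) - seg 0 L (fun r => Q (xi + r *: u) (t *: u)) =
      - ('i * seg 0 t (fun s => Q (xi + L *: u) (s *: u) - Q (xi + 0 *: u) (s *: u))).
      apply/eqP; rewrite -segB// -addr_eq0; apply/eqP; exact: G0.
    rewrite Ga normcN normcM (_ : normc 'i = 1) ?mul1r; last by rewrite /= expr0n expr1n add0r sqrtr1.
    have bd s : 0 < s <= t -> normc (Q (xi + L *: u) (s *: u) - Q (xi + 0 *: u) (s *: u)) <=
        M * (weight (xi + L *: u) + weight xi).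
      move=> /andP[/ltW s0 st]; apply: le_trans (le_normcD _ _) _; rewrite normcN mulrDr.
      by rewrite lerD// ?scale0r ?addr0 leQ// s0.
    rewrite (_ : M * t * _ = M * (weight (xi + L *: u) + weight xi) * (t - 0)); last by ring.
    apply: (proj2 (seg_le t0 _ bd)).
    have cc (r : R) : cmeas (T := RR) (fun s => Q (xi + r *: u) (s *: u)).
      apply: ccont_cmeas; have := @hol_ccont _ _ (holQ xi) (fun s => r +i* s); apply.
      move=> x y; rewrite (_ : _ - _ = 'i * (x - y)%:C); last by apply: complexP; rewrite !ReImE //=; ring.
      by rewrite normcM normc_real /= expr0n expr1n add0r sqrtr1 mul1r.
    exact: cmeasB (cc L) (cc 0).
apply/eqP; rewrite -subr_eq0; apply/eqP/eq0_normc/eqP; rewrite eq_le normc_ge0 andbT.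
rewrite leNgt; apply/negP => n0.
set K := 2 * (M * t) * _ in key.
have K0 : 0 <= K by rewrite !mulr_ge0.
(* For this value of L the bound [key] would read K + 1 <= K. *)
have := key ((K + 1) / normc (J 0 - J t)) (divr_ge0 (addr_ge0 K0 ler01) (ltW n0)).
by rewrite mulrC divfK ?gt_eqF//; lra.
Qed.

End shift.

(** * The supporting function *)

Section supporting.
Variables (R : realType) (d : nat).
Local Notation Rd := 'rV[R]_d.
Implicit Types (A : set Rd) (a x u : Rd).

Lemma dotr_continuous x : continuous (fun a => dotr a x).
Proof.
rewrite /dotr; elim: (index_enum _) => [|i s ih] a.
  rewrite (_ : (fun _ => _) = cst 0); first exact: cst_continuous.
  by apply/funext => b; rewrite big_nil.
rewrite (_ : (fun _ => _) = (fun b : Rd => b ord0 i * x ord0 i + \sum_(j <- s) b ord0 j * x ord0 j)).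
  apply: (@cvgD _ _ _ (nbhs a) (nbhs_filter a)); last exact: ih.
  apply: (@cvgM _ _ (nbhs a) (nbhs_filter a)); first exact: coord_continuous.
  exact: (@cvg_cst _ _ _ (nbhs a) (nbhs_filter a)).
by apply/funext => b; rewrite big_cons.
Qed.

Lemma supporting_has_sup A x : A !=set0 -> compact A -> has_sup [set dotr a x | a in A].
Proof.
move=> [a Aa] cA; split; first by exists (dotr a x), a.
have : compact [set dotr a x | a in A].
  by apply: continuous_compact cA; apply: continuous_subspaceT; exact: dotr_continuous.
move/compact_bounded => [M [_ HM]]; exists (M + 1) => _ [b Ab <-].
have := HM (M + 1); rewrite ltrDl ltr01 => /(_ isT (dotr b x)) H.
by apply: le_trans (ler_norm _) _; apply: H; exists b.
Qed.

Lemma supporting_ub A a x : compact A -> A a -> dotr a x <= supporting_function A x.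
Proof.
move=> cA Aa; apply: ub_le_sup; last by exists a.
exact: (proj2 (supporting_has_sup x (ex_intro A a Aa) cA)).
Qed.

Lemma dotrZr a (t : R) x : dotr a (t *: x) = t * dotr a x.
Proof. by rewrite /dotr mulr_sumr; apply: eq_bigr => i _; rewrite mxE; ring. Qed.

Lemma supportingZ_le A x (t : R) : A !=set0 -> compact A -> 0 <= t ->
  supporting_function A (t *: x) <= t * supporting_function A x.
Proof.
move=> A0 cA t0; apply: ge_sup; first exact: (supporting_has_sup _ A0 cA).1.
move=> _ [a Aa <-]; rewrite dotrZr ler_wpM2l//; exact: supporting_ub.
Qed.

Lemma supporting0 A : A !=set0 -> compact A -> supporting_function A 0 <= 0.
Proof. by move=> A0 cA; have := supportingZ_le 0 A0 cA (lexx 0); rewrite scale0r mul0r. Qed.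

Lemma dotr_ge0 x : 0 <= dotr x x.
Proof. by apply: sumr_ge0 => i _; rewrite -expr2 sqr_ge0. Qed.

End supporting.

(** * Decay of the Gaussian-regularized transform *)

Section decay.
Variables (R : realType) (d : nat).
Local Notation Rd := 'rV[R]_d.
Local Notation Cd := 'rV[R[i]]_d.
Local Notation mu := (lebesgue_rV R d).

(** The entire extension - e z.z + i y.z of the exponent of the Gaussian times the character of the
    inverse transform. The products are bilinear, without conjugation. *)
Definition gz (e : R) (y : Rd) (z : Cd) : R[i] :=
  \sum_(j < d) (- e%:C * (z ord0 j * z ord0 j) + 'i * (y ord0 j)%:C * z ord0 j).

Lemma Re_sum (I : Type) (s : seq I) (f : I -> R[i]) :
  complex.Re (\sum_(i <- s) f i) = \sum_(i <- s) complex.Re (f i).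
Proof. by elim: s => [|i s ih]; rewrite ?big_nil// !big_cons Re_add ih. Qed.

Lemma Im_sum (I : Type) (s : seq I) (f : I -> R[i]) :
  complex.Im (\sum_(i <- s) f i) = \sum_(i <- s) complex.Im (f i).
Proof. by elim: s => [|i s ih]; rewrite ?big_nil// !big_cons Im_add ih. Qed.

Lemma Re_gz e y (xi eta : Rd) : complex.Re (gz e y (zc xi eta)) =
  - (e * dotr xi xi) + (e * dotr eta eta - dotr y eta).
Proof.
rewrite /gz Re_sum /dotr !mulr_sumr -sumrB -sumrN -big_split/=.
by apply: eq_bigr => j _; rewrite !mxE !ReImE /=; ring.
Qed.

Lemma Im_gz e y (xi : Rd) : complex.Im (gz e y (zc xi 0)) = dotr y xi.
Proof.
rewrite /gz Im_sum /dotr; apply: eq_bigr => j _; rewrite !mxE !ReImE /=; ring.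
Qed.

(** In each coordinate exp(e x^2) >= 1 + e x^2 >= e (1 + x^2), because e <= 1; this costs one factor
    1/e per coordinate. *)
Lemma gauss_le_weight (e : R) (xi : Rd) : 0 < e <= 1 -> expR (- (e * dotr xi xi)) <= (e^-1) ^+ d * weight xi.
Proof.
move=> /andP[e0 e1]; rewrite /dotr mulr_sumr -sumrN expR_sum (_ : e^-1 ^+ d = \prod_(j < d) e^-1); last by rewrite prodr_const card_ord.
rewrite /weight -big_split; apply: ler_prod => j _; rewrite expR_ge0 /=.
set x := xi ord0 j; rewrite -expr2 expRN -invfM lef_pV2 ?posrE ?expR_gt0//; last first.
  by rewrite mulr_gt0// ltr_wpDr ?sqr_ge0.
apply: le_trans (expR_ge1Dx _); have := sqr_ge0 x; nra.
Qed.

Variables (F : Cd -> R[i]) (A : set Rd) (C : R).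
Hypothesis A0 : A !=set0.
Hypothesis cA : compact A.
Hypothesis eF : entire F.
Hypothesis C0 : 0 < C.
Hypothesis FC : forall z : Cd,
  normc (F z) <= C * expR (supporting_function A (map_mx (@complex.Im R) z)).

Lemma hol_gz e y (a v : Cd) w : hol_at (fun w => gz e y (a + w *: v)) w.
Proof.
apply: hol_at_sum => j.
have hz : hol_at (fun w => (a + w *: v) ord0 j) w.
  rewrite (_ : (fun w => _) = (fun w => a ord0 j + w * v ord0 j)); last first.
    by apply/funext => z; rewrite !mxE.
  apply: hol_atD; first exact: hol_at_cst.
  by apply: hol_atM; [exact: hol_at_id|exact: hol_at_cst].
apply: hol_atD.
  by apply: hol_atM; [exact: hol_at_cst|exact: hol_atM].
by apply: hol_atM => //; exact: hol_at_cst.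
Qed.

Lemma cmeas_sum dT (T : measurableType dT) (I : Type) (s : seq I) (f : I -> T -> R[i]) :
  (forall i, cmeas (f i)) -> cmeas (fun x => \sum_(i <- s) f i x).
Proof.
move=> mf; elim: s => [|i s ih].
  by under eq_fun do rewrite big_nil; exact: cmeas_cst.
by under eq_fun do rewrite big_cons; exact: cmeasD.
Qed.

Lemma cmeas_cexp dT (T : measurableType dT) (f : T -> R[i]) : cmeas f -> cmeas (fun x => cexp (f x)).
Proof.
move=> [m1 m2]; apply: cmeasM; last exact: measurable_ce.
by apply: cmeas_real; apply: measurableT_comp m1; exact: measurable_expR.
Qed.

Lemma cmeas_gz e y (eta : Rd) : cmeas (fun xi : Rd => gz e y (zc xi eta)).
Proof.
apply: cmeas_sum => j.
have mz : cmeas (fun xi : Rd => zc xi eta ord0 j).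
  by under eq_fun do rewrite mxE; apply: cmeas_ReIm => //; exact: measurable_coord.
apply: cmeasD.
  by apply: cmeasM; [exact: cmeas_cst|exact: cmeasM].
by apply: cmeasM => //; exact: cmeas_cst.
Qed.

(** After the shift from xi to xi + i t u, the growth of F contributes exp(t H_A(u)), the character
    exp(- t y.u), and the Gaussian exp(e t^2 |u|^2). *)
Lemma gauss_shift (e : R) (y u : Rd) (t : R) : 0 < e <= 1 -> 0 <= t ->
  normc (cI mu (fun xi => F (zc xi 0) * cexp (gz e y (zc xi 0)))) <=
  C * expR (t * (supporting_function A u - dotr y u) + e * (t ^+ 2 * dotr u u)) *
    ((e^-1) ^+ d * \int[mu]_x weight x).
Proof.
move=> e01 t0; have /andP[e0 e1] := e01.
pose Q xi eta := F (zc xi eta) * cexp (gz e y (zc xi eta)).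
have QE xi (u' : Rd) w : Q (xi + complex.Re w *: u') (complex.Im w *: u') =
    F (zc xi 0 + w *: zc u' 0) * cexp (gz e y (zc xi 0 + w *: zc u' 0)).
  by case: w => a b; rewrite zc_line.
have holQ xi w : hol_at (fun w => Q (xi + complex.Re w *: u) (complex.Im w *: u)) w.
  under eq_fun do rewrite QE.
  apply: hol_atM; first by apply: hol_at_line; exact: eF.
  apply: (@hol_at_comp _ (@cexp R) (fun w => gz e y (zc xi 0 + w *: zc u 0))); first exact: hol_gz.
  exact: hol_at_cexp.
have mQ eta : cmeas (fun xi => Q xi eta).
  by apply: cmeasM; [exact: cmeas_entire|apply: cmeas_cexp; exact: cmeas_gz].
have bQ xi s : 0 <= s -> normc (Q xi (s *: u)) <=
    C * expR (s * (supporting_function A u - dotr y u) + e * (s ^+ 2 * dotr u u)) *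
      ((e^-1) ^+ d * weight xi).
  move=> s0; rewrite normcM normc_cexp Re_gz expRD.
  have h1 := gauss_le_weight xi e01.
  have h2 := FC (zc xi (s *: u)); rewrite zc_Im in h2.
  have h3 : expR (supporting_function A (s *: u)) <= expR (s * supporting_function A u).
    by rewrite ler_expR; exact: supportingZ_le.
  have h4 : normc (F (zc xi (s *: u))) <= C * expR (s * supporting_function A u).
    by apply: le_trans h2 _; rewrite ler_pM2l.
  rewrite (_ : s * (supporting_function A u - dotr y u) + e * (s ^+ 2 * dotr u u) =
    s * supporting_function A u + (e * dotr (s *: u) (s *: u) - dotr y (s *: u))); last first.
    by rewrite !dotrZr (dotrC (s *: u) u) dotrZr; ring.
  rewrite [expR (s * _ + _)]expRD.
  rewrite (_ : normc _ * (_ * _) = normc (F (zc xi (s *: u))) *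
    expR (e * dotr (s *: u) (s *: u) - dotr y (s *: u)) * expR (- (e * dotr xi xi))); last by ring.
  apply: ler_pM => //; first by rewrite mulr_ge0 ?normc_ge0 ?expR_ge0.
  by rewrite mulrA ler_wpM2r ?expR_ge0.
(* [contour_shift] wants one constant for all intermediate s in [0, t], hence the absolute value.
   The sharp bound [bQ] is used only at the endpoint s = t. *)
pose M := C * expR (t * `|supporting_function A u - dotr y u| + e * (t ^+ 2 * dotr u u)) * (e^-1) ^+ d.
have ei : 0 <= (e^-1) ^+ d by rewrite exprn_ge0// invr_ge0 ltW.
have leQ xi s : 0 <= s <= t -> normc (Q xi (s *: u)) <= M * weight xi.
  move=> /andP[s0 st]; apply: le_trans (bQ xi s s0) _; rewrite /M -[leRHS]mulrA.
  apply: ler_pM; [by rewrite mulr_ge0 ?expR_ge0 ?(ltW C0)|by rewrite mulr_ge0// ltW// weight_gt0| |by []].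
  rewrite ler_pM2l// ler_expR lerD//.
    by apply: le_trans (ler_wpM2l s0 (ler_norm _)) _; rewrite ler_wpM2r.
  by rewrite ler_pM2l// ler_wpM2r ?dotr_ge0// lerXn2r ?nnegrE.
have S := contour_shift t0 holQ mQ leQ.
have S0 : cI mu (fun xi => F (zc xi 0) * cexp (gz e y (zc xi 0))) = cI mu (fun xi => Q xi (0 *: u)).
  by rewrite scale0r.
set K := C * expR _.
have I1 := rintZ ((e^-1) ^+ d) (rint_weight R d); have I2 := rintZ K I1.
have B := normc_cI_le (mQ (t *: u)) I2 (fun xi => bQ xi t t0).
have E : \int[mu]_x (K * ((e^-1) ^+ d * weight x)) = K * ((e^-1) ^+ d * \int[mu]_x weight x).
  by rewrite (RintegralZl _ measurableT I1) (RintegralZl _ measurableT (rint_weight R d)).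
by rewrite S0 S -E; exact: B.
Qed.

Lemma gauss_decay (e del : R) (y u : Rd) : 0 < e <= 1 -> 0 < del ->
  supporting_function A u + del <= dotr y u ->
  normc (cI mu (fun xi => F (zc xi 0) * cexp (gz e y (zc xi 0)))) <=
  C * \int[mu]_x weight x * ((e^-1) ^+ d * expR (- (del ^+ 2 / (4 * (dotr u u + 1)) / e))).
Proof.
move=> e01 del0 H; have /andP[e0 e1] := e01.
(* The added 1 makes [N] positive whatever u is, so that it may be divided by. *)
pose N := dotr u u + 1; have N0 : 0 < N by rewrite ltr_wpDl// dotr_ge0.
(* the minimizer of [- t * del + e * t ^+ 2 * N] *)
pose t := del / (2 * N) / e.
have t0 : 0 <= t by rewrite !divr_ge0 ?mulr_ge0 ?ltW.
apply: le_trans (gauss_shift y u e01 t0) _.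
have W0 : 0 <= \int[mu]_x weight x by apply: Rintegral_ge0 => x _; rewrite ltW// weight_gt0.
have ei : 0 <= (e^-1) ^+ d by rewrite exprn_ge0// invr_ge0 ltW.
rewrite (_ : C * _ * (_ * _) = C * (\int[mu]_x weight x) * ((e^-1) ^+ d *
  expR (t * (supporting_function A u - dotr y u) + e * (t ^+ 2 * dotr u u)))); last by ring.
rewrite ler_wpM2l ?mulr_ge0 ?(ltW C0)// ler_wpM2l// ler_expR -/N.
have h1 : t * (supporting_function A u - dotr y u) <= t * (- del) by rewrite ler_wpM2l//; lra.
have h2 : e * (t ^+ 2 * dotr u u) <= e * (t ^+ 2 * N).
  by rewrite ler_pM2l// ler_wpM2l ?sqr_ge0// /N; lra.
apply: le_trans (lerD h1 h2) _.
rewrite le_eqVlt; apply/orP; left; apply/eqP; rewrite /t; field.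
by rewrite !gt_eqF.
Qed.

End decay.

(** * L^2 convergence and Schwartz functions *)

Section riesz_fischer.
Context d (T : measurableType d) (R : realType).
Variable mu : {measure set T -> \bar R}.

Lemma sum_halves n : \sum_(0 <= k < n) (2^-1 : R) ^+ k = 2 - 2 * 2^-1 ^+ n.
Proof.
elim: n => [|n ih]; first by rewrite big_nil expr0; ring.
by rewrite big_nat_recr//= ih exprS; field.
Qed.

Lemma cvg_of_summable (u : R^nat) (B : R) : (forall n, \sum_(0 <= k < n) `|u k.+1 - u k| <= B) -> cvgn u.
Proof.
move=> H; have c1 : cvgn (series (fun k => `|u k.+1 - u k|)).
  apply: nondecreasing_is_cvgn.
    by apply/nondecreasing_seqP => n; rewrite /series [leRHS]big_nat_recr//= lerDl.
  by exists B => _ [n _ <-]; rewrite /series/=; exact: H.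
have /cvg_ex[l Hl] := @normed_cvg R R^o (fun k => u k.+1 - u k) c1.
have E n : u n = u 0%N + series (fun k => u k.+1 - u k) n.
  by rewrite /series/= telescope_sumr// addrC subrK.
apply/cvg_ex; exists (u 0%N + l).
have Hc : (fun n => u 0%N + series (fun k => u k.+1 - u k) n) @ \oo --> u 0%N + l.
  by apply: cvgD; [exact: cvg_cst|exact: Hl].
by apply: cvg_trans Hc; apply: near_eq_cvg; apply: nearW => n; rewrite -E.
Qed.

Lemma cvg_dist0 (u : R^nat) (l : R) : u @ \oo --> l -> `|u n - l| @[n --> \oo] --> 0.
Proof.
move=> ul; apply/cvgr0Pnorm_lt => e e0; have /cvgrPdist_lt/(_ _ e0) := ul.
by apply: filterS => n; rewrite normr_id distrC.
Qed.

(** The increments, squared and weighted by 2^k, still have summable integrals, so their sum is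
    finite almost everywhere. There the increments themselves are summable and the sequence
    converges. *)
Lemma riesz_fischer (g_ : nat -> T -> R[i]) (c : R) : 0 <= c -> (forall k, cmeas (g_ k)) ->
  (forall k, (\int[mu]_x (normc (g_ k.+1 x - g_ k x) ^+ 2)%:E <= (c * 4^-1 ^+ k)%:E)%E) ->
  exists2 g, cmeas g & \forall x \ae mu, normc (g_ k x - g x) @[k --> \oo] --> 0.
Proof.
move=> c0 mg gl.
pose h k x : \bar R := (2 ^+ k * normc (g_ k.+1 x - g_ k x) ^+ 2)%:E.
have mn k : measurable_fun setT (fun x => normc (g_ k.+1 x - g_ k x) ^+ 2).
  by apply: measurable_funX; apply: measurable_normc; exact: cmeasB.
have mh k : measurable_fun setT (h k).
  by apply/measurable_EFinP; exact: measurable_funM.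
have h0 k x : (0 <= h k x)%E by rewrite lee_fin mulr_ge0 ?sqr_ge0// exprn_ge0.
have hk k : (\int[mu]_x h k x <= (c * 2^-1 ^+ k)%:E)%E.
  rewrite /h; under eq_integral do rewrite EFinM.
  have p0 : (0 <= (2 ^+ k : R)%:E)%E by rewrite lee_fin exprn_ge0.
  rewrite ge0_integralZl//; last 2 first.
  - exact/measurable_EFinP.
  - by move=> x _; rewrite lee_fin sqr_ge0.
  - apply: le_trans (lee_wpmul2l _ (gl k)) _ => //.
    rewrite -EFinM lee_fin mulrCA -exprMn (_ : 2 * 4^-1 = 2^-1 :> R)//; lra.
have S : (\int[mu]_x (\sum_(0 <= k <oo) h k x) < +oo)%E.
  rewrite integral_nneseries//.
  apply: (@le_lt_trans _ _ (2 * c)%:E); last by rewrite ltry.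
  apply: lime_le.
    by apply: is_cvg_nneseries => k _ _; apply: integral_ge0 => x _.
  apply: nearW => n; apply: le_trans (lee_sum _ (fun k _ => hk k)) _.
  rewrite sumEFin lee_fin -mulr_sumr mulrC sum_halves ler_wpM2r//.
  by rewrite gerBl mulr_ge0// exprn_ge0// invr_ge0.
have iS : mu.-integrable setT (fun x => \sum_(0 <= k <oo) h k x)%E.
  apply/integrableP; split; first exact: ge0_emeasurable_sum.
  rewrite (eq_integral (fun x => \sum_(0 <= k <oo) h k x)%E)// => x _.
  by rewrite gee0_abs// nneseries_ge0.
have [N [mN N0 sN]] := integrable_ae measurableT iS.
have fin x : ~ N x -> (\sum_(0 <= k <oo) h k x)%E \is a fin_num.
  by move=> Nx; apply: contra_notT Nx => H; apply: sN => /= /(_ I); apply/negP.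
have bd x : ~ N x -> exists B, forall n, \sum_(0 <= k < n) normc (g_ k.+1 x - g_ k x) <= B.
  move=> /fin; case E : (\sum_(0 <= k <oo) h k x)%E => [B||]// _; exists (B + 2) => n.
  have H : (\sum_(0 <= k < n) h k x <= B%:E)%E by rewrite -E; exact: nneseries_lim_ge.
  rewrite sumEFin lee_fin in H.
  (* Each modulus a satisfies a <= 2^k a^2 + 2^-k. The first terms sum to at most B, the second to
     at most 2. *)
  apply: (@le_trans _ _ (\sum_(0 <= k < n) (2 ^+ k * normc (g_ k.+1 x - g_ k x) ^+ 2 + 2^-1 ^+ k))).
    apply: ler_sum => k _; set a := normc _.
    have p0 : 0 < 2 ^+ k :> R by rewrite exprn_gt0.
    rewrite exprVn; have := sqr_ge0 (2 ^+ k * a - 1); set p := 2 ^+ k in p0 *.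
    have a0 : 0 <= a by exact: normc_ge0.
    rewrite sqrrB1 => K; rewrite -(ler_pM2l p0) mulrDr mulfV ?gt_eqF//.
    rewrite mulrA -expr2 -exprMn; have := mulr_ge0 (ltW p0) a0; lra.
  rewrite big_split/= lerD// sum_halves gerBl mulr_ge0// exprn_ge0// invr_ge0//.
have m1 : measurable_fun setT (\1_(~` N) : T -> R) by apply: measurable_indic; exact: measurableC.
(* Setting the sequence to 0 on the null set makes it converge everywhere, and its pointwise limit
   is then measurable. *)
pose g' k x := g_ k x * (\1_(~` N) x)%:C.
have mg' k : cmeas (g' k) by apply: cmeasM => //; exact: cmeas_real.
have g'0 x : N x -> forall k, g' k x = 0.
  by move=> Nx k; rewrite /g' indicE memNset ?mulr0//=; exact.
have g'1 x : ~ N x -> forall k, g' k x = g_ k x.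
  by move=> Nx k; rewrite /g' indicE mem_set// mulr1.
have cvR x : cvgn (fun k => complex.Re (g' k x)).
  have [Nx|Nx] := pselect (N x).
    by under eq_fun do rewrite g'0//; exact: is_cvg_cst.
  have [B HB] := bd x Nx; apply: (@cvg_of_summable _ B) => n.
  apply: le_trans (HB n); apply: ler_sum => k _; rewrite !g'1//.
  by rewrite -Re_opp -Re_add; exact: normc_Re.
have cvI x : cvgn (fun k => complex.Im (g' k x)).
  have [Nx|Nx] := pselect (N x).
    by under eq_fun do rewrite g'0//; exact: is_cvg_cst.
  have [B HB] := bd x Nx; apply: (@cvg_of_summable _ B) => n.
  apply: le_trans (HB n); apply: ler_sum => k _; rewrite !g'1//.
  by rewrite -Im_opp -Im_add; exact: normc_Im.
pose g x := limn (fun k => complex.Re (g' k x)) +i* limn (fun k => complex.Im (g' k x)).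
exists g.
  apply: cmeas_ReIm.
    by apply: (measurable_fun_cvg (h := fun k x => complex.Re (g' k x))) => [k|x _];
      [exact: (mg' k).1|exact: cvR].
  by apply: (measurable_fun_cvg (h := fun k x => complex.Im (g' k x))) => [k|x _];
    [exact: (mg' k).2|exact: cvI].
exists N; split => // x /= H; apply: contra_notP H => Nx.
have H1 : `|complex.Re (g' k x) - complex.Re (g x)| + `|complex.Im (g' k x) - complex.Im (g x)| @[k --> \oo] --> 0.
  have h1 := cvg_dist0 (cvR x); have h2 := cvg_dist0 (cvI x).
  by have := cvgD h1 h2; rewrite addr0; apply.
apply: (squeeze_cvgr _ (@cvg_cst _ _ _ _ _) H1).
apply: nearW => k; rewrite normc_ge0 /= -(g'1 x Nx).
by apply: le_trans (normc_le _) _; rewrite !ReImE.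
Qed.

End riesz_fischer.

Section l2_pairing.
Variables (R : realType) (d : nat).
Local Notation Rd := 'rV[R]_d.
Local Notation mu := (lebesgue_rV R d).

Lemma sqintM (a b : Rd -> R[i]) : cmeas a -> cmeas b -> sqint a -> sqint b ->
  cint mu (fun x => a x * b x).
Proof.
move=> ma mb sa sb; apply: (cint_le (cmeasM ma mb) (rintD sa sb)) => x; rewrite normcM.
have := sqr_ge0 (normc (a x) - normc (b x)).
have := normc_ge0 (a x); have := normc_ge0 (b x); nra.
Qed.

Lemma normc_sub_sqr (a b : R[i]) : normc (a - b) ^+ 2 <= 2 * (normc a ^+ 2 + normc b ^+ 2).
Proof.
have h := le_normcD a (- b); rewrite normcN in h.
have n0 := normc_ge0 (a - b); have na := normc_ge0 a; have nb := normc_ge0 b.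
have h2 : normc (a - b) ^+ 2 <= (normc a + normc b) ^+ 2 by rewrite lerXn2r ?nnegrE ?addr_ge0.
have := sqr_ge0 (normc a - normc b); move: h2; rewrite sqrrD sqrrB; lra.
Qed.

Lemma sqintB (a b : Rd -> R[i]) : cmeas a -> cmeas b -> sqint a -> sqint b ->
  sqint (fun x => a x - b x).
Proof.
move=> ma mb sa sb; apply: (rint_le _ (rintZ 2 (rintD sa sb))) => [|x].
  by apply: measurable_funX; apply: measurable_normc; exact: cmeasB.
by rewrite ger0_norm ?sqr_ge0//; exact: normc_sub_sqr.
Qed.

(** In place of the Cauchy-Schwarz inequality, the weighted bound y z <= 2^k y^2 + 2^-k z^2 is
    integrated; with squared distances of order 4^-k both terms are of order 2^-k. *)
Lemma sqint_pair_cvg (g_ : nat -> Rd -> R[i]) (g b : Rd -> R[i]) (c : R) :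
  (forall k, cmeas (g_ k)) -> cmeas g -> cmeas b -> (forall k, sqint (g_ k)) -> sqint g -> sqint b ->
  (forall k, \int[mu]_x (normc (g_ k x - g x) ^+ 2) <= c * 4^-1 ^+ k) ->
  normc (cI mu (fun x => g_ k x * b x) - cI mu (fun x => g x * b x)) @[k --> \oo] --> 0.
Proof.
move=> mg_ mg mb sg_ sg sb H.
set B := \int[mu]_x (normc (b x) ^+ 2).
have key k : normc (cI mu (fun x => g_ k x * b x) - cI mu (fun x => g x * b x)) <= (c + B) * 2^-1 ^+ k.
  have c1 := sqintM (mg_ k) mb (sg_ k) sb; have c2 := sqintM mg mb sg sb.
  rewrite -cIB//.
  have sd := sqintB (mg_ k) mg (sg_ k) sg.
  have p0 : 0 < 2 ^+ k :> R by rewrite exprn_gt0.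
  have I1 := rintZ (2 ^+ k) sd; have I2 := rintZ (2^-1 ^+ k) sb.
  have m1 : cmeas (fun x => g_ k x * b x - g x * b x) by apply: cmeasB; exact: cmeasM.
  have le1 x : normc (g_ k x * b x - g x * b x) <=
      2 ^+ k * normc (g_ k x - g x) ^+ 2 + 2^-1 ^+ k * normc (b x) ^+ 2.
    rewrite -mulrBl normcM exprVn; set y := normc _; set z := normc (b x).
    have y0 : 0 <= y by exact: normc_ge0.
    have z0 : 0 <= z by exact: normc_ge0.
    move: (2 ^+ k) p0 => p p0.
    rewrite -(ler_pM2l p0) (_ : p * (_ + _) = (p * y) ^+ 2 + z ^+ 2); last by field; rewrite gt_eqF.
    have := sqr_ge0 (p * y - z); have := mulr_ge0 (mulr_ge0 (ltW p0) y0) z0.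
    rewrite (_ : p * (y * z) = p * y * z) ?mulrA//; move: (p * y) => u; nra.
  apply: le_trans (normc_cI_le m1 (rintD I1 I2) le1) _.
  rewrite (RintegralD measurableT I1 I2) (RintegralZl _ measurableT sd) (RintegralZl _ measurableT sb).
  rewrite mulrDl (mulrC B) lerD2r; apply: le_trans (ler_wpM2l (ltW p0) (H k)) _.
  by rewrite mulrCA -exprMn (_ : 2 * 4^-1 = 2^-1 :> R)//; lra.
have H1 : (c + B) * 2^-1 ^+ k @[k --> \oo] --> 0.
  by apply: cvg0_mull; apply: cvg_expr; rewrite ger0_norm ?invr_ge0// invf_lt1// ltr1n.
apply: (squeeze_cvgr _ (@cvg_cst _ _ _ _ _) H1).
by apply: nearW => k; rewrite normc_ge0 key.
Qed.

End l2_pairing.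

Section schwartz_bounds.
Variables (R : realType) (d : nat).
Local Notation Rd := 'rV[R]_d.
Local Notation mu := (lebesgue_rV R d).
Implicit Types (phi : Rd -> R[i]) (x : Rd).

Lemma continuous_normc_cvg phi x : {for x, continuous phi} ->
  normc (phi y - phi x) @[y --> x] --> 0.
Proof.
move=> cphi; apply/(@cvgrPdist_lt _ _ _ (nbhs x) (nbhs_filter x)) => e e0.
have e0' : 0 < e%:C by rewrite ltcR.
have := (@cvgrPdist_lt _ _ _ (nbhs x) (nbhs_filter x) phi (phi x)).1 cphi _ e0'.
apply: filterS => y; rewrite normc_lt_norm => h.
by rewrite sub0r normrN ger0_norm ?normc_ge0// normcB.
Qed.

Lemma normc_cvg_continuous phi x : normc (phi y - phi x) @[y --> x] --> 0 ->
  {for x, continuous phi}.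
Proof.
move=> H; apply/(@cvgrPdist_lt _ _ _ (nbhs x) (nbhs_filter x)) => e /gt0_complex[r r0 ->].
have := (@cvgrPdist_lt _ _ _ (nbhs x) (nbhs_filter x) _ _).1 H _ r0.
apply: filterS => y; rewrite sub0r normrN ger0_norm ?normc_ge0// normcB => h.
by rewrite normc_lt_norm.
Qed.

Lemma continuous_normc phi : continuous phi -> continuous (fun x => normc (phi x)).
Proof.
move=> c x; apply/(@cvgrPdist_lt _ _ _ (nbhs x) (nbhs_filter x)) => e e0.
have := (@cvgrPdist_lt _ _ _ (nbhs x) (nbhs_filter x) _ _).1 (continuous_normc_cvg (c x)) _ e0.
apply: filterS => y; rewrite sub0r normrN ger0_norm ?normc_ge0// => h.
apply: le_lt_trans h.
have h1 := le_normcD (phi x) (phi y - phi x); have h2 := le_normcD (phi y) (phi x - phi y).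
move: h1 h2; rewrite !subrKC [normc (phi x - phi y)]normcB.
by rewrite ler_norml => h1 h2; apply/andP; split; lra.
Qed.

Lemma continuous_Re phi : continuous phi -> continuous (fun x => complex.Re (phi x)).
Proof.
move=> c x; apply/(@cvgrPdist_lt _ _ _ (nbhs x) (nbhs_filter x)) => e e0.
have := (@cvgrPdist_lt _ _ _ (nbhs x) (nbhs_filter x) _ _).1 (continuous_normc_cvg (c x)) _ e0.
apply: filterS => y; rewrite sub0r normrN ger0_norm ?normc_ge0// => h.
by apply: le_lt_trans h; rewrite distrC -Re_opp -Re_add normc_Re.
Qed.

Lemma continuous_Im phi : continuous phi -> continuous (fun x => complex.Im (phi x)).
Proof.
move=> c x; apply/(@cvgrPdist_lt _ _ _ (nbhs x) (nbhs_filter x)) => e e0.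
have := (@cvgrPdist_lt _ _ _ (nbhs x) (nbhs_filter x) _ _).1 (continuous_normc_cvg (c x)) _ e0.
apply: filterS => y; rewrite sub0r normrN ger0_norm ?normc_ge0// => h.
by apply: le_lt_trans h; rewrite distrC -Im_opp -Im_add normc_Im.
Qed.

Lemma continuous_cmeas phi : continuous phi -> cmeas phi.
Proof.
by move=> c; split; apply: rV_continuous_measurable; [exact: continuous_Re|exact: continuous_Im].
Qed.

Lemma smooth_continuous phi : smooth phi -> continuous phi.
Proof. by move=> /(_ [::])[]. Qed.

Lemma schwartz_seminorm_ub s1 s2 phi x : (schwartz_seminorm s1 s2 phi < +oo)%E ->
  `|monomial s1 x| * normc (pderivs s2 phi x) <= fine (schwartz_seminorm s1 s2 phi).
Proof.
move=> foo.
have H : ((`|monomial s1 x| * normc (pderivs s2 phi x))%:E <= schwartz_seminorm s1 s2 phi)%E.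
  by apply: ereal_sup_ubound; exists x.
rewrite -lee_fin fineK//; rewrite ge0_fin_numE//; apply: le_trans H.
by rewrite lee_fin mulr_ge0// normc_ge0.
Qed.

(* The bound obtained for |x^m| * prod_(i <- s) (1 + x_i^2) * a by expanding the
   product into monomials. *)
Fixpoint weight_cst (K : seq 'I_d -> R) (s m : seq 'I_d) : R :=
  if s is i :: s' then weight_cst K s' m + weight_cst K s' (i :: i :: m) else K m.

Lemma weight_cst_const (r : R) s m : weight_cst (fun=> r) s m = 2 ^+ size s * r.
Proof.
elim: s m => [|i s IH] m /=; first by rewrite expr0 mul1r.
by rewrite !IH exprS; ring.
Qed.

(** Each factor 1 + x_i^2 either leaves the monomial as it is or lengthens it by two, so raising [N]
    by two at each step keeps the bound N + 2 size(s) unchanged. *)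
Lemma monomial_weight (K : seq 'I_d -> R) x (a : R) (s : seq 'I_d) (N : nat) m :
  (forall m', (size m' <= N + (size s).*2)%N -> `|monomial m' x| * a <= K m') ->
  (size m <= N)%N ->
  `|monomial m x| * (\prod_(i <- s) (1 + x ord0 i ^+ 2) * a) <= weight_cst K s m.
Proof.
elim: s m N => [|i s IH] m N HK mN /=.
  by rewrite big_nil mul1r; apply: HK; rewrite addn0.
have h1 := IH m N.+2; have h2 := IH (i :: i :: m) N.+2.
have E : (N.+2 + (size s).*2 = N + (size (i :: s)).*2)%N by rewrite /= doubleS !addnS.
rewrite E in h1 h2; have {}h1 := h1 HK (leqW (leqW mN)); have {}h2 := h2 HK mN.
have Em : monomial [:: i, i & m] x = x ord0 i ^+ 2 * monomial m x.
  by rewrite /monomial !big_cons mulrA expr2.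
rewrite big_cons; move: h1 h2; rewrite Em normrM (ger0_norm (sqr_ge0 _)).
by move: (\prod_(_ <- _) _) `|_| => p q; lra.
Qed.

Lemma weight_monomial (K : seq 'I_d -> R) x (a : R) :
  (forall m, (size m <= (size (index_enum 'I_d)).*2)%N -> `|monomial m x| * a <= K m) ->
  a <= weight_cst K (index_enum 'I_d) [::] * weight x.
Proof.
move=> HK; have := @monomial_weight K x a (index_enum 'I_d) 0 [::] HK (leqnn _).
rewrite /monomial big_nil normr1 mul1r => h.
have w0 := weight_gt0 x.
have E : \prod_(i < d) (1 + x ord0 i ^+ 2) * weight x = 1.
  rewrite /weight -big_split /= big1// => i _; rewrite divff// gt_eqF//.
  by rewrite ltr_pwDl// sqr_ge0.
rewrite -[a]mul1r -E mulrAC ler_pM2r//.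
Qed.

Lemma schwartz_weight phi : schwartz phi ->
  exists2 K : R, 0 <= K & forall x, normc (phi x) <= K * weight x.
Proof.
move=> [_ semi]; pose K m := fine (schwartz_seminorm m [::] phi).
set C := weight_cst K (index_enum 'I_d) [::].
have H x : normc (phi x) <= C * weight x.
  by apply: weight_monomial => m _; exact: (schwartz_seminorm_ub (s2 := [::])).
exists C => //; have := H 0; have := weight_gt0 (0 : Rd); have := normc_ge0 (phi 0).
move=> h1 h2 h3; have := le_trans h1 h3; rewrite pmulr_lge0//.
Qed.

Lemma weight_le1 x : weight x <= 1.
Proof.
rewrite /weight; apply: prodr_ile1 => i _.
have h : 1 <= 1 + x ord0 i ^+ 2 by rewrite lerDl sqr_ge0.
by rewrite invr_ge0 invf_le1 ?(le_trans ler01 h)// (lt_le_trans ltr01 h).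
Qed.

Lemma schwartz_cmeas phi : schwartz phi -> cmeas phi.
Proof. by move=> [s _]; apply: continuous_cmeas; exact: smooth_continuous. Qed.

Lemma schwartz_bounded phi : schwartz phi -> exists2 K : R, 0 <= K & forall x, normc (phi x) <= K.
Proof.
move=> /schwartz_weight[K K0 H]; exists K => // x.
by rewrite (le_trans (H x))// ler_piMr// weight_le1.
Qed.

Lemma schwartz_cint phi : schwartz phi -> cint mu phi.
Proof.
move=> sp; have [K K0 H] := schwartz_weight sp.
exact: (cint_le (schwartz_cmeas sp) (rintZ K (rint_weight R d)) H).
Qed.

Lemma cint_bounded_sqint (g : Rd -> R[i]) C : cint mu g -> (forall x, normc (g x) <= C) -> sqint g.
Proof.
move=> [mg ng] gC; apply: (rint_le _ (rintZ C ng)) => [|x].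
  by apply: measurable_funX; exact: measurable_normc.
by rewrite ger0_norm ?sqr_ge0// expr2 ler_wpM2r ?normc_ge0.
Qed.

Lemma schwartz_sqint phi : schwartz phi -> sqint phi.
Proof.
move=> sp; have [K K0 H] := schwartz_bounded sp.
exact: cint_bounded_sqint (schwartz_cint sp) H.
Qed.

End schwartz_bounds.

Section test_functions.
Variables (R : realType) (d : nat).
Local Notation Rd := 'rV[R]_d.
Local Notation mu := (lebesgue_rV R d).
Implicit Types (phi : Rd -> R[i]) (x : Rd).

Lemma continuous_prod_rV (s : seq 'I_d) (h : 'I_d -> Rd -> R) : (forall i, continuous (h i)) ->
  continuous (fun x => \prod_(i <- s) h i x).
Proof.
move=> ch x; elim: s => [|i s IH].
  rewrite (_ : (fun _ => _) = cst 1); first exact: cst_continuous.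
  by apply/funext => y; rewrite big_nil.
rewrite (_ : (fun _ => _) = (fun y => h i y * \prod_(j <- s) h j y)).
  by apply: (@cvgM _ _ (nbhs x) (nbhs_filter x)); [exact: ch|exact: IH].
by apply/funext => y; rewrite big_cons.
Qed.

(** The reciprocal of the weight is continuous, and M is its maximum on K. This makes constants on
    compact sets integrable without computing any volume. *)
Lemma compact_le_weight (K : set Rd) : compact K ->
  exists2 M : R, 0 <= M & forall x, K x -> 1 <= M * weight x.
Proof.
move=> cK; pose w x : R := \prod_(i < d) (1 + x ord0 i ^+ 2).
have cw : continuous w.
  apply: continuous_prod_rV => i x; apply: (@cvgD _ _ _ (nbhs x) (nbhs_filter x)); first exact: cvg_cst.
  by apply: (@cvgM _ _ (nbhs x) (nbhs_filter x)); exact: coord_continuous.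
have [K0|] := pselect (K !=set0); last first.
  by move=> K0; exists 0 => // x Kx; case: K0; exists x.
have [c cA H] := EVT_max_rV K0 cK (continuous_subspaceT cw).
exists (w c) => [|x Kx].
  by apply: prodr_ge0 => i _; rewrite addr_ge0 ?sqr_ge0.
apply: le_trans (_ : w x * weight x <= _); last first.
  by rewrite ler_wpM2r ?(ltW (weight_gt0 _))// H ?inE.
rewrite /w /weight -big_split /= big1// => i _; rewrite divff// gt_eqF//.
by rewrite ltr_pwDl// sqr_ge0.
Qed.

Lemma pderiv_eq0 i (f : Rd -> R[i]) (U : set Rd) : open U -> (forall x, U x -> f x = 0) ->
  forall x, U x -> pderiv i f x = 0.
Proof.
move=> oU f0 x Ux; have nU : nbhs x U by exact: open_nbhs_nbhs.
rewrite /pderiv (near_eq_derive (g := cst 0)) ?derive_cst; last first.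
  by apply: filterS nU => y Uy /=; rewrite f0.
rewrite (near_eq_derive (g := cst 0)) ?derive_cst//.
by apply: filterS nU => y Uy /=; rewrite f0.
Qed.

Lemma pderivs_eq0 s (f : Rd -> R[i]) (U : set Rd) : open U -> (forall x, U x -> f x = 0) ->
  forall x, U x -> pderivs s f x = 0.
Proof. by move=> oU f0; elim: s => [//|i s IH] /=; exact: pderiv_eq0. Qed.

Lemma test_schwartz (U : set Rd) phi : test_function U phi -> schwartz phi.
Proof.
move=> [sm cK _]; split => // s1 s2.
set K := closure _ in cK.
have ocK : open (~` K) by apply: closed_openC; exact: closed_closure.
have phi0 x : (~` K) x -> phi x = 0.
  by move=> nK; apply: contra_notP nK => /eqP nz; apply: subset_closure.
pose h x : R := `|monomial s1 x| * normc (pderivs s2 phi x).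
have ch : continuous h.
  move=> x; apply: (@cvgM _ _ (nbhs x) (nbhs_filter x)).
    apply: continuous_comp; last exact: norm_continuous.
    by apply: (@continuous_prod_rV s1 (fun i x => x ord0 i)) => i y; exact: coord_continuous.
  by apply: continuous_normc; exact: (sm s2).1.
have [M hM] : exists M : R, forall x, h x <= M.
  have [K0|K0] := pselect (K !=set0).
    have [c _ H] := EVT_max_rV K0 cK (continuous_subspaceT ch).
    exists (h c) => x; have [Kx|nK] := pselect (K x); first by rewrite H ?inE.
    by rewrite /h (pderivs_eq0 s2 ocK phi0 nK) normc0 mulr0 mulr_ge0// normc_ge0.
  exists 0 => x; have nK : ~ K x by move=> Kx; apply: K0; exists x.
  by rewrite /h (pderivs_eq0 s2 ocK phi0 nK) normc0 mulr0.
apply: le_lt_trans (ltry M); apply: ge_ereal_sup => _ [x _ <-].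
by rewrite lee_fin; exact: hM.
Qed.

Lemma ae_bounded_locally_integrable (f f0 : Rd -> R[i]) (C : R) : cmeas f0 ->
  (forall x, normc (f0 x) <= C) -> (\forall x \ae mu, f x = f0 x) -> Defs.locally_integrable f.
Proof.
move=> mf0 f0C ff0; split; first by case: (mf0) => m1 m2; exists f0; split => //; apply: filterS ff0 => x fx _.
move=> K cK; have [M M0 HM] := compact_le_weight cK.
have clK : closed K by apply: compact_closed => //; exact: norm_hausdorff.
have mK := rV_closed_measurable clK.
have C0 : 0 <= C by apply: le_trans (f0C 0); exact: normc_ge0.
rewrite integral_mkcond (@ae_integral _ _ _ mu _ ((fun x => (normc (f0 x))%:E) \_ K)); first last.
- by apply: filterS ff0 => x fx; rewrite !patchE fx.
- have m1 : measurable_fun setT (fun x => (normc (f0 x))%:E) by apply/measurable_EFinP; exact: measurable_normc.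
  have := (measurable_restrictT _ mK).1 (measurable_funTS m1); exact.
have rw := (rintP mu (fun x => mulr_ge0 (mulr_ge0 C0 M0) (ltW (weight_gt0 x)))).1 (rintZ (C * M) (rint_weight R d)).
apply: le_lt_trans rw.2; apply: ge0_mono_integral => x.
  by rewrite patchE; case: ifP => // _; rewrite lee_fin normc_ge0.
rewrite patchE; case: ifPn => [/set_mem Kx|_]; rewrite lee_fin ?mulr_ge0// ?(ltW (weight_gt0 _))//.
rewrite -mulrA -[normc _]mulr1 ler_pM ?normc_ge0//; exact: HM.
Qed.

Lemma distr_of_ae (f f0 phi : Rd -> R[i]) : cmeas f0 -> cmeas phi ->
  (\forall x \ae mu, f x = f0 x) -> distr_of f phi = cI mu (fun x => f0 x * phi x).
Proof.
move=> mf0 mphi ff0; apply: ae_cI; first exact: cmeasM.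
by apply: filterS ff0 => x ->.
Qed.

(** Since [f0] is bounded, an L^1 estimate of psi - phi suffices. The seminorms without derivatives
    and with monomials of degree at most 2 d bound it by a multiple of [weight]. *)
Lemma ae_bounded_tempered (f f0 : Rd -> R[i]) (C : R) : cmeas f0 ->
  (forall x, normc (f0 x) <= C) -> (\forall x \ae mu, f x = f0 x) -> tempered (distr_of f).
Proof.
move=> mf0 f0C ff0.
have C0 : 0 <= C by apply: le_trans (f0C 0); exact: normc_ge0.
have ci phi : schwartz phi -> cint mu (fun x => f0 x * phi x).
  move=> sp; have := cintMb (schwartz_cint sp) mf0 f0C.
  by congr (cint _ _); apply/funext => x; rewrite mulrC.
split=> [a phi psi sp sq|phi e sp e0].
  have mp := schwartz_cmeas sp; have mq := schwartz_cmeas sq.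
  rewrite !(distr_of_ae (f0 := f0))//; last first.
    by apply: cmeasD => //; apply: cmeasM => //; exact: cmeas_cst.
  rewrite -(cIMl a (ci _ sp)) -(cID (cintMl a (ci _ sp)) (ci _ sq)).
  by apply: eq_cI => x; rewrite mulrDr mulrCA.
pose s0 := index_enum 'I_d; set W := \int[mu]_x weight x.
have W0 : 0 <= W by apply: Rintegral_ge0 => x _; exact/ltW/weight_gt0.
set Q := C * (2 ^+ size s0 * W).
have Q0 : 0 <= Q by rewrite !mulr_ge0// exprn_ge0.
(* [Q] times the size of the seminorms bounds the difference; dividing by Q + 1 makes the inequality
   strict and allows Q = 0. *)
exists (size s0).*2, (e / (Q + 1)); split; first by rewrite divr_gt0// ltr_wpDl.
move=> psi sq semi; set del := e / (Q + 1) in semi *.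
have mp := schwartz_cmeas sp; have mq := schwartz_cmeas sq.
have md := cmeasB mq mp.
have dw x : normc (psi x - phi x) <= 2 ^+ size s0 * del * weight x.
  rewrite -(weight_cst_const del s0 [::]); apply: weight_monomial => m hm.
  have sl := semi m [::] hm isT.
  have : ((`|monomial m x| * normc (pderivs [::] (fun x => psi x - phi x) x))%:E <=
          schwartz_seminorm m [::] (fun x => (psi x - phi x)%R))%E.
    by apply: ereal_sup_ubound; exists x.
  by move=> h; have := le_lt_trans h sl; rewrite lte_fin => /ltW.
rewrite !(distr_of_ae (f0 := f0))// -(cIB (ci _ sq) (ci _ sp)).
have mm : cmeas (fun x => f0 x * psi x - f0 x * phi x) by apply: cmeasB; exact: cmeasM.
have le x : normc (f0 x * psi x - f0 x * phi x) <= C * (2 ^+ size s0 * del) * weight x.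
  by rewrite -mulrBr normcM -mulrA ler_pM ?normc_ge0.
apply: le_lt_trans (normc_cI_le mm (rintZ _ (rint_weight R d)) le) _.
rewrite (RintegralZl _ measurableT (rint_weight R d)) -/W.
rewrite (_ : _ * W = Q * del); last by rewrite /Q; ring.
by rewrite /del mulrA ltr_pdivrMr ?ltr_wpDl//; nra.
Qed.

End test_functions.

(** * From exponential type to the support *)

Section separation.
Variables (R : realType) (d : nat).
Local Notation Rd := 'rV[R]_d.

Lemma dotr_gt0 (u : Rd) : u != 0 -> 0 < dotr u u.
Proof.
move=> u0; rewrite lt_neqAle dotr_ge0 andbT eq_sym; apply: contra_neq u0 => uu0.
apply/rowP => i; rewrite mxE; apply/eqP.
have := uu0; rewrite /dotr => /eqP; rewrite psumr_eq0; last by move=> j _; rewrite -expr2 sqr_ge0.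
by move=> /allP/(_ i (mem_index_enum _)) /=; rewrite mulf_eq0 orbb.
Qed.

Lemma dotr_self_continuous : continuous (fun a : Rd => dotr a a).
Proof.
rewrite /dotr; elim: (index_enum _) => [|i s ih] a.
  rewrite (_ : (fun _ => _) = cst 0); first exact: cst_continuous.
  by apply/funext => b; rewrite big_nil.
rewrite (_ : (fun _ => _) = (fun b : Rd => b ord0 i * b ord0 i + \sum_(j <- s) b ord0 j * b ord0 j)).
  apply: (@cvgD _ _ _ (nbhs a) (nbhs_filter a)); last exact: ih.
  by apply: (@cvgM _ _ (nbhs a) (nbhs_filter a)); exact: coord_continuous.
by apply/funext => b; rewrite big_cons.
Qed.

Lemma dotrB_scale (u v : Rd) (t : R) :
  dotr (u - t *: v) (u - t *: v) = dotr u u - 2 * t * dotr u v + t ^+ 2 * dotr v v.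
Proof.
rewrite /dotr !mulr_sumr -sumrB -big_split /=; apply: eq_bigr => i _; rewrite !mxE; ring.
Qed.

(** The direction [u] points from the nearest point a0 of A to x. Minimality gives u.(a - a0) <= 0
    on A, so H_A(u) <= a0.u = x.u - |u|^2, and half of |u|^2 serves as the gap. *)
Lemma convex_separation (A : set Rd) (x : Rd) : A !=set0 -> compact A ->
  convex_set (A : set (convex_lmodType Rd)) -> ~ A x ->
  exists u, exists2 del, 0 < del & supporting_function A u + del < dotr x u.
Proof.
move=> A0 cA cvA nAx.
have cq : continuous (fun a : Rd => dotr (x - a) (x - a)).
  move=> a; apply: (@continuous_comp _ _ _ (fun a : Rd => x - a) (fun b => dotr b b)).
    apply: (@cvgB _ _ _ (nbhs a) (nbhs_filter a)); last exact: cvg_id.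
    exact: (@cvg_cst _ _ _ (nbhs a) (nbhs_filter a)).
  exact: dotr_self_continuous.
have [a0 /set_mem Aa0 Hmin] := EVT_min_rV A0 cA (continuous_subspaceT cq).
pose u := x - a0.
have u0 : u != 0 by rewrite subr_eq0; apply: contra_not_neq nAx => ->.
have key a : A a -> dotr u (a - a0) <= 0.
  move=> Aa; set v := a - a0; rewrite leNgt; apply/negP => p0.
  set p := dotr u v in p0 *; have v0 := dotr_ge0 v; set w := dotr v v in v0 *.
  (* If p > 0, moving from a0 the fraction t = p / (w + p) of the way to a lowers the squared
     distance to x by 2 t p - t^2 w, which is positive because t w <= p. *)
  have t01 : 0 <= p / (w + p) <= 1.
    by rewrite divr_ge0 ?addr_ge0 ?(ltW p0)//= ler_pdivrMr ?ltr_wpDl// mul1r lerDr.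
  have /andP[t0 t1] := t01; pose tt : {i01 R} := Itv01 t0 t1; set t := p / (w + p) in t0 t1 tt t01 *.
  have Ab : (a0 + t *: v) \in A.
    have -> : a0 + t *: v = t *: a + (1 - t) *: a0.
      by rewrite /v scalerBr scalerBl scale1r addrCA addrA.
    by have := cvA a a0 tt (mem_set Aa) (mem_set Aa0).
  have := Hmin _ Ab; rewrite opprD addrA -/u dotrB_scale -/p -/w => h.
  have h1 : 2 * t * p <= t ^+ 2 * w by move: h; rewrite /u; lra.
  have tpos : 0 < t by rewrite divr_gt0// ltr_wpDl.
  have h2 : 2 * p <= t * w by rewrite -(ler_pM2l tpos); rewrite mulrCA mulrA (_ : t * (t * w) = t ^+ 2 * w)// mulrA expr2.
  have h3 : t * w <= p.
    by rewrite /t mulrAC ler_pdivrMr ?ltr_wpDl//; rewrite ler_wpM2l ?(ltW p0)// lerDl ltW.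
  lra.
exists u, (dotr u u / 2); first by rewrite divr_gt0// dotr_gt0.
have H : supporting_function A u <= dotr a0 u.
  apply: ge_sup; first by case: A0 => a Aa; exists (dotr a u), a.
  move=> _ [a Aa <-]; have := key a Aa; rewrite -subr_le0.
  rewrite (_ : dotr u (a - a0) - 0 = dotr a u - dotr a0 u) ?subr_le0// subr0 /dotr -sumrB.
  by apply: eq_bigr => i _; rewrite !mxE; ring.
have E : dotr x u = dotr a0 u + dotr u u.
  by rewrite /dotr -big_split /=; apply: eq_bigr => i _; rewrite !mxE; ring.
by have := dotr_gt0 u0; rewrite E; lra.
Qed.

(** Writing k m = (n + 1) q, the exponential exp(k m) is the (n + 1)-st power of exp(q) >= q. One
    power more than n is taken so that a factor 1/m is left. *)
Lemma expR_power_decay (k : R) (n : nat) (m : R) : 0 < k -> 0 < m ->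
  m ^+ n * expR (- (k * m)) <= (n.+1%:R / k) ^+ n.+1 / m.
Proof.
move=> k0 m0; set q := k * m / n.+1%:R.
have n0 : 0 < n.+1%:R :> R by rewrite ltr0n.
have q0 : 0 < q by rewrite /q divr_gt0// mulr_gt0.
have E : k * m = n.+1%:R * q by rewrite /q mulrCA divff ?mulr1// gt_eqF.
rewrite E expRN expRM_natl.
have h : q ^+ n.+1 <= expR q ^+ n.+1.
  by rewrite lerXn2r ?nnegrE ?expR_ge0 ?(ltW q0)// (le_trans _ (expR_ge1Dx q))// lerDr.
rewrite ler_pdivrMr ?exprn_gt0 ?expR_gt0//.
apply: le_trans (_ : (n.+1%:R / k) ^+ n.+1 / m * q ^+ n.+1 <= _); last first.
  by rewrite ler_wpM2l// divr_ge0 ?(ltW m0)// exprn_ge0// divr_ge0 ?(ltW k0)// ltW.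
have -> : q = (n.+1%:R / k)^-1 * m by rewrite /q invf_div mulrAC.
have r0 : 0 < n.+1%:R / k by rewrite divr_gt0.
move: (n.+1%:R / k) r0 => r r0; rewrite exprMn exprVn mulrACA mulfV ?mul1r ?gt_eqF ?exprn_gt0//.
by rewrite exprS mulKf ?gt_eqF.
Qed.

End separation.

(** * Gaussian regularization *)

Section gaussian_regularization.
Variables (R : realType) (d : nat).
Local Notation Rd := 'rV[R]_d.
Local Notation Cd := 'rV[R[i]]_d.
Local Notation mu := (lebesgue_rV R d).

Definition gauss_reg (f : Rd -> R[i]) (e : R) (x : Rd) : R[i] := f x * (expR (- (e * dotr x x)))%:C.

Lemma cmeas_gauss e : cmeas (fun x : Rd => (expR (- (e * dotr x x)))%:C).
Proof.
apply: cmeas_real; apply: measurableT_comp; first exact: measurable_expR.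
apply: measurableT_comp => //; apply: measurable_funM => //.
by apply: measurable_dotr; exact: measurable_id.
Qed.

Lemma normc_gauss e (x : Rd) : 0 <= e -> normc ((expR (- (e * dotr x x)))%:C) <= 1.
Proof.
move=> e0; rewrite normc_real ger0_norm ?expR_ge0// -[leRHS]expR0 ler_expR.
by rewrite oppr_le0 mulr_ge0// dotr_ge0.
Qed.

Variables (f : Rd -> R[i]) (C : R).
Hypothesis mf : cmeas f.
Hypothesis sf : sqint f.
Hypothesis fC : forall x, normc (f x) <= C.

Lemma cmeas_gauss_reg e : cmeas (gauss_reg f e).
Proof. by apply: cmeasM => //; exact: cmeas_gauss. Qed.

Lemma normc_gauss_reg e x : 0 <= e -> normc (gauss_reg f e x) <= normc (f x).
Proof. by move=> e0; rewrite normcM ler_piMr ?normc_ge0//; exact: normc_gauss. Qed.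

Lemma cint_gauss_reg e : 0 < e <= 1 -> cint mu (gauss_reg f e).
Proof.
move=> e01; apply: (cint_le (cmeas_gauss_reg e) (rintZ (C * (e^-1) ^+ d) (rint_weight R d))) => x.
rewrite normcM -mulrA ler_pM ?normc_ge0// normc_real ger0_norm ?expR_ge0//.
exact: gauss_le_weight.
Qed.

Lemma sqint_gauss_reg e : 0 <= e -> sqint (gauss_reg f e).
Proof.
move=> e0; apply: (rint_le _ sf) => [|x].
  by apply: measurable_funX; apply: measurable_normc; exact: cmeas_gauss_reg.
by rewrite ger0_norm ?sqr_ge0// lerXn2r ?nnegrE ?normc_ge0// normc_gauss_reg.
Qed.

(** Dominated convergence: the integrand is |f|^2 times the square of 1 - exp(- e |x|^2), which lies
    between 0 and 1. *)
Lemma gauss_reg_cvg :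
  \int[mu]_x (normc (gauss_reg f n.+1%:R^-1 x - f x) ^+ 2) @[n --> \oo] --> 0.
Proof.
pose h n x : R[i] := (normc (gauss_reg f n.+1%:R^-1 x - f x) ^+ 2)%:C.
have mh n : cmeas (h n).
  apply: cmeas_real; apply: measurable_funX; apply: measurable_normc.
  by apply: cmeasB => //; exact: cmeas_gauss_reg.
have E n x : h n x = ((normc (f x) * (1 - expR (- (n.+1%:R^-1 * dotr x x)))) ^+ 2)%:C.
  rewrite /h /gauss_reg -{2}[f x]mulr1 -mulrBr normcM normcB; congr ((_ * _) ^+ 2)%:C.
  set r := expR _; have -> : 1 - r%:C = (1 - r)%:C by rewrite rmorphB rmorph1.
  rewrite normc_real ger0_norm// subr_ge0 /r.
  by rewrite -[leRHS]expR0 ler_expR oppr_le0 mulr_ge0 ?dotr_ge0// invr_ge0.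
have hb n x : normc (h n x) <= normc (f x) ^+ 2.
  rewrite E normc_real ger0_norm ?sqr_ge0// lerXn2r ?nnegrE ?normc_ge0//.
    by rewrite mulr_ge0 ?normc_ge0// subr_ge0 -[leRHS]expR0 ler_expR oppr_le0 mulr_ge0 ?dotr_ge0 ?invr_ge0.
  by rewrite ler_piMr ?normc_ge0// lerBlDr lerDl expR_ge0.
have hl x : normc (h n x - 0) @[n --> \oo] --> 0.
  have L : 1 - expR (- (n.+1%:R^-1 * dotr x x)) @[n --> \oo] --> (0 : R).
    have L1 : - (n.+1%:R^-1 * dotr x x) @[n --> \oo] --> (0 : R).
      have L0 := cvgN (cvgM (@cvg_harmonic R) (cvg_cst (dotr x x))).
      rewrite mul0r oppr0 in L0; exact: L0.
    have L2 : expR (- (n.+1%:R^-1 * dotr x x)) @[n --> \oo] --> expR (0 : R).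
      by apply: continuous_cvg L1; exact: continuous_expR.
    have L3 := cvgB (cvg_cst (1 : R)) L2.
    rewrite expR0 subrr in L3; exact: L3.
  have L2 := cvg0_mull (normc (f x)) L; have L3 := cvgM L2 L2.
  rewrite mulr0 in L3; rewrite (_ : (fun n => _) = (fun n =>
    normc (f x) * (1 - expR (- (n.+1%:R^-1 * dotr x x))) *
    (normc (f x) * (1 - expR (- (n.+1%:R^-1 * dotr x x)))))); first exact: L3.
  by apply/funext => n; rewrite subr0 E normc_real ger0_norm ?sqr_ge0// expr2.
have [_ H] := cI_dct mh (@cmeas_cst _ Rd R 0) sf hb hl.
apply: cvg_trans H; apply: near_eq_cvg; apply: nearW => n.
have c0 : cI mu (fun=> 0) = 0 :> R[i].
  by apply: complexP => //=; rewrite /Rintegral integral0.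
rewrite c0 subr0 cI_real normc_real ger0_norm//.
by apply: Rintegral_ge0 => x _; rewrite sqr_ge0.
Qed.

(** The rate 4^-k is what [riesz_fischer] and [sqint_pair_cvg] need; the bound k + 1 <= 1 / e_k
    sends the decay estimate off A to 0. *)
Lemma gauss_reg_seq : exists e_ : nat -> R, [/\ forall k, 0 < e_ k <= 1,
  forall k, k.+1%:R <= (e_ k)^-1 &
  forall k, \int[mu]_x (normc (gauss_reg f (e_ k) x - f x) ^+ 2) <= 4^-1 ^+ k].
Proof.
have H k : exists N : nat, (k <= N)%N /\
    \int[mu]_x (normc (gauss_reg f N.+1%:R^-1 x - f x) ^+ 2) <= 4^-1 ^+ k.
  have p0 : 0 < 4^-1 ^+ k :> R by rewrite exprn_gt0// invr_gt0.
  have [M _ HM] := (@cvgrPdist_lt _ _ _ \oo _ _ _).1 gauss_reg_cvg _ p0.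
  exists (maxn k M); split; first exact: leq_maxl.
  have := HM (maxn k M) (leq_maxr _ _); rewrite sub0r normrN => /ltW; exact: le_trans (ler_norm _).
have [N HN] := choice H; exists (fun k => (N k).+1%:R^-1); split => k.
- by rewrite invr_gt0 ltr0n /= invf_le1 ?ltr0n// ler1n.
- by rewrite invrK ler_nat ltnS (HN k).1.
- exact: (HN k).2.
Qed.

End gaussian_regularization.

Section inverse_transform.
Variables (R : realType) (d : nat).
Local Notation Rd := 'rV[R]_d.
Local Notation Cd := 'rV[R[i]]_d.
Local Notation mu := (lebesgue_rV R d).

Lemma ftB s (g h : Rd -> R[i]) y : cint mu g -> cint mu h ->
  ft s g y - ft s h y = ft s (fun x => g x - h x) y.
Proof.
move=> cg ch; have md : measurable_fun setT (fun x : Rd => s * dotr y x).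
  by apply: measurable_funM => //; apply: measurable_dotr => //; exact: measurable_id.
rewrite /ft -mulrBr -(cIB (cint_ce cg md) (cint_ce ch md)); congr (_ * _).
by apply: eq_cI => x; rewrite mulrBl.
Qed.

Lemma normc_dist_le (a b c : R[i]) : `|normc (c - b) - normc (a - c)| <= normc (a - b).
Proof.
have h1 := le_normcD (a - b) (b - c); have h2 := le_normcD (c - a) (a - b).
have E1 : a - b + (b - c) = a - c by ring.
have E2 : c - a + (a - b) = c - b by ring.
move: h1 h2; rewrite E1 E2 [normc (b - c)]normcB [normc (c - a)]normcB => h1 h2.
by rewrite ler_norml; apply/andP; split; lra.
Qed.

Lemma normc_sub3_sqr (a b c : R[i]) :
  normc (a - b) ^+ 2 <= 2 * (normc (a - c) ^+ 2 + normc (b - c) ^+ 2).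
Proof. by rewrite -[a - b](_ : (a - c) - (b - c) = _) ?normc_sub_sqr//; ring. Qed.

Variables (f : Rd -> R[i]) (C : R) (e_ : nat -> R).
Hypothesis mf : cmeas f.
Hypothesis sf : sqint f.
Hypothesis fC : forall x, normc (f x) <= C.
Hypothesis e01 : forall k, 0 < e_ k <= 1.
Hypothesis ef : forall k, \int[mu]_x (normc (gauss_reg f (e_ k) x - f x) ^+ 2) <= 4^-1 ^+ k.

Let fe k := gauss_reg f (e_ k).
Let g_ k := ft 1 (fe k).

Let e0 k : 0 <= e_ k. Proof. by have /andP[/ltW] := e01 k. Qed.
Let cfe k : cint mu (fe k). Proof. exact: cint_gauss_reg mf fC _ (e01 k). Qed.
Let sfe k : sqint (fe k). Proof. exact: sqint_gauss_reg. Qed.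
Let mg k : cmeas (g_ k). Proof. exact: cmeas_ft. Qed.

Let fe_close k n : (k <= n)%N ->
  (\int[mu]_x (normc (fe n x - fe k x) ^+ 2)%:E <= (4 * 4^-1 ^+ k)%:E)%E.
Proof.
move=> kn; have s1 := sqintB (cfe n).1 mf (sfe n) sf; have s2 := sqintB (cfe k).1 mf (sfe k) sf.
have I := rintZ 2 (rintD s1 s2).
apply: (@le_trans _ _ (\int[mu]_x (2 * (normc (fe n x - f x) ^+ 2 + normc (fe k x - f x) ^+ 2))%:E)%E).
  by apply: ge0_mono_integral => x; rewrite lee_fin ?sqr_ge0//; exact: normc_sub3_sqr.
rewrite -(rint_fineK I) lee_fin (RintegralZl _ measurableT (rintD s1 s2)) (RintegralD measurableT s1 s2).
have h : 4^-1 ^+ n <= 4^-1 ^+ k :> R.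
  by apply: ler_wiXn2l kn; rewrite ?invr_ge0// invf_le1// ler1n.
have := ef n; have := ef k; rewrite -/(fe n) -/(fe k).
by move: (_ ^+ n) (_ ^+ k) h (\int[mu]_x _) (\int[mu]_x _) => p q h a b; lra.
Qed.

Let g_close k n : (k <= n)%N ->
  (\int[mu]_y (normc (g_ n y - g_ k y) ^+ 2)%:E <= (4 * 4^-1 ^+ k)%:E)%E.
Proof.
move=> kn; apply: le_trans (fe_close kn).
have -> : (fun y => (normc (g_ n y - g_ k y) ^+ 2)%:E) =
          (fun y => (normc (ft 1 (fun x => fe n x - fe k x) y) ^+ 2)%:E).
  by apply/funext => y; rewrite /g_ ftB.
by apply: plancherel_le; [exact: cintB|rewrite expr1n].
Qed.

(** The function g is the L^2 limit of the transforms of the regularizations. Parseval's formula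
    holds for each of these against phi, and both sides pass to the limit; the result says that f is
    the Fourier transform of g as a distribution. *)
Lemma inverse_transform : exists g, [/\ cmeas g, sqint g,
  forall k, \int[mu]_y (normc (ft 1 (gauss_reg f (e_ k)) y - g y) ^+ 2) <= 4 * 4^-1 ^+ k &
  forall phi, schwartz phi -> cI mu (fun x => f x * phi x) = cI mu (fun y => g y * ft (-1) phi y)].
Proof.
have [|g mg' Hg] := @riesz_fischer _ Rd R mu g_ 4 _ mg (fun k => g_close (leqnSn k)); first by [].
(* Fatou's lemma in n, with k fixed, carries the Cauchy estimate over to the almost everywhere
   limit. *)
have close k : (\int[mu]_y (normc (g_ k y - g y) ^+ 2)%:E <= (4 * 4^-1 ^+ k)%:E)%E.
  apply: (fatou_ae_le (f_ := fun n y => normc (g_ n y - g_ k y) ^+ 2)).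
  - by move=> n; apply: measurable_funX; apply: measurable_normc; exact: cmeasB.
  - by move=> n y; rewrite sqr_ge0.
  - by move=> y; rewrite sqr_ge0.
  - apply: filterS Hg => y Hy.
    have L : normc (g_ n y - g_ k y) @[n --> \oo] --> normc (g_ k y - g y).
      apply/(@cvgrPdist_lt _ _ _ \oo _ _ _) => e ep.
      have [M _ HM] := (@cvgrPdist_lt _ _ _ \oo _ _ _).1 Hy _ ep; exists M => // n Mn; have := HM n Mn.
      rewrite sub0r normrN ger0_norm ?normc_ge0// => h; apply: le_lt_trans h.
      exact: normc_dist_le.
    have L2 := @cvgM _ _ \oo _ _ _ _ _ L L; exact: L2.
  - by exists k => // n /= kn; exact: g_close.
have sg_ k : sqint (g_ k) by apply: sqint_ft; rewrite ?expr1n.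
have sd k : sqint (fun y => g_ k y - g y).
  apply/rintP; first by move=> x; rewrite sqr_ge0.
  split; first by apply: measurable_funX; apply: measurable_normc; exact: cmeasB.
  by apply: le_lt_trans (close k) _; rewrite ltry.
(* By writing g as g_0 - (g_0 - g). *)
have sg : sqint g.
  have := sqintB (mg 0) (cmeasB (mg 0) mg') (sg_ 0) (sd 0).
  by congr (rint _ _); apply/funext => y; rewrite opprB addrC subrK.
have closeR k : \int[mu]_y (normc (g_ k y - g y) ^+ 2) <= 4 * 4^-1 ^+ k.
  by rewrite -lee_fin (rint_fineK (sd k)); exact: close.
exists g; split => // phi sp.
have cp := schwartz_cint sp; have sqp := schwartz_sqint sp; have [K K0 pK] := schwartz_bounded sp.
have m1 : (- 1) ^+ 2 = 1 :> R by rewrite sqrrN expr1n.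
have P k : cI mu (fun y => g_ k y * ft (-1) phi y) = cI mu (fun x => fe k x * phi x).
  apply: parseval pK _ _ => //; last by rewrite expr1n.
  by move=> x; apply: continuous_normc_cvg; exact: (smooth_continuous sp.1).
have L1 := sqint_pair_cvg mg mg' (cmeas_ft (-1) cp) sg_ sg (sqint_ft cp sqp m1) closeR.
have ef1 k : \int[mu]_x (normc (fe k x - f x) ^+ 2) <= 1 * 4^-1 ^+ k by rewrite mul1r; exact: ef.
have L2 := sqint_pair_cvg (fun k => (cfe k).1) mf cp.1 sfe sf sqp ef1.
apply: (@normc_cvg_unique _ (fun k => cI mu (fun x => fe k x * phi x))); first exact: L2.
by under eq_fun do rewrite -P; exact: L1.
Qed.

End inverse_transform.

Section entire_to_fourier.
Variables (R : realType) (d : nat).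
Local Notation Rd := 'rV[R]_d.
Local Notation Cd := 'rV[R[i]]_d.
Local Notation mu := (lebesgue_rV R d).
Variables (F : Cd -> R[i]) (A : set Rd) (C : R).
Hypothesis A0 : A !=set0.
Hypothesis cA : compact A.
Hypothesis eF : entire F.
Hypothesis C0 : 0 < C.
Hypothesis FC : forall z : Cd,
  normc (F z) <= C * expR (supporting_function A (map_mx (@complex.Im R) z)).

Let f0 (x : Rd) := F (zc x 0).

Lemma entire_real_le x : normc (f0 x) <= C.
Proof.
apply: le_trans (FC _) _; rewrite zc_Im ler_piMr ?(ltW C0)// -[leRHS]expR0 ler_expR.
exact: supporting0.
Qed.

Lemma ft_gauss_reg_decay e del (y u : Rd) : 0 < e <= 1 -> 0 < del ->
  supporting_function A u + del <= dotr y u ->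
  normc (ft 1 (gauss_reg f0 e) y) <= ft_cst R d * (C * \int[mu]_x weight x *
    ((e^-1) ^+ d * expR (- (del ^+ 2 / (4 * (dotr u u + 1)) / e)))).
Proof.
move=> e01 del0 H; rewrite normcM normc_real gtr0_norm ?ft_cst_gt0// ler_pM2l ?ft_cst_gt0//.
rewrite (_ : cI mu _ = cI mu (fun xi => F (zc xi 0) * cexp (gz e y (zc xi 0)))).
  exact: (gauss_decay A0 cA eF C0 FC e01 del0 H).
apply: eq_cI => x; rewrite /gauss_reg /f0 -mulrA; congr (_ * _).
have z0 (v : Rd) : dotr v 0 = 0 by rewrite /dotr big1// => i _; rewrite mxE mulr0.
by rewrite /cexp Re_gz Im_gz mul1r !z0 mulr0 subr0 addr0.
Qed.

Variables (g : Rd -> R[i]) (e_ : nat -> R).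
Hypothesis cvA : convex_set (A : set (convex_lmodType Rd)).
Hypothesis mg : cmeas g.
Hypothesis sg : sqint g.
Hypothesis sf0 : sqint f0.
Hypothesis e01 : forall k, 0 < e_ k <= 1.
Hypothesis eN : forall k, k.+1%:R <= (e_ k)^-1.
Hypothesis closeg : forall k, \int[mu]_y (normc (ft 1 (gauss_reg f0 (e_ k)) y - g y) ^+ 2) <= 4 * 4^-1 ^+ k.

(** The regularized transforms tend to 0 uniformly on a half space containing x, while their
    pairings with test functions there converge to those of g. *)
Lemma inverse_transform_support : distr_support (distr_of g) `<=` A.
Proof.
move=> x xs; apply: contra_notP xs => nAx.
have [u [del del0 Hu]] := convex_separation A0 cA cvA nAx.
set H := supporting_function A u in Hu *.
exists [set y | H + del < dotr y u] => //=; split.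
  rewrite (_ : [set y | _] = (fun y => dotr y u) @^-1` [set t | H + del < t]) //.
  by apply: open_comp; [move=> y _; exact: dotr_continuous|exact: open_gt].
move=> phi tphi; have sp := test_schwartz tphi; have cp := schwartz_cint sp; have sqp := schwartz_sqint sp.
have phiU y : phi y != 0 -> H + del <= dotr y u.
  by case: tphi => _ _ KU nz; apply: ltW; apply: KU; apply: subset_closure.
pose W := \int[mu]_x weight x; pose kap := del ^+ 2 / (4 * (dotr u u + 1)).
have kap0 : 0 < kap.
  by rewrite divr_gt0 ?exprn_gt0// mulr_gt0// ltr_wpDl// dotr_ge0.
have W0 : 0 <= W by apply: Rintegral_ge0 => y _; exact/ltW/weight_gt0.
pose P := \int[mu]_x normc (phi x).
have P0 : 0 <= P by apply: Rintegral_ge0 => y _; exact: normc_ge0.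
(* Of the decay e^-d exp(- kap / e) only the rate 1/(k + 1) is kept, by [expR_power_decay] with m =
   1 / e_k. *)
pose B := ft_cst R d * (C * W * ((d.+1%:R / kap) ^+ d.+1)) * P.
pose gk k := ft 1 (gauss_reg f0 (e_ k)).
have mf0 : cmeas f0 by exact: cmeas_entire.
have cfk k : cint mu (gauss_reg f0 (e_ k)) by exact: cint_gauss_reg mf0 entire_real_le _ (e01 k).
have mgk k : cmeas (gk k) by exact: cmeas_ft.
have sgk k : sqint (gk k).
  apply: sqint_ft => //; last by rewrite expr1n.
  by apply: sqint_gauss_reg => //; have /andP[/ltW] := e01 k.
have le k : normc (cI mu (fun y => gk k y * phi y)) <= B * k.+1%:R^-1.
  set M := ft_cst R d * (C * W * ((d.+1%:R / kap) ^+ d.+1 * k.+1%:R^-1)).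
  have M0 : 0 <= M.
    by rewrite !mulr_ge0 ?(ltW (ft_cst_gt0 R d)) ?(ltW C0)// exprn_ge0// divr_ge0// ltW.
  have hM y : normc (gk k y * phi y) <= M * normc (phi y).
    rewrite normcM; have [->|nz] := eqVneq (phi y) 0; first by rewrite normc0 !mulr0.
    rewrite ler_wpM2r ?normc_ge0//.
    apply: le_trans (ft_gauss_reg_decay (e01 k) del0 (phiU y nz)) _.
    rewrite ler_wpM2l ?(ltW (ft_cst_gt0 R d))// ler_wpM2l ?mulr_ge0 ?(ltW C0)// -/kap.
    have ei : 0 < (e_ k)^-1 by rewrite invr_gt0; have /andP[] := e01 k.
    apply: le_trans (expR_power_decay d kap0 ei) _.
    have r0 : 0 <= (d.+1%:R / kap) ^+ d.+1 by rewrite exprn_ge0// mulr_ge0 ?invr_ge0 ?(ltW kap0).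
    rewrite (ler_wpM2l r0)// lef_pV2 ?posrE ?ltr0n//; exact: eN.
  have mm : cmeas (fun y => gk k y * phi y) by apply: cmeasM => //; exact: cp.1.
  apply: le_trans (normc_cI_le mm (rintZ M cp.2) hM) _.
  rewrite (RintegralZl _ measurableT cp.2) -/P /M /B le_eqVlt; apply/orP; left; apply/eqP; ring.
have L1 := sqint_pair_cvg mgk mg cp.1 sgk sg sqp closeg.
have L2 : normc (cI mu (fun y => gk k y * phi y) - 0) @[k --> \oo] --> 0.
  have LB := cvg0_mull B (@cvg_harmonic R).
  apply: (squeeze_cvgr _ (@cvg_cst _ _ _ _ _) LB).
  by apply: nearW => k; rewrite normc_ge0 subr0; exact: le.
exact: normc_cvg_unique L1 L2.
Qed.

End entire_to_fourier.

Lemma exponential_type_fourier (R : realType) (d : nat) (A : set 'rV[R]_d) (f : 'rV[R]_d -> R[i])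
    (F : 'rV[R[i]]_d -> R[i]) : A !=set0 -> compact A ->
  convex_set (A : set (convex_lmodType 'rV[R]_d)) -> L2 f -> exponential_type A F -> extends_to f F ->
  exists g : 'rV[R]_d -> R[i],
     [/\ L2 g, distr_support (distr_of g) `<=` A & is_fourier_transform f g].
Proof.
move=> A0 cA cvA [mf f2] [eF [C C0 FC]] Ff.
(* The restriction of F to R^d is a bounded Borel representative of f, and every integral is
   computed with it. *)
pose f0 (x : 'rV[R]_d) := F (zc x 0).
have mf0 : cmeas f0 by exact: cmeas_entire.
have ff0 : \forall x \ae lebesgue_rV R d, f x = f0 x.
  by apply: filterS Ff => x; rewrite /f0 zc_real => ->.
have f0C := entire_real_le A0 cA C0 FC.
have sf0 : sqint f0.
  apply/rintP; first by move=> x; rewrite sqr_ge0.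
  split; first by apply: measurable_funX; exact: measurable_normc.
  by rewrite -(ae_normc2 mf0 ff0); exact: f2.
have [e_ [e01 eN ef]] := gauss_reg_seq mf0 sf0.
have [g [mg sg closeg gP]] := inverse_transform mf0 sf0 f0C e01 ef.
exists g; split.
- split; first by case: (mg) => m1 m2; exists g; split => //; apply: nearW.
  by have := (rintP (lebesgue_rV R d) (fun x => sqr_ge0 (normc (g x)))).1 sg => -[].
- exact: (inverse_transform_support A0 cA eF C0 FC cvA mg sg sf0 e01 eN closeg).
- exists (distr_of f); split.
  + exact: (ae_bounded_tempered mf0 f0C ff0).
  + by split => //; exact: (ae_bounded_locally_integrable mf0 f0C ff0).
  + move=> phi sp; apply: (eq_trans (distr_of_ae mf0 (schwartz_cmeas sp) ff0)).
    by apply: (eq_trans (gP phi sp)); rewrite /distr_fourier fourierE.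
Qed.

(** * Test functions and the du Bois-Reymond lemma *)

Section flat_functions.
Variable R : realType.
Implicit Types (p : {poly R}) (x : R).

(** The polynomial factor makes the family stable under differentiation, so that the smoothness of
    exp(- 1/x), extended by 0, follows by iterating a single derivative formula. *)
Definition flat p x : R := if 0 < x then p.[x^-1] * expR (- x^-1) else 0.

(* With t = 1/x, the derivative of p(t) exp(-t) is t^2 (p - p')(t) exp(-t). *)
Definition flat_deriv p : {poly R} := 'X^2 * (p - p^`()).

(** Quadratic vanishing at 0 is what gives derivative 0 there. With t = 1/x, [expR_power_decay]
    applied to the power i + 1 bounds t^i exp(- t) by (i + 2)^(i + 2) / t^2. *)
Lemma flat_le_sqr p : exists2 K, 0 <= K & forall x, `|flat p x| <= K * x ^+ 2.
Proof.
exists (\sum_(i < size p) `|p`_i| * (i.+2%:R) ^+ i.+2).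
  by apply: sumr_ge0 => i _; rewrite mulr_ge0// exprn_ge0.
move=> x; rewrite /flat; case: ifPn => [x0|_]; last first.
  by rewrite normr0 mulr_ge0 ?sqr_ge0//; apply: sumr_ge0 => i _; rewrite mulr_ge0// exprn_ge0.
have t0 : 0 < x^-1 by rewrite invr_gt0.
rewrite normrM (ger0_norm (expR_ge0 _)) horner_coef mulr_suml.
apply: (@le_trans _ _ ((\sum_(i < size p) `|p`_i * x^-1 ^+ i|) * expR (- x^-1))).
  by rewrite ler_wpM2r ?expR_ge0// ler_norm_sum.
rewrite mulr_suml; apply: ler_sum => i _; rewrite normrM -!mulrA ler_wpM2l//.
rewrite ger0_norm ?exprn_ge0 ?(ltW t0)//.
have := @expR_power_decay R 1 i.+1 x^-1 ltr01 t0; rewrite mul1r divr1 invrK exprSr.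
rewrite -mulrA mulrCA mulrC -ler_pdivlMr// -mulrA invrK => /le_trans -> //.
by rewrite -mulrA expr2.
Qed.

Lemma is_derive_flat p x : is_derive x (1 : R) (flat p) (flat (flat_deriv p) x).
Proof.
have [x0|x0|x0] := ltgtP x 0.
- have -> : flat (flat_deriv p) x = 0 by rewrite /flat ltNge (ltW x0).
  apply: (near_eq_is_derive (f := cst 0)).
  by near=> y; rewrite /flat ltNge ltW//; near: y; exact: lt_nbhsl.
- have xn0 : x != 0 by rewrite gt_eqF.
  have dV : is_derive x (1 : R) (fun y => y^-1) (- x ^- 2).
    by have := @is_deriveV R id x 1 1 xn0 (is_derive_id x 1); rewrite scaler1.
  have d1 : is_derive x (1 : R) (horner p \o (fun y => y^-1)) (p^`().[x^-1] * (- x ^- 2)).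
    exact: is_derive1_comp.
  have d2 : is_derive x (1 : R) (expR \o (fun y => - y^-1)) (expR (- x^-1) * - (- x ^- 2)).
    by apply: is_derive1_comp; exact: is_deriveN.
  have D := is_deriveM d1 d2.
  have -> : flat (flat_deriv p) x = (horner p \o (fun y => y^-1)) x *: (expR (- x^-1) * - (- x ^- 2)) +
      (expR \o (fun y => - y^-1)) x *: (p^`().[x^-1] * (- x ^- 2)).
    by rewrite /flat x0 /flat_deriv !hornerE /GRing.scale /= exprVn; ring.
  refine (near_eq_is_derive _ D).
  by near=> y; rewrite /flat ifT//; near: y; exact: lt_nbhsr.
- subst x; have -> : flat (flat_deriv p) 0 = 0 by rewrite /flat ltxx.
  have F0 : flat p 0 = 0 by rewrite /flat ltxx.
  have [K K0 HK] := flat_le_sqr p.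
  suff L : (fun h => h^-1 *: ((flat p \o shift 0) (h *: 1) - flat p 0)) @ 0^' --> (0 : R).
    by apply: DeriveDef; [apply/cvg_ex; exists 0; exact: L|exact: cvg_lim L].
  apply/cvgrPdist_lt => e e0; near=> h.
  have h0 : h != 0 by near: h; exact: nbhs_dnbhs_neq.
  rewrite sub0r normrN /= F0 subr0 /shift addr0 /GRing.scale /= mulr1 normrM normfV.
  have hp : 0 < `|h| by rewrite normr_gt0.
  rewrite -(ltr_pM2l hp) mulrA divff ?gt_eqF// mul1r; apply: le_lt_trans (HK h) _.
  rewrite -real_normK ?num_real// expr2 mulrA mulrC ltr_pM2l//.
  have : `|h| < e / (K + 1).
    near: h; apply: dnbhs0_lt; rewrite divr_gt0// ltr_wpDl//.
  rewrite ltr_pdivlMr ?ltr_wpDl// => h1; apply: le_lt_trans h1; rewrite mulrC ler_wpM2l ?normr_ge0//.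
  by rewrite lerDl.
Unshelve. all: by end_near. Qed.

Lemma flat1_ge0 x : 0 <= flat 1 x.
Proof. by rewrite /flat; case: ifP => // _; rewrite hornerC mul1r expR_ge0. Qed.

Lemma flat1_le1 x : flat 1 x <= 1.
Proof.
rewrite /flat; case: ifP => // x0; rewrite hornerC mul1r -[leRHS]expR0 ler_expR oppr_le0.
by rewrite invr_ge0 ltW.
Qed.

Lemma flat1_gt0 x : (0 < flat 1 x) = (0 < x).
Proof. by rewrite /flat; case: ifP => //; rewrite ?ltxx// hornerC mul1r expR_gt0. Qed.

(** Under dilation [flat 1] becomes the indicator of x > 0, so that indicators of half spaces are
    bounded limits of smooth functions. *)
Lemma flat1_cvg x : flat 1 (n.+1%:R * x) @[n --> \oo] --> ((0 < x)%R%:R : R).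
Proof.
case: (ltrP 0 x) => x0 /=.
  have H : expR (- (n.+1%:R^-1 * x^-1)) @[n --> \oo] --> expR (0 : R).
    apply: continuous_cvg; first exact: continuous_expR.
    have L0 := cvgN (cvgM (@cvg_harmonic R) (cvg_cst x^-1)).
    rewrite mul0r oppr0 in L0; exact: L0.
  rewrite expR0 in H; rewrite (_ : (fun n => _) = (fun n => expR (- (n.+1%:R^-1 * x^-1)))); first exact: H.
  by apply/funext => n; rewrite /flat ifT ?mulr_gt0// hornerC mul1r invfM.
rewrite (_ : (fun n => _) = (fun n : nat => 0 : R)); first exact: cvg_cst.
by apply/funext => n; rewrite /flat ltNge mulr_ge0_le0.
Qed.

End flat_functions.

Section bump_functions.
Variables (R : realType) (d : nat).
Local Notation Rd := 'rV[R]_d.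

(* The point of this class is that it is closed under partial derivatives. *)
Inductive bump : (Rd -> R) -> Prop :=
| bump_flat p c a i : bump (fun x => flat p (c * x ord0 i + a))
| bump_cst c : bump (fun=> c)
| bumpD f g : bump f -> bump g -> bump (fun x => f x + g x)
| bumpM f g : bump f -> bump g -> bump (fun x => f x * g x).

Lemma is_derive_line (f : Rd -> R) x v df :
  is_derive (0 : R) (1 : R) (fun h : R => f (h *: v + x)) df -> is_derive x v f df.
Proof.
move=> [D1 D2]; have D3 := (derivable1P f x v).2 D1; apply: (DeriveDef D3).
rewrite -D2 /derive; set g1 := fun h => h^-1 *: _; set g2 := fun h => h^-1 *: _.
suff -> : g1 = g2 by [].
by apply/funext => h; rewrite /g1 /g2 /= addr0 scale0r add0r [_%:A]mulr1.
Qed.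

Lemma bump_derive f : bump f -> forall i, exists2 g, bump g &
  forall x, is_derive x (delta_mx ord0 i) f (g x).
Proof.
elim=> {f} [p c a j|c|f g _ IHf _ IHg|f g bf IHf bg IHg] i.
- exists (fun x => flat (flat_deriv p) (c * x ord0 j + a) * (c * (j == i)%:R)).
    by apply: bumpM; [exact: bump_flat|exact: bump_cst].
  move=> x; apply: is_derive_line.
  have -> : (fun h : R => flat p (c * (h *: delta_mx ord0 i + x) ord0 j + a)) =
            flat p \o (fun h => (c * (j == i)%:R) * h + (c * x ord0 j + a)).
    by apply/funext => h; rewrite /= !mxE eqxx /=; congr (flat p _); ring.
  pose h (t : R) := c * (j == i)%:R * t + (c * x ord0 j + a).
  have Dh : is_derive (0 : R) (1 : R) h (c * (j == i)%:R).
    have D := is_deriveD (is_deriveZ (c * (j == i)%:R) (is_derive_id (0 : R) (1 : R)))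
      (is_derive_cst (c * x ord0 j + a) (0 : R) (1 : R)).
    by move: D; rewrite addr0 /GRing.scale /= mulr1.
  have h0 : h 0 = c * x ord0 j + a by rewrite /h mulr0 add0r.
  have Df := is_derive_flat p (h 0); 
  by have := @is_derive1_comp R (flat p) h 0 _ _ Df Dh; rewrite h0.
- exists (fun=> 0); first exact: bump_cst.
  by move=> x; exact: is_derive_cst.
- have [f' bf' df] := IHf i; have [g' bg' dg] := IHg i.
  exists (fun x => f' x + g' x); first exact: bumpD.
  by move=> x; exact: is_deriveD.
- have [f' bf' df] := IHf i; have [g' bg' dg] := IHg i.
  exists (fun x => f x * g' x + g x * f' x); first by apply: bumpD; exact: bumpM.
  by move=> x; exact: is_deriveM.
Qed.

Lemma flat_continuous (p : {poly R}) : continuous (flat p).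
Proof.
move=> x; apply/differentiable_continuous/derivable1_diffP.
by have [] := is_derive_flat p x.
Qed.

Lemma bump_continuous f : bump f -> continuous f.
Proof.
elim=> {f} [p c a j|c|f g _ IHf _ IHg|f g bf IHf bg IHg] x.
- apply: (@continuous_comp _ _ _ (fun y : Rd => c * y ord0 j + a) (flat p)); last exact: flat_continuous.
  apply: (@cvgD _ _ _ (nbhs x) (nbhs_filter x)); last exact: (@cvg_cst _ _ _ (nbhs x) (nbhs_filter x)).
  apply: (@cvgM _ _ (nbhs x) (nbhs_filter x)); last exact: coord_continuous.
  exact: (@cvg_cst _ _ _ (nbhs x) (nbhs_filter x)).
- exact: cst_continuous.
- by apply: (@cvgD _ _ _ (nbhs x) (nbhs_filter x)); [exact: IHf|exact: IHg].
- by apply: (@cvgM _ _ (nbhs x) (nbhs_filter x)); [exact: IHf|exact: IHg].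
Qed.

Lemma bump_prod (I : Type) (s : seq I) (f : I -> Rd -> R) : (forall i, bump (f i)) ->
  bump (fun x => \prod_(i <- s) f i x).
Proof.
move=> bf; elim: s => [|i s IH].
  rewrite (_ : (fun _ => _) = (fun=> 1)); first exact: bump_cst.
  by apply/funext => x; rewrite big_nil.
rewrite (_ : (fun _ => _) = (fun x => f i x * \prod_(j <- s) f j x)); first exact: bumpM.
by apply/funext => x; rewrite big_cons.
Qed.

Lemma bump_pderivs s f : bump f -> exists2 g, bump g &
  pderivs s (fun x => (f x)%:C) = (fun x => (g x)%:C).
Proof.
move=> bf; elim: s => [|i s [g bg E]] /=; first by exists f.
have [g' bg' dg] := bump_derive bg i; exists g' => //; rewrite E.
apply/funext => x; rewrite /pderiv; congr (_ +i* _).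
  by have [_ <-] := dg x.
by rewrite (_ : _ \o _ = cst 0)// derive_cst.
Qed.

Lemma bump_smooth f : bump f -> smooth (fun x => (f x)%:C).
Proof.
move=> bf s; have [g bg ->] := bump_pderivs s bf; split.
  move=> x; apply: normc_cvg_continuous; have cg := bump_continuous bg.
  apply/(@cvgrPdist_lt _ _ _ (nbhs x) (nbhs_filter x)) => e e0.
  have := (@cvgrPdist_lt _ _ _ (nbhs x) (nbhs_filter x) _ _).1 (cg x) _ e0.
  apply: filterS => y h; rewrite sub0r normrN ger0_norm ?normc_ge0//.
  by rewrite -rmorphB normc_real distrC.
move=> i x; have [g' bg' dg] := bump_derive bg i; split.
  by have [] := dg x.
by rewrite (_ : _ \o _ = cst 0)//; exact: derivable_cst.
Qed.

Lemma cbox_compact (a b : Rd) : compact (cbox a b).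
Proof.
have := @rV_compact R d (fun i => `[a ord0 i, b ord0 i]%classic) (fun i => @segment_compact R _ _).
congr compact; apply/seteqP; split => x /= h i; have := h i; rewrite /= in_itv//.
Qed.

Lemma bump_test f a b (U : set Rd) : bump f -> (forall x, f x != 0 -> cbox a b x) ->
  cbox a b `<=` U -> test_function U (fun x => (f x)%:C).
Proof.
move=> bf fab abU.
have cl : closed (cbox a b) by apply: compact_closed; [exact: norm_hausdorff|exact: cbox_compact].
have sub : closure [set x | (f x)%:C != 0] `<=` cbox a b.
  rewrite closureE; apply: smallest_sub => // x /= nz; apply: fab.
  by apply: contra_neq nz => ->.
split; first exact: bump_smooth.
  by apply: subclosed_compact sub => //; [exact: closed_closure|exact: cbox_compact].
exact: subset_trans sub abU.
Qed.

(** The arguments are spelled [1 * x + - a] and [-1 * x + b] to match the shape of [bump_flat]. *)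
Definition box_bump (a b : Rd) (x : Rd) : R :=
  \prod_(i < d) (flat 1 (1 * x ord0 i + - a ord0 i) * flat 1 (-1 * x ord0 i + b ord0 i)).

Lemma bump_box a b : bump (box_bump a b).
Proof. by apply: bump_prod => i; apply: bumpM; exact: bump_flat. Qed.

Lemma box_bump_gt0 a b x : obox a b x -> 0 < box_bump a b x.
Proof.
move=> ab; apply: prodr_gt0 => i _; have /andP[h1 h2] := ab i.
by rewrite mulr_gt0// flat1_gt0; lra.
Qed.

Lemma box_bump_supp a b x : box_bump a b x != 0 -> cbox a b x.
Proof.
move=> nz i; apply: obox_cbox => j; move: nz; rewrite /box_bump (bigD1 j) //=.
rewrite !mulf_eq0 !negb_or => /andP[/andP[h1 h2] _].
have f1 (t : R) : flat 1 t != 0 -> 0 < t.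
  by rewrite -flat1_gt0 lt_neqAle eq_sym => ->; exact: flat1_ge0.
by have := f1 _ h1; have := f1 _ h2; lra.
Qed.

(** A smooth approximation of the indicator of [cut_set s]. Its support need not be compact, so it
    is used only multiplied by a [box_bump]. *)
Definition cutoff (s : seq ('I_d * R)) (n : nat) (x : Rd) : R :=
  \prod_(p <- s) flat 1 (n.+1%:R * x ord0 p.1 + n.+1%:R * - p.2).

Definition cut_set (s : seq ('I_d * R)) : set Rd := [set x | all (fun p => p.2 < x ord0 p.1) s].

Lemma bump_cutoff s n : bump (cutoff s n).
Proof. by apply: bump_prod => p; exact: bump_flat. Qed.

Lemma cutoff_ge0 s n x : 0 <= cutoff s n x.
Proof. by apply: prodr_ge0 => p _; exact: flat1_ge0. Qed.

Lemma cutoff_le1 s n x : cutoff s n x <= 1.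
Proof. by apply: prodr_ile1 => p _; rewrite flat1_ge0 flat1_le1. Qed.

Lemma cutoff_cvg s x : cutoff s n x @[n --> \oo] --> (\1_(cut_set s) x : R).
Proof.
rewrite indicE (_ : (x \in cut_set s) = all (fun p => p.2 < x ord0 p.1) s); last first.
  by apply/idP/idP => [/set_mem|/mem_set].
rewrite /cutoff; elim: s => [|p s IH] /=.
  by under eq_fun do rewrite big_nil; exact: cvg_cst.
under eq_fun do rewrite big_cons -mulrDr.
rewrite -mulnb natrM -[p.2 < _]subr_gt0; apply: cvgM; last exact: IH.
exact: flat1_cvg.
Qed.

End bump_functions.

(** * Vanishing almost everywhere from vanishing integrals *)

Section du_bois_reymond.
Variables (R : realType) (d : nat).
Local Notation Rd := 'rV[R]_d.
Local Notation mu := (lebesgue_rV R d).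

Let cut_sets : set (set Rd) := [set S | exists s, S = cut_set s].

Lemma cut_set_measurable s : measurable (cut_set s : set Rd).
Proof.
elim: s => [|p s IH]; first by rewrite (_ : cut_set _ = setT)//; apply/seteqP; split.
rewrite (_ : cut_set _ = (fun x : Rd => x ord0 p.1) @^-1` `]p.2, +oo[ `&` cut_set s); last first.
  by apply/seteqP; split => x /=; rewrite in_itv /= andbT => /andP.
apply: measurableI => //; rewrite -[X in measurable X]setTI; apply: measurable_coord => //.
Qed.

Lemma cut_sets_generate : @measurable _ Rd = <<s cut_sets >>.
Proof.
apply/seteqP; split; last first.
  apply: smallest_sub; first exact: sigma_algebra_measurable.
  by move=> _ [s ->]; exact: cut_set_measurable.
apply: smallest_sub; first exact: smallest_sigma_algebra.
move=> S; rewrite -bigcup_seq /= => -[i _ [B mB <-]].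
have mf : measurable_fun [set: g_sigma_algebraType cut_sets]
    (fun x : g_sigma_algebraType cut_sets => (x : Rd) ord0 i).
  apply: (measurability _ (RGenOInfty.measurableE R)) => _ [_ [t ->] <-].
  rewrite setTI; apply: sub_sigma_algebra; exists [:: (i, t)].
  by apply/seteqP; split => x; rewrite /cut_set /= in_itv /= ?andbT.
exact: (mf measurableT B mB).
Qed.

Lemma cut_sets_setI : setI_closed cut_sets.
Proof.
move=> _ _ [s ->] [t ->]; exists (s ++ t).
by apply/seteqP; split => x; rewrite /cut_set /= all_cat => /andP.
Qed.

Variable (k : Rd -> R[i]).
Hypothesis ck : cint mu k.
Hypothesis k0 : forall s, cI mu (fun x => k x * (\1_(cut_set s) x)%:C) = 0.

Lemma normc_indic (S : set Rd) x : normc ((\1_S x)%:C : R[i]) <= 1.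
Proof. by rewrite normc_real indicE; case: (x \in S); rewrite ?normr0// normr1. Qed.

Lemma cint_indic (S : set Rd) : measurable S -> cint mu (fun x => k x * (\1_S x)%:C).
Proof.
move=> mS; apply: (cintMb (C := 1) ck); last exact: normc_indic.
by apply: cmeas_real; exact: measurable_indic.
Qed.

(** Dynkin's theorem: the cut sets are stable under intersection and generate the Borel sets. The
    empty list gives the whole space, which handles complements, and partial sums of disjoint
    indicators are dominated by |k|. *)
Lemma cI_indic_eq0 S : measurable S -> cI mu (fun x => k x * (\1_S x)%:C) = 0.
Proof.
rewrite cut_sets_generate; move: S.
apply: (dynkin_induction (P := fun S => cI mu (fun x => k x * (\1_S x)%:C) = 0) cut_sets_generate cut_sets_setI).
- by rewrite -(k0 [::]); congr (cI mu _); apply/funext => x; rewrite !indicE; congr (_ * (_ %:R)%:C);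
    apply: congr1; apply/idP/idP => _; apply: mem_set.
- by move=> _ [s ->]; exact: k0.
- move=> S mS S0.
  have -> : (fun x => k x * (\1_(~` S) x)%:C) =
      (fun x => k x * (\1_(cut_set [::]) x)%:C - k x * (\1_S x)%:C).
    apply/funext => x; rewrite -mulrBr -rmorphB; congr (_ * _%:C); rewrite !indicE.
    rewrite in_setC (_ : (x \in cut_set [::]) = true); last exact: mem_set.
    by case: (x \in S); rewrite /= ?subrr ?subr0.
  have c1 := cint_indic (cut_set_measurable [::]); have c2 := cint_indic mS.
  by rewrite (cIB c1 c2) k0 S0 subrr.
- move=> F mF tF F0.
  pose f_ n x := k x * (\sum_(i < n) \1_(F i) x)%:C.
  have f0 n : cint mu (f_ n) /\ cI mu (f_ n) = 0.
    elim: n => [|n [c I]].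
      have -> : f_ 0%N = fun x => 0 * k x by apply/funext => x; rewrite /f_ big_ord0 mulr0 mul0r.
      by split; [exact: cintMl|rewrite cIMl// mul0r].
    have -> : f_ n.+1 = fun x => f_ n x + k x * (\1_(F n) x)%:C.
      by apply/funext => x; rewrite /f_ big_ord_recr /= -mulrDr -rmorphD.
    have c2 := cint_indic (mF n).
    by split; [exact: cintD|rewrite cID// I F0 addr0].
  have val n x m : F m x -> \sum_(i < n) \1_(F i) x = ((m < n)%N%:R : R).
    move=> Fm; have h i : \1_(F i) x = ((i == m)%:R : R).
      rewrite indicE; congr (_%:R); have [->|im] := eqVneq i m; first by rewrite mem_set.
      by rewrite memNset// => Fi; move/trivIsetP: tF => /(_ i m I I im) /seteqP[/(_ x)] /(_ (conj Fi Fm)).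
    under eq_bigr do rewrite h; case: ltnP => mn.
      rewrite (bigD1 (Ordinal mn)) //= eqxx big1 ?addr0// => i.
      by rewrite -val_eqE /= => /negbTE ->.
    by rewrite big1// => i _; rewrite ltn_eqF// (leq_trans (ltn_ord i)).
  have val0 n x : ~ (\bigcup_i F i) x -> \sum_(i < n) \1_(F i) x = (0 : R).
    by move=> nF; rewrite big1// => i _; rewrite indicE memNset// => Fi; apply: nF; exists i.
  have bd n x : normc (f_ n x) <= normc (k x).
    rewrite normcM ler_piMr ?normc_ge0// normc_real.
    have [[m _ Fm]|nF] := pselect ((\bigcup_i F i) x).
      by rewrite (val _ _ _ Fm); case: (m < n)%N; rewrite ?normr0// normr1.
    by rewrite val0// normr0.
  have lim x : normc (f_ n x - k x * (\1_(\bigcup_i F i) x)%:C) @[n --> \oo] --> 0.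
    have [[m _ Fm]|nF] := pselect ((\bigcup_i F i) x); last first.
      under eq_fun do rewrite /f_ val0// indicE memNset//= subrr normc0.
      exact: cvg_cst.
    apply/(@cvgrPdist_lt _ _ _ \oo _ _ _) => e e0; exists m.+1 => // n mn.
    rewrite /f_ (val _ _ _ Fm) mn indicE mem_set; last by exists m.
    by rewrite subrr normc0 subrr normr0.
  have mU : measurable (\bigcup_i F i) by exact: bigcup_measurable.
  have [_ L] := cI_dct (fun n => (f0 n).1.1) (cint_indic mU).1 ck.2 bd lim.
  symmetry; apply: (normc_cvg_unique (u := fun n => cI mu (f_ n))); last exact: L.
  by under eq_fun do rewrite (f0 _).2 subrr normc0; exact: cvg_cst.
Qed.

Lemma rint_ae_eq0 (h : Rd -> R) :
  (forall S, measurable S -> rint mu (fun x => h x * \1_S x) /\ \int[mu]_x (h x * \1_S x) = 0) ->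
  \forall x \ae mu, h x = 0.
Proof.
move=> hS; have rh : rint mu h.
  have [+ _] := hS setT measurableT; congr (rint _ _); apply/funext => x.
  by rewrite indicT mulr1.
have := @integral_ae_eq _ _ _ mu setT measurableT (cst 0%E) (EFin \o h) rh.
move=> /(_ (measurable_cst _)) H.
have : ae_eq mu setT (EFin \o h) (cst 0%E).
  apply: H => E _ mE; have [rE E0] := hS E mE.
  rewrite integral0 integral_mkcond.
  rewrite (_ : _ \_ E = (fun x => (h x * \1_E x)%:E)); first by rewrite -(rint_fineK rE) E0.
  apply/funext => x; rewrite patchE indicE; case: ifPn => xE; first by rewrite mulr1.
  by rewrite mulr0.
by apply: filterS => x /(_ I) [].
Qed.

Lemma cut_ae_eq0 : \forall x \ae mu, k x = 0.
Proof.
have A1 : \forall x \ae mu, complex.Re (k x) = 0.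
  apply: rint_ae_eq0 => S mS; have c := cint_indic mS; have := cI_indic_eq0 mS.
  have E : (fun x => complex.Re (k x * (\1_S x)%:C)) = (fun x => complex.Re (k x) * \1_S x).
    by apply/funext => x; rewrite ReImE /= mulr0 subr0.
  by move=> /(congr1 (@complex.Re R)) /=; rewrite -E => ->; split => //; exact: cint_Re c.
have A2 : \forall x \ae mu, complex.Im (k x) = 0.
  apply: rint_ae_eq0 => S mS; have c := cint_indic mS; have := cI_indic_eq0 mS.
  have E : (fun x => complex.Im (k x * (\1_S x)%:C)) = (fun x => complex.Im (k x) * \1_S x).
    by apply/funext => x; rewrite ReImE /= mulr0 add0r.
  by move=> /(congr1 (@complex.Im R)) /=; rewrite -E => ->; split => //; exact: cint_Im c.
by apply: filterS2 A1 A2 => x h1 h2; exact: complexP.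
Qed.

End du_bois_reymond.

Section test_vanishing.
Variables (R : realType) (d : nat).
Local Notation Rd := 'rV[R]_d.
Local Notation mu := (lebesgue_rV R d).
Variable h : Rd -> R[i].

(** Integrability is part of the definition because the real-valued integral takes the default value
    0 when the extended one is infinite. *)
Definition kills_tests (U : set Rd) := forall phi, test_function U phi ->
  cint mu (fun x => h x * phi x) /\ cI mu (fun x => h x * phi x) = 0.

(** The product [k] of [h] with the box bump is integrable, and its integral over each cut set is a
    limit of integrals of [h] against bump times cutoff, hence 0. So k = 0 almost everywhere, and
    the bump is positive inside the box. *)
Lemma kills_tests_box a b U : cbox a b `<=` U -> kills_tests U ->
  \forall x \ae mu, obox a b x -> h x = 0.
Proof.
move=> abU kU.
pose k x := h x * (box_bump a b x)%:C.
have ck : cint mu k.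
  by have [] := kU _ (bump_test (bump_box a b) (@box_bump_supp R d a b) abU).
have k0 s : cI mu (fun x => k x * (\1_(cut_set s) x)%:C) = 0.
  pose f_ n x := k x * (cutoff s n x)%:C.
  have t n : test_function U (fun x => (box_bump a b x * cutoff s n x)%:C).
    apply: (bump_test _ _ abU); first by apply: bumpM; [exact: bump_box|exact: bump_cutoff].
    by move=> x; rewrite mulf_eq0 negb_or => /andP[/box_bump_supp].
  have E n : f_ n = (fun x => h x * (box_bump a b x * cutoff s n x)%:C).
    by apply/funext => x; rewrite /f_ /k -mulrA -rmorphM.
  have f0 n : cint mu (f_ n) /\ cI mu (f_ n) = 0 by rewrite E; exact: kU (t n).
  have bd n x : normc (f_ n x) <= normc (k x).
    by rewrite normcM ler_piMr ?normc_ge0// normc_real ger0_norm ?cutoff_ge0// cutoff_le1.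
  have lim x : normc (f_ n x - k x * (\1_(cut_set s) x)%:C) @[n --> \oo] --> 0.
    have L := cvg0_mull (normc (k x)) (cvg_dist0 (cutoff_cvg (s := s) (x := x))).
    rewrite (_ : (fun n => _) = (fun n => normc (k x) * `|cutoff s n x - \1_(cut_set s) x|)); first exact: L.
    by apply/funext => n; rewrite /f_ -mulrBr -rmorphB normcM normc_real.
  have mc := (cint_indic ck (cut_set_measurable s)).1.
  have [_ L] := cI_dct (fun n => (f0 n).1.1) mc ck.2 bd lim.
  symmetry; apply: (normc_cvg_unique (u := fun n => cI mu (f_ n))); last exact: L.
  by under eq_fun do rewrite (f0 _).2 subrr normc0; exact: cvg_cst.
have := cut_ae_eq0 ck k0; apply: filterS => x kx ox.
have := box_bump_gt0 ox; move: kx => /eqP; rewrite /k mulf_eq0 => /orP[/eqP//|/eqP[->]].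
by rewrite ltxx.
Qed.

(** The good neighbourhoods may be uncountably many; the rational boxes inside them, enumerated by
    [unpickle], are countable, so the exceptional sets form a null set. *)
Lemma kills_tests_ae (V : set Rd) :
  (forall x, V x -> exists U, [/\ open U, U x & kills_tests U]) ->
  \forall x \ae mu, V x -> h x = 0.
Proof.
move=> VU.
have H (n : nat) : \forall x \ae mu, forall (q : 'rV[rat]_d) (l : nat), unpickle n = Some (q, l) ->
    (exists2 U, cbox (rat_lo R q l) (rat_hi R q l) `<=` U & kills_tests U) ->
    obox (rat_lo R q l) (rat_hi R q l) x -> h x = 0.
  case E : (unpickle n) => [[q l]|]; last by apply: nearW.
  have [[U bU kU]|nU] := pselect (exists2 U, cbox (rat_lo R q l) (rat_hi R q l) `<=` U & kills_tests U).
    by have := kills_tests_box bU kU; apply: filterS => x hx q' l' [<- <-].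
  by apply: nearW => x q' l' [<- <-] /nU.
have := ae_foralln H; apply: filterS => x hx Vx.
have [U [oU Ux kU]] := VU x Vx; have [q [l [ox bU]]] := open_rat_box oU Ux.
by apply: (hx (pickle (q, l)) q l) => //; [exact: pickleK|exists U].
Qed.

End test_vanishing.

(** * From the support to exponential type *)

Section complex_functional.
Variables (R : realType) (d : nat).
Local Notation Cd := 'rV[R[i]]_d.

(** The candidate for a differential on C^d; it is registered as a linear map below in order to be
    passed to [diff_unique]. *)
Definition coord_comb (c : 'I_d -> R[i]) (h : Cd) : R[i] := \sum_(j < d) h ord0 j * c j.

Lemma coord_comb_linear c : linear_for *%R (coord_comb c).
Proof.
move=> a u v; rewrite /coord_comb mulr_sumr -big_split; apply: eq_bigr => j _ /=.
by rewrite !mxE mulrDl mulrA.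
Qed.

HB.instance Definition _ c := GRing.isLinear.Build R[i] Cd R[i] *%R (coord_comb c) (coord_comb_linear c).

Lemma normc_coord_le (h : Cd) j : normc (h ord0 j) <= complex.Re `|h|.
Proof.
have : `|h ord0 j| <= `|h|.
  rewrite (_ : `|h| = mx_norm h) // mx_normE.
  have H : (`|h ord0 j|%:nng <= \big[Num.max/0%:nng]_ij `|h ij.1 ij.2|%:nng)%R.
    by apply/bigmax_geP; right => /=; exists (ord0, j).
  by move: H; rewrite -num_le.
by rewrite normc_normE lecE /= => /andP[].
Qed.

Lemma coord_comb_continuous c : continuous (coord_comb c).
Proof.
rewrite /coord_comb; elim: (index_enum _) => [|i s ih] a.
  rewrite (_ : (fun _ => _) = cst 0); first exact: cst_continuous.
  by apply/funext => b; rewrite big_nil.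
rewrite (_ : (fun _ => _) = (fun h : Cd => h ord0 i * c i + \sum_(j <- s) h ord0 j * c j)).
  apply: (@cvgD _ _ _ (nbhs a) (nbhs_filter a)); last exact: ih.
  apply: (@cvgM _ _ (nbhs a) (nbhs_filter a)); first exact: coord_continuous.
  exact: (@cvg_cst _ _ _ (nbhs a) (nbhs_filter a)).
by apply/funext => b; rewrite big_cons.
Qed.

Lemma differentiable_of_remainder (F : Cd -> R[i]) (z : Cd) (c : 'I_d -> R[i]) (K r : R) :
  0 < r -> 0 <= K ->
  (forall h : Cd, complex.Re `|h| <= r -> normc (F (h + z) - F z - coord_comb c h) <= K * complex.Re `|h| ^+ 2) ->
  differentiable F z.
Proof.
move=> r0 K0 H; have cc := @coord_comb_continuous c.
have DU := @diff_unique _ _ _ F (coord_comb c) z cc.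
(* [E] is the premise of [diff_unique], namely the little-o expansion of F at z. *)
lazymatch type of DU with ?A -> _ => have E : A end.
  apply/eqaddoP => e /gt0_complex[s s0 ->].
  pose rho := Num.min r (s / (K + 1)).
  have K1 : 0 < K + 1 by rewrite ltr_wpDl.
  have rho0 : 0 < rho by rewrite lt_min r0 divr_gt0.
  apply/nbhs_ballP; exists rho%:C; first by rewrite /= ltcR.
  move=> h; rewrite -ball_normE /= sub0r normrN => hr.
  have hE : `|h| = (complex.Re `|h|)%:C.
    have : 0 <= `|h| by [].
    by case: (`|h|) => u v; rewrite lecE /= => /andP[/eqP -> _].
  have N0 : 0 <= complex.Re `|h|.
    have : 0 <= `|h| by [].
    by rewrite lecE /= => /andP[].
  move: hr; rewrite hE ltcR lt_min => /andP[h1 h2].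
  rewrite normc_normE -rmorphM lecR.
  rewrite (_ : (_ - _) h = F (h + z) - F z - coord_comb c h); last by rewrite opprD addrA.
  apply: le_trans (H h (ltW h1)) _ => //.
  rewrite expr2 mulrA ler_wpM2r//.
  move: h2; rewrite ltr_pdivlMr// => h2.
  by apply: le_trans (ltW h2); rewrite mulrC ler_wpM2l// lerDl.
by apply/diff_locallyP; rewrite (DU E).
Qed.

End complex_functional.

(** * The Fourier-Laplace transform *)

Section fourier_laplace.
Variables (R : realType) (d : nat).
Local Notation Rd := 'rV[R]_d.
Local Notation Cd := 'rV[R[i]]_d.
Local Notation mu := (lebesgue_rV R d).

Lemma cI_sum (I : Type) (s : seq I) (f : I -> Rd -> R[i]) : (forall j, cint mu (f j)) ->
  cI mu (fun x => \sum_(j <- s) f j x) = \sum_(j <- s) cI mu (f j).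
Proof.
move=> cf; suff [] : cint mu (fun x => \sum_(j <- s) f j x) /\
  cI mu (fun x => \sum_(j <- s) f j x) = \sum_(j <- s) cI mu (f j) by [].
elim: s => [|j s [c E]].
  have -> : (fun x => \sum_(j <- [::]) f j x) = (fun _ : Rd => 0 : R[i]).
    by apply/funext => x; rewrite big_nil.
  have c0 : cint mu (fun _ : Rd => 0 : R[i]).
    apply: (cint_le (@cmeas_cst _ Rd R 0) (rint_weight R d)) => x.
    by rewrite normc0 ltW// weight_gt0.
  by split=> //; rewrite big_nil; apply: complexP => //=; rewrite /Rintegral integral0.
have -> : (fun x => \sum_(j0 <- j :: s) f j0 x) = (fun x => f j x + \sum_(j <- s) f j x).
  by apply/funext => x; rewrite big_cons.
by split; [exact: cintD|rewrite cID// E big_cons].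
Qed.

Definition clin (z : Cd) (x : Rd) : R[i] := - 'i * \sum_(j < d) z ord0 j * (x ord0 j)%:C.

Lemma clinD z h x : clin (h + z) x = clin z x + clin h x.
Proof.
rewrite /clin -mulrDr -big_split; congr (_ * _); apply: eq_bigr => j _ /=.
by rewrite mxE mulrDl addrC.
Qed.

Lemma cmeas_clin z : cmeas (clin z).
Proof.
apply: cmeasM; first exact: cmeas_cst.
apply: cmeas_sum => j; apply: cmeasM; first exact: cmeas_cst.
by apply: cmeas_real; exact: measurable_coord.
Qed.

Lemma Re_clin z x : complex.Re (clin z x) = dotr x (map_mx (@complex.Im R) z).
Proof.
rewrite /clin !ReImE Im_sum /= oppr0 mul0r sub0r mulN1r opprK /dotr; apply: eq_bigr => j _.
by rewrite ReImE /= !mxE mulr0 add0r mulrC.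
Qed.

Lemma normc_sum (I : Type) (s : seq I) (f : I -> R[i]) :
  normc (\sum_(j <- s) f j) <= \sum_(j <- s) normc (f j).
Proof.
elim: s => [|j s IH]; first by rewrite !big_nil normc0.
by rewrite !big_cons (le_trans (le_normcD _ _))// lerD2l.
Qed.

Lemma normc_i : normc ('i : R[i]) = 1.
Proof. by rewrite /= expr0n expr1n add0r sqrtr1. Qed.

Lemma normc_clin_le (M : R) (h : Cd) (x : Rd) : (forall j, `|x ord0 j| <= M) ->
  normc (clin h x) <= complex.Re `|h| * (d%:R * M).
Proof.
move=> xM; rewrite normcM normcN normc_i mul1r; apply: le_trans (normc_sum _ _) _.
have -> : complex.Re `|h| * (d%:R * M) = \sum_(j < d) complex.Re `|h| * M.
  by rewrite sumr_const card_ord -mulr_natl; ring.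
apply: ler_sum => j _; rewrite normcM normc_real ler_pM ?normc_ge0//.
exact: normc_coord_le.
Qed.

Variables (A : set Rd) (g : Rd -> R[i]).
Hypothesis cA : compact A.
Hypothesis cg : cint mu g.
Hypothesis gA : forall x, g x != 0 -> A x.

(** Since [g] vanishes off A, the multiplier has to be bounded on A only; this admits the
    exponentials exp(- i z.x), which may be unbounded on R^d. *)
Lemma cint_supp (b : Rd -> R[i]) (B : R) : cmeas b -> (forall x, A x -> normc (b x) <= B) ->
  cint mu (fun x => g x * b x) /\ normc (cI mu (fun x => g x * b x)) <= B * \int[mu]_x normc (g x).
Proof.
move=> mb bB; have le x : normc (g x * b x) <= B * normc (g x).
  rewrite normcM mulrC; have [->|gx] := eqVneq (g x) 0; first by rewrite normc0 !mulr0.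
  by rewrite ler_wpM2r ?normc_ge0//; apply/bB/gA.
have m := cmeasM cg.1 mb; have r := rintZ B cg.2; split; first exact: cint_le r le.
by apply: le_trans (normc_cI_le m r le) _; rewrite (RintegralZl _ measurableT cg.2).
Qed.

Definition fourier_laplace (z : Cd) : R[i] :=
  (ft_cst R d)%:C * cI mu (fun x => g x * cexp (clin z x)).

Lemma normc_cexp_clin z x : A x -> normc (cexp (clin z x)) <= expR (supporting_function A (map_mx (@complex.Im R) z)).
Proof. by move=> Ax; rewrite normc_cexp Re_clin ler_expR; exact: supporting_ub. Qed.

Lemma fourier_laplace_le z : normc (fourier_laplace z) <=
  ft_cst R d * (\int[mu]_x normc (g x)) * expR (supporting_function A (map_mx (@complex.Im R) z)).
Proof.
rewrite normcM normc_real gtr0_norm ?ft_cst_gt0// -mulrA ler_pM2l ?ft_cst_gt0// mulrC.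
by apply: (cint_supp _ _).2; [exact/cmeas_cexp/cmeas_clin|exact: normc_cexp_clin].
Qed.

Lemma fourier_laplace_real y : fourier_laplace (zc y 0) = ft (-1) g y.
Proof.
congr (_ * _); apply: eq_cI => x; congr (_ * _).
have E : clin (zc y 0) x = 0 +i* (-1 * dotr y x).
  apply: complexP; rewrite /clin !ReImE ?Re_sum ?Im_sum /= ?oppr0 ?mul0r ?mulN1r ?sub0r ?add0r ?opprK.
    by rewrite big1// => j _; rewrite !ReImE /= !mxE /= mulr0 mul0r addr0.
  by congr (- _); apply: eq_bigr => j _; rewrite !ReImE /= !mxE /= mulr0 subr0.
by rewrite E /cexp /= expR0 mul1r.
Qed.

Lemma compact_coord_bound : exists2 M : R, 0 < M & forall x, A x -> forall j, `|x ord0 j| <= M.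
Proof.
have [M [_ HM]] := compact_bounded cA.
exists (Num.max 1 (M + 1)); first by rewrite lt_max ltr01.
move=> x Ax j; have := HM (M + 1); rewrite ltrDl ltr01 => /(_ isT x Ax) xM.
rewrite le_max; apply/orP; right; apply: le_trans xM.
rewrite (_ : `|x| = mx_norm x) // mx_normE.
have H : (`|x ord0 j|%:nng <= \big[Num.max/0%:nng]_ij `|x ij.1 ij.2|%:nng)%R.
  by apply/bigmax_geP; right => /=; exists (ord0, j).
by move: H; rewrite -num_le.
Qed.

(** Differentiation under the integral in quantitative form: for x in A the exponent w = - i h.x is
    at most |h| N, and [cexp_sub_le] turns exp(w) - 1 - w into a remainder quadratic in h, uniformly
    in x. *)
Lemma fourier_laplace_entire : entire fourier_laplace.
Proof.
move=> z; have [M M0 HM] := compact_coord_bound.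
set E := expR (supporting_function A (map_mx (@complex.Im R) z)).
have mE := cmeas_cexp (cmeas_clin z).
have E0 : 0 <= E by exact: expR_ge0.
set S := \int[mu]_x normc (g x).
have S0 : 0 <= S by apply: Rintegral_ge0 => x _; exact: normc_ge0.
pose N := d%:R * M; have N0 : 0 <= N by rewrite mulr_ge0// ltW.
pose b j x := cexp (clin z x) * (- 'i * (x ord0 j)%:C).
have mx j : cmeas (fun x : Rd => - 'i * (x ord0 j)%:C : R[i]).
  by apply: cmeasM; [exact: cmeas_cst|apply: cmeas_real; exact: measurable_coord].
have cb j : cint mu (fun x => g x * b j x).
  apply: (cint_supp (B := E * M) _ _).1; first exact: cmeasM.
  move=> x Ax; rewrite normcM ler_pM ?normc_ge0 ?normc_cexp_clin//.
  by rewrite normcM normcN normc_i mul1r normc_real HM.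
pose c j := (ft_cst R d)%:C * cI mu (fun x => g x * b j x).
(* The radius ensures |w| <= 1/2, the range of [cexp_sub_le]. The factor E bounds exp(- i z.x) on A,
   4 N^2 bounds the remainder, and S is the L^1 norm of g. *)
apply: (@differentiable_of_remainder R d _ z c (ft_cst R d * (E * (4 * N ^+ 2) * S)) (2^-1 / (N + 1))).
- by rewrite divr_gt0// ltr_wpDl.
- apply: mulr_ge0; first exact/ltW/ft_cst_gt0.
  by apply: mulr_ge0 => //; apply: mulr_ge0 => //; apply: mulr_ge0 => //; exact: sqr_ge0.
move=> h; set n := complex.Re `|h| => hn.
have n0 : 0 <= n.
  have : 0 <= `|h| by [].
  by rewrite lecE /= => /andP[].
have nN : n * N <= 2^-1.
  move: hn; rewrite ler_pdivlMr ?ltr_wpDl// => hn; apply: le_trans hn.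
  by rewrite ler_wpM2l// lerDl.
have wle x : A x -> normc (clin h x) <= n * N by move=> Ax; apply: normc_clin_le; exact: HM.
have lin_c : coord_comb c h = (ft_cst R d)%:C * cI mu (fun x => g x * (cexp (clin z x) * clin h x)).
  rewrite /coord_comb /c (eq_bigr (fun j => (ft_cst R d)%:C * cI mu (fun x => h ord0 j * (g x * b j x)))).
    rewrite -mulr_sumr; congr (_ * _); rewrite -cI_sum; last by move=> j; exact: cintMl.
    apply: eq_cI => x; rewrite [clin h x]/clin !mulr_sumr; apply: eq_bigr => j _; rewrite /b; ring.
  by move=> j _; rewrite cIMl// mulrCA.
pose r x := cexp (clin z x) * (cexp (clin h x) - 1 - clin h x).
have mh := cmeas_clin h; have meh := cmeas_cexp mh.
have rb x : A x -> normc (r x) <= E * (4 * N ^+ 2) * n ^+ 2.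
  move=> Ax; rewrite normcM -mulrA ler_pM ?normc_ge0 ?normc_cexp_clin//.
  apply: le_trans (cexp_sub_le (le_trans (wle x Ax) nN)) _.
  rewrite -mulrA ler_pM2l// -exprMn; have := wle x Ax; rewrite mulrC => h1.
  by apply: lerXn2r h1; rewrite nnegrE ?normc_ge0// mulr_ge0.
have mr : cmeas r.
  by apply: cmeasM => //; apply: cmeasB => //; apply: cmeasB => //; exact: cmeas_cst.
have [cr rle] := cint_supp mr rb.
have c1 : cint mu (fun x => g x * cexp (clin (h + z) x)).
  by apply: (cint_supp _ _).1; [exact/cmeas_cexp/cmeas_clin|exact: normc_cexp_clin].
have c2 : cint mu (fun x => g x * cexp (clin z x)).
  by apply: (cint_supp _ _).1; [exact: mE|exact: normc_cexp_clin].
have c3 : cint mu (fun x => g x * (cexp (clin z x) * clin h x)).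
  apply: (cint_supp (B := E * (n * N)) _ _).1; first exact: cmeasM.
  by move=> x Ax; rewrite normcM ler_pM ?normc_ge0 ?normc_cexp_clin ?wle.
have -> : fourier_laplace (h + z) - fourier_laplace z - coord_comb c h =
    (ft_cst R d)%:C * cI mu (fun x => g x * r x).
  rewrite lin_c /fourier_laplace -!mulrBr; congr (_ * _).
  rewrite -(cIB c1 c2) -(cIB (cintB c1 c2) c3); apply: eq_cI => x.
  by rewrite /r clinD cexpD; ring.
rewrite normcM normc_real gtr0_norm ?ft_cst_gt0// -mulrA ler_pM2l ?ft_cst_gt0//.
by apply: le_trans rle _; rewrite -/S mulrAC.
Qed.

End fourier_laplace.

Section fourier_to_entire.
Variables (R : realType) (d : nat).
Local Notation Rd := 'rV[R]_d.
Local Notation Cd := 'rV[R[i]]_d.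
Local Notation mu := (lebesgue_rV R d).

Lemma lebesgue_measurable_cmeas (f : Rd -> R[i]) : lebesgue_measurable f ->
  exists2 f1, cmeas f1 & \forall x \ae mu, f x = f1 x.
Proof. by move=> [f1 [m1 m2 E]]; exists f1 => //; apply: filterS E => x /(_ I). Qed.

(** A test function is bounded and vanishes off the compact set K, on which the Borel representative
    f1 has the same finite integral of the modulus as f. *)
Lemma locally_integrable_test (f f1 phi : Rd -> R[i]) U : Defs.locally_integrable f ->
  cmeas f1 -> (\forall x \ae mu, f x = f1 x) -> test_function U phi ->
  cint mu (fun x => f1 x * phi x).
Proof.
move=> [_ lf] mf1 ff1 tp; have sp := test_schwartz tp; have [B B0 pB] := schwartz_bounded sp.
have [_ cK _] := tp; set K := closure _ in cK.
have clK : closed K by exact: closed_closure.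
have mK := rV_closed_measurable clK.
have i1 : rint mu (fun x => normc (f1 x * (\1_K x)%:C)).
  apply/rintP; first by move=> x; exact: normc_ge0.
  have m1 : cmeas (fun x => f1 x * (\1_K x)%:C).
    by apply: cmeasM => //; apply: cmeas_real; exact: measurable_indic.
  split; first exact: measurable_normc.
  have m2 : measurable_fun setT (fun x => (normc (f1 x * (\1_K x)%:C))%:E).
    by apply/measurable_EFinP; exact: measurable_normc.
  have E : (\int[mu]_(x in K) (normc (f x))%:E)%E = (\int[mu]_x (normc (f1 x * (\1_K x)%:C))%:E)%E.
    rewrite integral_mkcond; apply: ae_integral => //; apply: filterS ff1 => x fx.
    rewrite patchE fx indicE normcM normc_real.
    by case: ifPn => _; rewrite ?normr1 ?mulr1// normr0 mulr0.
  by rewrite -E; exact: (lf K cK).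
apply: (cint_le (cmeasM mf1 (schwartz_cmeas sp)) (rintZ B i1)) => x.
rewrite !normcM normc_real indicE; have [Kx|nK] := pselect (K x).
  by rewrite mem_set// normr1 mulr1 mulrC ler_wpM2r// normc_ge0.
have -> : phi x = 0 by apply: contra_notP nK => /eqP nz; exact: subset_closure.
by rewrite normc0 mulr0 !mulr_ge0// normc_ge0.
Qed.

Lemma fourier_exponential_type (A : set Rd) (f g : Rd -> R[i]) : A !=set0 -> compact A ->
  lebesgue_measurable f -> L2 g -> distr_support (distr_of g) `<=` A -> is_fourier_transform f g ->
  L2 f /\ exists F : Cd -> R[i], exponential_type A F /\ extends_to f F.
Proof.
move=> A0 cA mf [mg g2] gA [T [tT [lf fT] TP]].
have [g1 mg1 gg1] := lebesgue_measurable_cmeas mg.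
have [f1 mf1 ff1] := lebesgue_measurable_cmeas mf.
have sg1 : sqint g1.
  apply/rintP; first by move=> x; rewrite sqr_ge0.
  split; first by apply: measurable_funX; exact: measurable_normc.
  by rewrite -(ae_normc2 mg1 gg1); exact: g2.
have g10 : \forall x \ae mu, (~` A) x -> g1 x = 0.
  apply: kills_tests_ae => x nAx.
  have /contrapT[U [oU kU] Ux] : ~ ~ (\bigcup_(U in [set U | open U /\
      forall phi, test_function U phi -> distr_of g phi = 0]) U) x.
    by move=> ns; apply: nAx; apply: gA.
  exists U; split => // phi tp; have sp := test_schwartz tp; split.
    exact: (sqintM mg1 (schwartz_cmeas sp) sg1 (schwartz_sqint sp)).
  by rewrite -(distr_of_ae mg1 (schwartz_cmeas sp) gg1); exact: kU.
have clA : closed A by apply: compact_closed => //; exact: norm_hausdorff.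
have mA := rV_closed_measurable clA.
(* A representative of g that vanishes at every point off A, as the section on the Fourier-Laplace
   transform assumes. *)
pose h x := g1 x * (\1_A x)%:C.
have mh : cmeas h by apply: cmeasM => //; apply: cmeas_real; exact: measurable_indic.
have hA x : h x != 0 -> A x.
  apply: contra_neqP => nA; by rewrite /h indicE memNset// mulr0.
have gh : \forall x \ae mu, g x = h x.
  apply: filterS2 gg1 g10 => x -> gx; rewrite /h indicE.
  by have [Ax|nA] := pselect (A x); [rewrite mem_set// mulr1|rewrite memNset// mulr0 gx].
have hle x : normc (h x) <= normc (g1 x) by rewrite normcM ler_piMr ?normc_ge0// normc_indic.
have [M M0 HM] := compact_le_weight cA.
have ch : cint mu h.
  (* Square integrability on a compact set gives integrability: on A, |h| <= 1 + |g1|^2 <= M weight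
     + |g1|^2. *)
  apply: (cint_le mh (rintD (rintZ M (rint_weight R d)) sg1)) => x.
  have [Ax|nA] := pselect (A x); last first.
    have -> : h x = 0 by rewrite /h indicE memNset// mulr0.
    by rewrite normc0 addr_ge0 ?sqr_ge0// mulr_ge0// ltW// weight_gt0.
  apply: le_trans (hle x) _; apply: le_trans (_ : 1 + normc (g1 x) ^+ 2 <= _); last by rewrite lerD2r HM.
  have := sqr_ge0 (normc (g1 x) - 1); have := normc_ge0 (g1 x); nra.
have sh : sqint h.
  apply: (rint_le _ sg1) => [|x]; first by apply: measurable_funX; exact: measurable_normc.
  by rewrite ger0_norm ?sqr_ge0// lerXn2r ?nnegrE ?normc_ge0.
pose F0 := ft (-1) h.
have mF0 : cmeas F0 by exact: cmeas_ft.
(* The difference is tested on the whole space: f1 pairs with phi through T, hence through the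
   transform of phi, and the multiplication formula gives the same value for F0. *)
have f1F0 : \forall x \ae mu, setT x -> f1 x - F0 x = 0.
  apply: kills_tests_ae => x _; exists setT; split => //; first exact: openT.
  move=> phi tp; have sp := test_schwartz tp; have cp := schwartz_cint sp.
  have c1 := locally_integrable_test lf mf1 ff1 tp.
  have c2 : cint mu (fun x => F0 x * phi x).
    have := cintMb cp mF0 (fun y => ft_le (-1) y ch).
    by congr (cint _ _); apply/funext => y; rewrite mulrC.
  have E : (fun x => (f1 x - F0 x) * phi x) = (fun x => f1 x * phi x - F0 x * phi x).
    by apply/funext => y; rewrite mulrBl.
  rewrite E; split; first exact: cintB.
  rewrite (cIB c1 c2) (ft_multiplication (-1) ch cp).
  have e1 : cI mu (fun x => f1 x * phi x) = T phi.
    by apply/esym/(eq_trans (fT phi tp)); exact: (distr_of_ae mf1 (schwartz_cmeas sp) ff1).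
  have e2 : T phi = cI mu (fun x => h x * ft (-1) phi x).
    apply: (eq_trans (TP phi sp)); rewrite /distr_fourier fourierE.
    exact: (distr_of_ae mh (cmeas_ft (-1) cp) gh).
  by rewrite e1 e2 subrr.
have fF0 : \forall x \ae mu, f x = F0 x.
  by apply: filterS2 ff1 f1F0 => x -> /(_ I)/eqP; rewrite subr_eq0 => /eqP.
split.
  split => //; apply: (@le_lt_trans _ _ (\int[mu]_x (normc (h x) ^+ 2)%:E)%E).
    have m1 : (-1) ^+ 2 = 1 :> R by rewrite sqrrN expr1n.
    by rewrite (ae_normc2 mF0 fF0); exact: plancherel_le.
  exact: ((rintP mu (fun x => sqr_ge0 (normc (h x)))).1 sh).2.
exists (fourier_laplace h); split; last first.
  by apply: filterS fF0 => x ->; rewrite -zc_real fourier_laplace_real.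
split; first exact: (fourier_laplace_entire cA ch hA).
(* The added 1 keeps the constant strictly positive even when g is 0 almost everywhere. *)
exists (ft_cst R d * (\int[mu]_x normc (h x)) + 1).
  by rewrite ltr_wpDl// mulr_ge0 ?(ltW (ft_cst_gt0 R d))//; apply: Rintegral_ge0 => x _; exact: normc_ge0.
move=> z; apply: le_trans (fourier_laplace_le cA ch hA z) _.
by rewrite ler_wpM2r ?expR_ge0// lerDl.
Qed.

End fourier_to_entire.

Theorem theorem3p5 (R : realType) (d : nat) (A : set 'rV[R]_d)
  (f : 'rV[R]_d -> R[i])
  (A_nonempty : A !=set0)
  (A_compact : compact A)
  (A_convex : convex_set (A : set (convex_lmodType 'rV[R]_d)))
  (A_symmetric : A = [set - a | a in A])
  (f_measurable : lebesgue_measurable f)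
  (f_tempered : exists T, tempered T /\ represents f T) :
  (exists g : 'rV[R]_d -> R[i],
     [/\ L2 g, distr_support (distr_of g) `<=` A & is_fourier_transform f g])
  <->
  (L2 f /\
   exists F : 'rV[R[i]]_d -> R[i], exponential_type A F /\ extends_to f F).
Proof.
split.
  move=> [g [g2 gA fg]].
  exact: (fourier_exponential_type A_nonempty A_compact f_measurable g2 gA fg).
move=> [f2 [F [FA fF]]].
exact: (exponential_type_fourier A_nonempty A_compact A_convex f2 FA fF).
Qed.
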